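(* Let $Y^3$ be a minimal surface in a conformally compact Einstein manifold $(X^{d+1},g_+)$, asymptotic to a surface $\Sigma^2\subset M^d$ and of the form $Y=(x,u(x,r),r)$ near the boundary of $X$ in an adapted chart, where $$u(x,r)=\tfrac14H(x)r^2+w_2(x)r^4\log r+u^{(4)}(x)r^4+\cdots.$$ Then $$\begin{aligned} -16w_2^\alpha={}&\Delta^\perp H^\alpha+g^{ij}g^{kl}\langle A_{ik},H\rangle A_{jl}^\alpha-\frac12|H|^2H^\alpha\\ &+g^{ij}\overline g^{\alpha\gamma}H^\beta\overline W_{i\beta j\gamma}-2\overline g^{\alpha\gamma}\overline P_{\beta\gamma}H^\beta-g^{ij}\overline P_{ij}H^\alpha+4g^{ik}g^{jl}\overline P_{kl}A_{ij}^\alpha\\ &+2\overline g^{\alpha\gamma}g^{ij}\big(\overline\nabla_\gamma\overline P_{ij}-2\overline\nabla_i\overline P_{j\gamma}\big). \end{aligned}$$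
   Context: Setting: $\overline X$ is a $(d+1)$-manifold ($d\ge3$) with boundary $M^d$ and interior $X$; $g_+$ is a conformally compact Einstein metric on $X$: $\mathrm{Ric}(g_+)=-d\,g_+$ and $\rho^2g_+$ extends to a metric on $\overline X$ for any defining function $\rho$ ($\rho>0$ on $X$, $\rho=0$ and $d\rho\ne0$ on $M$). The conformal infinity is the conformal class of $(\rho^2g_+)|_{TM}$. Fix a metric $\overline g$ in it. The special defining function $r$ is the one, uniquely determined near $M$, with $(r^2g_+)|_{TM}=\overline g$ and $|dr|_{r^2g_+}=1$. The flow of the $r^2g_+$-gradient of $r$ identifies a neighborhood of $M$ in $\overline X$ with $M\times[0,\epsilon)$, where $r^2g_+=dr^2+\widetilde g$, $\widetilde g=\overline g+g^{(2)}r^2+\cdots$ with $g^{(2)}=-\overline P$. $\Sigma^2\subset M^d$ has induced metric $g=\overline g|_\Sigma$. Adapted chart: local coordinates $(x^i,y^\alpha)$ of $M$, $1\le i\le2$, $3\le\alpha\le d$, with $\Sigma=\{y=0\}$ and $\overline g(\partial_{x^i},\partial_{y^\alpha})=0$ on $\Sigma$; extended with $r$ to coordinates of $\overline X$ by the identification above. $Y=(x,u(x,r),r)$ means that $Y$ is the graph $y^\alpha=u^\alpha(x,r)$. Latin indices are tangential, Greek indices normal, repeated indices are summed. $A_{ij}^\alpha=\overline g^{\alpha\beta}\overline g(\overline\nabla_i\partial_j,\partial_\beta)$ is the second fundamental form of $\Sigma\subset(M,\overline g)$, $H^\alpha=g^{ij}A_{ij}^\alpha$ the mean curvature vector, $\langle\cdot,\cdot\rangle$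 and $|\cdot|$ are with respect to $\overline g$; $\nabla^\perp$ is the normal connection and $\Delta^\perp=g^{ij}\nabla_i^\perp\nabla_j^\perp$; $\overline\nabla$ is the Levi-Civita connection of $\overline g$. $\overline P=\frac1{d-2}\big(\overline{\mathrm{Ric}}-\frac{\overline R}{2(d-1)}\overline g\big)$ is the Schouten tensor and $\overline W$ the Weyl tensor, with $\overline R_{ABCD}=\overline W_{ABCD}+\overline P_{AC}\overline g_{BD}+\overline P_{BD}\overline g_{AC}-\overline P_{AD}\overline g_{BC}-\overline P_{BC}\overline g_{AD}$, where $\overline R_{ABCD}=\overline g\big((\overline\nabla_A\overline\nabla_B-\overline\nabla_B\overline\nabla_A)\partial_D,\partial_C\big)$. All quantities are evaluated on $\Sigma$. *)

(* Defs.v *)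
From HB Require Import structures.
From mathcomp Require Import all_boot all_order all_algebra.
From mathcomp Require Import all_classical all_reals all_analysis.

Set Implicit Arguments.
Unset Strict Implicit.
Unset Printing Implicit Defensive.
Import Order.TTheory GRing.Theory Num.Theory.
Import numFieldNormedType.Exports.
Local Open Scope classical_set_scope.
Local Open Scope ring_scope.

(* Everything is written in coordinates: a point is a row vector, and a metric
   is a matrix-valued function of the point. *)

Definition pd (R : realType) (N : nat) (i : 'I_N) (f : 'rV[R]_N -> R)
    (z : 'rV[R]_N) : R :=
  'D_(delta_mx 0 i) f z.

(* Intended for open D. *)
Fixpoint Ck (R : realType) (N k : nat) (D : set 'rV[R]_N)
    (f : 'rV[R]_N -> R) {struct k} : Prop :=
  (forall z, D z -> {for z, continuous f}) /\
  (if k is k'.+1 then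
     forall i : 'I_N, (forall z, D z -> derivable f z (delta_mx 0 i)) /\
                      Ck k' D (pd i f)
   else True).

(* C^k on an arbitrary D, in particular up to the boundary of a half-space:
   f has a C^k extension to a neighborhood of each point of D. *)
Definition Ck_on (R : realType) (N k : nat) (D : set 'rV[R]_N)
    (f : 'rV[R]_N -> R) : Prop :=
  forall z, D z -> exists O : set 'rV[R]_N, exists f' : 'rV[R]_N -> R,
    [/\ open O, O z, Ck k O f' & forall y, O y -> D y -> f y = f' y].

Section Riemannian.
Context (R : realType) (N : nat).
Implicit Types (g T : 'rV[R]_N -> 'M[R]_N) (z : 'rV[R]_N).

(* Gamma^k_{ij}, upper index first. *)
Definition christoffel g z (k i j : 'I_N) : R :=
  2^-1 * \sum_l invmx (g z) k l *
    (pd i (fun y => g y j l) z + pd j (fun y => g y i l) z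
     - pd l (fun y => g y i j) z).

(* The e-th component of (nabla_a nabla_b - nabla_b nabla_a) d_d. *)
Definition curvature g z (a b d e : 'I_N) : R :=
  pd a (fun y => christoffel g y e b d) z
  - pd b (fun y => christoffel g y e a d) z
  + \sum_f (christoffel g z f b d * christoffel g z e a f
            - christoffel g z f a d * christoffel g z e b f).

(* R_{abcd} = g((nabla_a nabla_b - nabla_b nabla_a) d_d, d_c), so that the unit
   sphere has R_{abcd} = g_{ac} g_{bd} - g_{ad} g_{bc}. *)
Definition riemann g z (a b c d : 'I_N) : R :=
  \sum_e curvature g z a b d e * g z e c.

Definition ricci g z : 'M[R]_N :=
  \matrix_(b, d) \sum_a \sum_c invmx (g z) a c * riemann g z a b c d.

Definition scalar_curvature g z : R :=
  \sum_a \sum_b invmx (g z) a b * ricci g z a b.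

Definition schouten g z : 'M[R]_N :=
  (N%:R - 2)^-1 *:
    (ricci g z - (scalar_curvature g z / (2 * (N%:R - 1))) *: g z).

Definition weyl g z (a b c d : 'I_N) : R :=
  let P := schouten g z in
  riemann g z a b c d
  - (P a c * g z b d + P b d * g z a c - P a d * g z b c - P b c * g z a d).

(* (nabla_c T)_{ab}, index of differentiation first. *)
Definition cov_deriv2 g T z (c a b : 'I_N) : R :=
  pd c (fun y => T y a b) z
  - \sum_e (christoffel g z e c a * T z e b + christoffel g z e c b * T z a e).

Definition inner g z (v w : 'rV[R]_N) : R := (v *m g z *m w^T) 0 0.

Definition is_einstein_on (D : set 'rV[R]_N) (c : R) g : Prop :=
  forall z, D z -> ricci g z = c *: g z.

Section Immersion.
Context (m : nat).
Implicit Types (F : 'rV[R]_m -> 'rV[R]_N) (s : 'rV[R]_m).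

Definition tangent F s (a : 'I_m) : 'rV[R]_N :=
  \row_K pd a (fun t => F t 0 K) s.

Definition first_form g F s : 'M[R]_m :=
  \matrix_(a, b) inner g (F s) (tangent F s a) (tangent F s b).

(* nabla_{d_a F} d_b F *)
Definition cov_hessian g F s (a b : 'I_m) : 'rV[R]_N :=
  \row_K (pd a (fun t => tangent F t b 0 K) s
          + \sum_L \sum_M christoffel g (F s) K L M
                          * tangent F s a 0 L * tangent F s b 0 M).

Definition normal_part g F s (v : 'rV[R]_N) : 'rV[R]_N :=
  v - \sum_a \sum_b (invmx (first_form g F s) a b
                     * inner g (F s) v (tangent F s a)) *: tangent F s b.

Definition mean_curvature g F s : 'rV[R]_N :=
  \sum_a \sum_b invmx (first_form g F s) a b *:
    normal_part g F s (cov_hessian g F s a b).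

Definition is_minimal_on (D : set 'rV[R]_m) g F : Prop :=
  forall s, D s -> mean_curvature g F s = 0.

End Immersion.
End Riemannian.

Definition is_metric_on (R : realType) (N p : nat) (D : set 'rV[R]_p)
    (g : 'rV[R]_p -> 'M[R]_N) : Prop :=
  forall z, D z -> (g z)^T = g z /\
    forall v : 'rV[R]_N, v != 0 -> 0 < (v *m g z *m v^T) 0 0.

(* Points of R^m x R, the last coordinate being r. *)
Section Collar.
Context (R : realType) (m : nat).
Implicit Types (w : 'rV[R]_(m + 1)).

Definition r_index : 'I_(m + 1) := rshift m ord0.
Definition r_coord w : R := w 0 r_index.
Definition at_r (z : 'rV[R]_m) (r : R) : 'rV[R]_(m + 1) :=
  row_mx z (const_mx r).

Definition collar (D : set 'rV[R]_m) (e : R) : set 'rV[R]_(m + 1) :=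
  [set w | D (lsubmx w) /\ 0 <= r_coord w < e].
Definition open_collar (D : set 'rV[R]_m) (e : R) : set 'rV[R]_(m + 1) :=
  [set w | D (lsubmx w) /\ 0 < r_coord w < e].

Definition bderiv (i : 'I_(m + 1)) (f : 'rV[R]_(m + 1) -> R) w : R :=
  (if i == r_index then r_coord w else 1) * pd i f w.

(* The remainder of a polyhomogeneous expansion: f = o(r^k) at z, and the same
   for the derivatives of f of order <= 2 along d/dx^i and r d/dr. *)
Definition remainder_o (k : nat) (f : 'rV[R]_(m + 1) -> R) (z : 'rV[R]_m)
    : Prop :=
  forall l : seq 'I_(m + 1), (size l <= 2)%N ->
    (fun r : R => foldr bderiv f l (at_r z r) / r ^+ k) @ 0^'+ --> (0 : R).

(* gt is the family of metrics gtilde = gtilde_r on R^m;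
   g_+ = r^-2 (dr^2 + gtilde). *)
Definition g_plus (gt : 'rV[R]_(m + 1) -> 'M[R]_m) w : 'M[R]_(m + 1) :=
  (r_coord w) ^- 2 *: block_mx (gt w) 0 0 1%:M.

Definition boundary_metric (gt : 'rV[R]_(m + 1) -> 'M[R]_m) (z : 'rV[R]_m)
    : 'M[R]_m :=
  gt (at_r z 0).

End Collar.

(* Sigma = {y = 0} in R^2 x R^n with coordinates (x, y) and metric g. *)
Section Surface.
Context (R : realType) (n : nat).
Implicit Types (g : 'rV[R]_(2 + n) -> 'M[R]_(2 + n)) (x : 'rV[R]_2).
Implicit Types (i j k : 'I_2) (alpha beta gamma : 'I_n).

Definition tan_ix (i : 'I_2) : 'I_(2 + n) := lshift n i.
Definition nor_ix (alpha : 'I_n) : 'I_(2 + n) := rshift 2 alpha.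

Definition sigma_pt x : 'rV[R]_(2 + n) := row_mx x 0.

Definition is_adapted (V : set 'rV[R]_(2 + n)) g : Prop :=
  forall x, V (sigma_pt x) -> forall i alpha,
    g (sigma_pt x) (tan_ix i) (nor_ix alpha) = 0.

Definition sigma_metric g x : 'M[R]_2 := ulsubmx (g (sigma_pt x)).
Definition ginv_tan g x (i j : 'I_2) : R := invmx (sigma_metric g x) i j.
Definition ginv_nor g x (alpha beta : 'I_n) : R :=
  invmx (g (sigma_pt x)) (nor_ix alpha) (nor_ix beta).

(* g^{alpha beta} g(nabla_A d_B, d_beta) on Sigma *)
Definition nabla_nor g x (A B : 'I_(2 + n)) alpha : R :=
  \sum_beta ginv_nor g x alpha beta *
    \sum_C christoffel g (sigma_pt x) C A B
           * g (sigma_pt x) C (nor_ix beta).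

Definition second_form g x i j : 'rV[R]_n :=
  \row_alpha nabla_nor g x (tan_ix i) (tan_ix j) alpha.

Definition Hvec g x : 'rV[R]_n :=
  \sum_i \sum_j ginv_tan g x i j *: second_form g x i j.

Definition nor_inner g x (v w : 'rV[R]_n) : R :=
  \sum_alpha \sum_beta
    g (sigma_pt x) (nor_ix alpha) (nor_ix beta) * v 0 alpha * w 0 beta.

Definition nabla_perp g (nu : 'rV[R]_2 -> 'rV[R]_n) x i : 'rV[R]_n :=
  \row_alpha (pd i (fun y => nu y 0 alpha) x
    + \sum_beta nabla_nor g x (tan_ix i) (nor_ix beta) alpha * nu x 0 beta).

(* g^{ij} nabla^perp_i nabla^perp_j is the trace of the second covariant
   derivative, the index j being differentiated by the Levi-Civita connection
   of Sigma. *)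
Definition laplace_perp g (nu : 'rV[R]_2 -> 'rV[R]_n) x : 'rV[R]_n :=
  \sum_i \sum_j ginv_tan g x i j *:
    (nabla_perp g (fun y => nabla_perp g nu y j) x i
     - \sum_k christoffel (sigma_metric g) x k i j *: nabla_perp g nu x k).

Definition graph (u : 'rV[R]_(2 + 1) -> 'rV[R]_n) (s : 'rV[R]_(2 + 1))
    : 'rV[R]_(2 + n + 1) :=
  at_r (row_mx (lsubmx s) (u s)) (r_coord s).

Definition u_expansion g (w2 u4 : 'rV[R]_2 -> 'rV[R]_n) (s : 'rV[R]_(2 + 1))
    : 'rV[R]_n :=
  let x := lsubmx s in let r := r_coord s in
  (4^-1 * r ^+ 2) *: Hvec g x + (r ^+ 4 * ln r) *: w2 x + r ^+ 4 *: u4 x.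

End Surface.

(* Main.v *)
(* In the coordinates (x, y, r) the Christoffel symbols of
   g_+ = r^-2 (dr^2 + gt) are those of the slice metrics gt_r, plus d_r gt terms,
   plus explicit multiples of 1 / r. Feeding them into Ric(g_+) = - d g_+ and
   letting r -> 0 gives d_r gt = 0 and d_r^2 gt = - 2 P at r = 0.

   For the graph of u, minimality is equivalent to the vanishing of the normal
   components of the trace of the Hessian, an equation
     hb^{ab} X_ab = 3 u_r / r,
   where hb is the first fundamental form for dr^2 + gt and X is bounded as
   r -> 0. Along the curve r |-> (x, u(x, r), r) every ingredient has an
   expansion a + b r^2 + o(r^2). The r^2 coefficient of the equation is linear
   in w_2, because u_rr - 3 u_r / r maps r^4 log r to 4 r^2 and kills r^4; its
   other terms involve the first two derivatives of H, one derivative of the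
   Christoffel symbols in the direction H, and P, DP. Collecting the first two
   groups into the Jacobi operator of Sigma produces the normal Laplacian and a
   curvature term, whose trace-free part is the Weyl term. *)

(* Regularity shapes the argument. The Einstein equation is given only for r > 0, the metric is C^3
   up to the boundary only through local extensions that are arbitrary for r < 0, and u need not be
   C^4 at r = 0 because of the logarithm. So x is fixed, and every ingredient is followed along one
   curve as r -> 0+. [jet] records a + b r^2 + o(r^2); factors that are only O(r), or only
   convergent, enter through products that still have a jet. The derivative u_rr has no jet of its
   own, since it contains r^2 log r, and is kept together with -3 u_r / r.

   The curve leaves the ray over x in the direction H / 4 at order r^2. This is the origin of the
   quarters; the result is four times the r^2 coefficient of the equation, and -16 = -4 * 4 with one
   4 from r^4 log r and one from clearing the quarter.

   Two corrections become visible only after this multiplication. [jacobi_identity] contributes -1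
   times the quadratic term in the second fundamental form, and the expansion of the inverse first
   fundamental form adds 2, leaving +1. The terms trace(P) H and P(H) appear with twice their final
   coefficients, and half of each is absorbed when the curvature is split into its Weyl and Schouten
   parts. *)
Require Import Defs.
From mathcomp Require Import all_boot all_order all_algebra.
From mathcomp Require Import all_classical all_reals all_analysis.
From mathcomp Require Import ring lra.

Set Implicit Arguments.
Unset Strict Implicit.
Unset Printing Implicit Defensive.
Import Order.TTheory GRing.Theory Num.Theory.
Import numFieldNormedType.Exports.
Local Open Scope classical_set_scope.
Local Open Scope ring_scope.

(** * Differential calculus in coordinates *)

Section PartialDerivatives.
Context (R : realType) (N : nat).
Implicit Types (f g : 'rV[R]_N -> R) (z : 'rV[R]_N) (D : set 'rV[R]_N).
Implicit Types (i j : 'I_N) (k : nat).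

Lemma open_near_eq (T : Type) D (f g : 'rV[R]_N -> T) z :
  open D -> D z -> (forall y, D y -> f y = g y) -> {near z, f =1 g}.
Proof. by move=> Do Dz fg; near do apply: fg; exact: open_nbhs_nbhs. Unshelve. all: by end_near. Qed.

Lemma near_continuous_at f g z : {near z, f =1 g} ->
  {for z, continuous f} -> {for z, continuous g}.
Proof.
move=> fg h; have e : f z = g z by apply: nbhs_singleton fg.
move: h; rewrite /prop_for /continuous_at e => h.
exact: cvg_trans (near_eq_cvg fg) h.
Qed.

Lemma pd_near i f g z : {near z, f =1 g} -> pd i f z = pd i g z.
Proof. exact: near_eq_derive. Qed.

Lemma near_pd_near i f g z :
  {near z, f =1 g} -> {near z, pd i f =1 pd i g}.
Proof.
move=> /near_join fg; near=> y; apply: pd_near; near: y.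
exact: fg.
Unshelve. all: by end_near. Qed.

Lemma pd_on i D f g z :
  open D -> D z -> (forall y, D y -> f y = g y) -> pd i f z = pd i g z.
Proof. by move=> Do Dz fg; apply/pd_near/(open_near_eq Do Dz). Qed.

Lemma Ck_cont k D f z : Ck k D f -> D z -> {for z, continuous f}.
Proof. by case: k => [|k] [h _]; apply: h. Qed.

Lemma Ck_pd k D f i : Ck k.+1 D f -> Ck k D (pd i f).
Proof. by case=> _ /(_ i) []. Qed.

Lemma Ck_derivable k D f i z : Ck k.+1 D f -> D z -> derivable f z (delta_mx 0 i).
Proof. by case=> _ /(_ i) [+ _]; apply. Qed.

Lemma Ck_S k D f : Ck k.+1 D f -> Ck k D f.
Proof.
elim: k f => [|k IH] f [h1 h2]; split=> // i.
by have [d1 d2] := h2 i; split=> //; apply: IH.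
Qed.

Lemma Ck_le k l D f : (k <= l)%N -> Ck l D f -> Ck k D f.
Proof.
move=> /subnK <-; elim: (l - k)%N => [//|m IH] h.
by apply/IH/Ck_S; rewrite -addSn.
Qed.

Lemma Ck_sub k D D' f : (forall z, D' z -> D z) -> Ck k D f -> Ck k D' f.
Proof.
move=> s; elim: k f => [|k IH] f [h1 h2]; split=> //; try by move=> z /s /h1.
by move=> i; have [d1 d2] := h2 i; split=> [z /s /d1//|]; apply: IH.
Qed.

(** Continuity and directional derivatives at a point see only a neighborhood. Formulas that are
    valid only on [D], such as the cofactor formula for an inverse, can therefore be substituted. *)
Lemma Ck_ext k D f g : open D -> (forall z, D z -> f z = g z) ->
  Ck k D f -> Ck k D g.
Proof.
move=> Do; elim: k f g => [|k IH] f g fg [h1 h2]; split.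
- by move=> z Dz; apply: near_continuous_at (h1 z Dz); exact: (open_near_eq Do Dz).
- by [].
- by move=> z Dz; apply: near_continuous_at (h1 z Dz); exact: (open_near_eq Do Dz).
move=> i; have [d1 d2] := h2 i; split=> [z Dz|].
  by apply: near_eq_derivable (d1 _ Dz); apply: (open_near_eq Do Dz).
by apply: IH d2 => z Dz; apply: (pd_on _ Do Dz).
Qed.

Lemma pd_cst (c : R) i z : pd i (fun _ => c) z = 0.
Proof. exact: derive_cst. Qed.

Lemma pd_cst_fun (c : R) i : pd i (fun _ : 'rV[R]_N => c) = fun _ => 0.
Proof. by apply/funext=> z; exact: pd_cst. Qed.

Lemma Ck_cst k D (c : R) : Ck k D (fun _ => c).
Proof.
elim: k c => [|k IH] c; split=> //; try by move=> z _; exact: cst_continuous.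
by move=> i; split; [move=> z _; exact: derivable_cst | rewrite pd_cst_fun].
Qed.

Lemma pd_add D i f g z : Ck 1 D f -> Ck 1 D g -> D z ->
  pd i (fun y => f y + g y) z = pd i f z + pd i g z.
Proof. by move=> hf hg Dz; apply: deriveD; [apply: Ck_derivable hf Dz|apply: Ck_derivable hg Dz]. Qed.

Lemma pd_sub D i f g z : Ck 1 D f -> Ck 1 D g -> D z ->
  pd i (fun y => f y - g y) z = pd i f z - pd i g z.
Proof. by move=> hf hg Dz; apply: deriveB; [apply: Ck_derivable hf Dz|apply: Ck_derivable hg Dz]. Qed.

Lemma pd_mul D i f g z : Ck 1 D f -> Ck 1 D g -> D z ->
  pd i (fun y => f y * g y) z = pd i f z * g z + f z * pd i g z.
Proof.
move=> hf hg Dz; rewrite [LHS](deriveM (Ck_derivable (i := i) hf Dz) (Ck_derivable (i := i) hg Dz)).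
by rewrite addrC mulrC.
Qed.

Lemma pd_scale D i (c : R) f z : Ck 1 D f -> D z ->
  pd i (fun y => c * f y) z = c * pd i f z.
Proof. by move=> hf Dz; rewrite (pd_mul _ (Ck_cst 1 D c) hf)// pd_cst mul0r add0r. Qed.

Lemma pd_inv D i f z : Ck 1 D f -> D z -> f z != 0 ->
  pd i (fun y => (f y)^-1) z = - (f z)^-1 ^+ 2 * pd i f z.
Proof.
move=> hf Dz fz; rewrite [LHS](deriveV fz (Ck_derivable (i := i) hf Dz)).
by rewrite exprVn.
Qed.

Lemma CkD k D f g : open D -> Ck k D f -> Ck k D g -> Ck k D (fun z => f z + g z).
Proof.
move=> Do; elim: k f g => [|k IH] f g hf hg; split=> //;
  try by move=> z Dz; apply: continuousD; [apply: Ck_cont hf Dz|apply: Ck_cont hg Dz].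
move=> i; split.
  by move=> z Dz; apply: derivableD; [apply: Ck_derivable hf Dz|apply: Ck_derivable hg Dz].
apply: (@Ck_ext _ _ (fun z => pd i f z + pd i g z)) => //.
  by move=> z Dz; rewrite -(pd_add i (Ck_le _ hf) (Ck_le _ hg) Dz).
by apply: IH; apply: Ck_pd.
Qed.

Lemma CkM k D f g : open D -> Ck k D f -> Ck k D g -> Ck k D (fun z => f z * g z).
Proof.
move=> Do; elim: k f g => [|k IH] f g hf hg; split=> //;
  try by move=> z Dz; apply: continuousM; [apply: Ck_cont hf Dz|apply: Ck_cont hg Dz].
move=> i; split.
  by move=> z Dz; apply: derivableM; [apply: Ck_derivable hf Dz|apply: Ck_derivable hg Dz].
apply: (@Ck_ext _ _ (fun z => pd i f z * g z + f z * pd i g z)) => //.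
  by move=> z Dz; rewrite -(pd_mul i (Ck_le _ hf) (Ck_le _ hg) Dz).
by apply: CkD => //; apply: IH; (apply: Ck_pd || apply: Ck_S).
Qed.

Lemma CkN k D f : open D -> Ck k D f -> Ck k D (fun z => - f z).
Proof.
move=> Do hf; apply: (@Ck_ext _ _ (fun z => -1 * f z)) => //.
  by move=> z _; rewrite mulN1r.
by apply: CkM => //; exact: Ck_cst.
Qed.

Lemma CkB k D f g : open D -> Ck k D f -> Ck k D g -> Ck k D (fun z => f z - g z).
Proof. by move=> Do hf hg; apply: CkD => //; apply: CkN. Qed.

Lemma CkV k D f : open D -> (forall z, D z -> f z != 0) -> Ck k D f ->
  Ck k D (fun z => (f z)^-1).
Proof.
move=> Do f0; elim: k => [|k IH] hf; split=> //;
  try by move=> z Dz; apply: continuousV; [exact: f0 | exact: Ck_cont hf Dz].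
move=> i; split.
  by move=> z Dz; apply: derivableV; [exact: f0 | exact: Ck_derivable hf Dz].
apply: (@Ck_ext _ _ (fun z => - (((f z)^-1 * (f z)^-1) * pd i f z))) => //.
  move=> z Dz; rewrite (pd_inv i (Ck_le _ hf) Dz) ?f0//.
  by rewrite expr2 mulNr.
have ih := IH (Ck_S hf).
by apply: CkN => //; apply: CkM => //; [apply: CkM|apply: Ck_pd].
Qed.

Lemma Ck_sum (I : Type) (r : seq I) (P : pred I) k D (F : I -> 'rV[R]_N -> R) :
  open D -> (forall l, P l -> Ck k D (F l)) ->
  Ck k D (fun z => \sum_(l <- r | P l) F l z).
Proof.
move=> Do h; elim: r => [|a r IH].
  by under eq_fun do rewrite big_nil; exact: Ck_cst.
under eq_fun do rewrite big_cons.
by case Pa: (P a) => //; apply: CkD => //; apply: h.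
Qed.

Lemma Ck_bigsum (I : finType) k D (F : I -> 'rV[R]_N -> R) :
  open D -> (forall l, Ck k D (F l)) -> Ck k D (fun z => \sum_l F l z).
Proof. by move=> Do h; apply: Ck_sum. Qed.

Lemma Ck_prod (I : Type) (r : seq I) (P : pred I) k D (F : I -> 'rV[R]_N -> R) :
  open D -> (forall l, P l -> Ck k D (F l)) ->
  Ck k D (fun z => \prod_(l <- r | P l) F l z).
Proof.
move=> Do h; elim: r => [|a r IH].
  by under eq_fun do rewrite big_nil; exact: Ck_cst.
under eq_fun do rewrite big_cons.
by case Pa: (P a) => //; apply: CkM => //; apply: h.
Qed.

Lemma pd_bigsum (I : finType) D (F : I -> 'rV[R]_N -> R) i z :
  open D -> (forall l, Ck 1 D (F l)) -> D z ->
  pd i (fun y => \sum_l F l y) z = \sum_l pd i (F l) z.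
Proof.
move=> Do h Dz; elim: (index_enum I) => [|a r IH].
  rewrite big_nil -[RHS](pd_cst 0 i z).
  by congr (pd _ _ _); apply/funext=> y; rewrite big_nil.
rewrite big_cons -IH -(pd_add _ (h a) _ Dz); last exact: Ck_sum.
by congr (pd _ _ _); apply/funext=> y; rewrite big_cons.
Qed.

Lemma pd_coord i j z : pd i (fun y => y 0 j) z = (i == j)%:R.
Proof.
rewrite /pd /derive; apply: cvg_lim => //.
apply: (@cvg_trans _ ((fun _ : R => (i == j)%:R : R) @ 0^')); last exact: cvg_cst.
apply: near_eq_cvg; near=> h.
rewrite /= !mxE eqxx /= addrK.
have h0 : h != 0 by near: h; exact: nbhs_dnbhs_neq.
by rewrite /GRing.scale /= mulrA mulVf// mul1r eq_sym.
Unshelve. all: by end_near. Qed.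

Lemma derivable_coord_fun i j z :
  derivable (fun y : 'rV[R]_N => y 0 j) z (delta_mx 0 i).
Proof. exact/diff_derivable/differentiable_coord. Qed.

Lemma Ck_coord k D j : Ck k D (fun y => y 0 j).
Proof.
case: k => [|k]; split=> //; try by move=> z _; exact: coord_continuous.
move=> i; split; first by move=> z _; exact: derivable_coord_fun.
rewrite (_ : pd i _ = fun _ => (i == j)%:R); first exact: Ck_cst.
by apply/funext=> z; exact: pd_coord.
Qed.

Lemma Ck_det k D n (A : 'rV[R]_N -> 'M[R]_n) : open D ->
  (forall a b, Ck k D (fun z => A z a b)) -> Ck k D (fun z => \det (A z)).
Proof.
move=> Do h; apply: Ck_sum => // s _; apply: CkM => //; first exact: Ck_cst.
by apply: Ck_prod.
Qed.

(** Cramer's rule makes each entry a polynomial in the entries of [A] divided by the determinant.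
    [invmx] is given by this formula only at invertible matrices, hence the passage through
    [Ck_ext]. *)
Lemma Ck_invmx k D n (A : 'rV[R]_N -> 'M[R]_n) : open D ->
  (forall z, D z -> A z \in unitmx) ->
  (forall a b, Ck k D (fun z => A z a b)) ->
  forall a b, Ck k D (fun z => invmx (A z) a b).
Proof.
move=> Do u h a b.
apply: (@Ck_ext _ _ (fun z => (\det (A z))^-1 *
   ((-1) ^+ (b + a) * \det (row' b (col' a (A z)))))) => //.
  by move=> z Dz; rewrite /invmx (u z Dz) !mxE.
apply: CkM => //.
  apply: CkV => //; last exact: Ck_det.
  by move=> z /u; rewrite unitmxE unitfE.
apply: CkM => //; first exact: Ck_cst.
apply: Ck_det => // c d; rewrite (_ : (fun _ => _) = (fun z => A z (lift b c) (lift a d))) //.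
by apply/funext => z; rewrite !mxE.
Qed.

End PartialDerivatives.

(** * Directional derivatives as properties of a line *)

Section GrowthRate.
Context (R : realType) (V V' : normedModType R) (f : V -> R) (g : V' -> R).
Context (a v : V) (b w : V').
Hypothesis fg : forall h : R, f (h *: v + a) = g (h *: w + b).

Let growth_rate : (fun h : R => h^-1 *: ((f \o shift a) (h *: v) - f a)) =
  (fun h : R => h^-1 *: ((g \o shift b) (h *: w) - g b)).
Proof.
apply/funext=> h /=; rewrite fg.
by have := fg 0; rewrite !scale0r !add0r => ->.
Qed.

(** A directional derivative is a limit of difference quotients on one line, so two functions on
    different spaces that agree along matching lines share it. For affine embeddings and projections
    this replaces the chain rule. *)
Lemma derive_same_line : 'D_v f a = 'D_w g b.
Proof. by rewrite /derive growth_rate. Qed.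

Lemma derivable_same_line : derivable g b w -> derivable f a v.
Proof. by rewrite /derivable growth_rate. Qed.

End GrowthRate.

Section MeanValue.
Context (R : realType) (N : nat).
Implicit Types (f g : 'rV[R]_N -> R) (z v : 'rV[R]_N) (D : set 'rV[R]_N).
Implicit Types (i j : 'I_N) (k : nat).

Lemma is_derive_line f z i (t : R) :
  derivable f (z + t *: delta_mx 0 i) (delta_mx 0 i) ->
  is_derive t 1 (fun s : R => f (z + s *: delta_mx 0 i))
    (pd i f (z + t *: delta_mx 0 i)).
Proof.
set d : 'rV[R]_N := delta_mx 0 i => df.
have E h : f (z + (h *: (1 : R) + t) *: d) = f (h *: d + (z + t *: d)).
  by rewrite [h *: 1]mulr1 scalerDl addrCA.
split; first exact: (derivable_same_line (f := fun s : R => f (z + s *: d)) E).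
exact: (derive_same_line (f := fun s : R => f (z + s *: d)) E).
Qed.

Lemma mean_value_pd i f z (s : R) :
  (forall c : R, `|c| <= `|s| -> derivable f (z + c *: delta_mx 0 i) (delta_mx 0 i)) ->
  exists2 c : R, `|c| <= `|s| &
    f (z + s *: delta_mx 0 i) - f z = s * pd i f (z + c *: delta_mx 0 i).
Proof.
move=> df; set d : 'rV[R]_N := delta_mx 0 i.
pose phi (t : R) := f (z + t *: d).
have dphi (t : R) : `|t| <= `|s| -> is_derive t 1 phi (pd i f (z + t *: d)).
  by move=> ts; apply: is_derive_line; apply: df.
have cphi (a b : R) : (forall t, t \in `[a, b] -> `|t| <= `|s|) ->
    {within `[a, b], continuous phi}.
  move=> h; apply: derivable_within_continuous => t tab.
  by apply: ex_derive; apply: dphi; apply: h.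
have phi0 : f z = phi 0 by rewrite /phi scale0r addr0.
case: (ltgtP 0 s) => [s0|s0|s0].
- have sub (t : R) : t \in `[0, s] -> `|t| <= `|s|.
    by rewrite in_itv /= => /andP[t0 ts]; rewrite !ger0_norm// ltW.
  have [t tI e] := MVT s0 (fun t ht => dphi t (sub t (subset_itv_oo_cc ht))) (cphi _ _ sub).
  exists t; first by apply: sub; apply: subset_itv_oo_cc.
  by rewrite -[f (z + _)]/(phi s) phi0 e subr0 mulrC.
- have sub (t : R) : t \in `[s, 0] -> `|t| <= `|s|.
    by rewrite in_itv /= => /andP[t0 ts]; rewrite !ler0_norm ?lerN2// ltW.
  have [t tI e] := MVT s0 (fun t ht => dphi t (sub t (subset_itv_oo_cc ht))) (cphi _ _ sub).
  exists t; first by apply: sub; apply: subset_itv_oo_cc.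
  by rewrite -[f (z + _)]/(phi s) phi0 -opprB e sub0r mulrN opprK mulrC.
- exists 0; first by rewrite normr0.
  by rewrite -s0 scale0r addr0 subrr mul0r.
Qed.

Lemma nbhs_coordP z (P : set 'rV[R]_N) : nbhs z P ->
  exists2 d : R, 0 < d & forall y : 'rV[R]_N, (forall i, `|y 0 i - z 0 i| < d) -> P y.
Proof.
move=> /nbhs_ballP[d /= d0 h]; exists d => // y hy; apply: h.
by split=> // a i; rewrite (ord1 a) /ball /= distrC.
Qed.

Definition trunc_rV v k : 'rV[R]_N := \row_i if (i < k)%N then v 0 i else 0.

Lemma trunc_rVS v i : trunc_rV v i.+1 = trunc_rV v i + v 0 i *: delta_mx 0 i.
Proof.
apply/rowP=> j; rewrite !mxE eqxx /= ltnS [RHS]addrC.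
have [->|ne] := eqVneq j i; first by rewrite leqnn ltnn addr0 mulr1.
have ne' : (j == i :> nat) = false by apply/negbTE.
by rewrite leq_eqVlt ne' mulr0 add0r.
Qed.

(** The segment from [z] to [z + v] is replaced by a path that changes one coordinate at a time; the
    mean value theorem on each leg compares with a partial derivative at [z0]. Strictness, with the
    base point [z] moving while the derivatives stay at [z0], is needed because the curves used
    below start from a point of the ray that itself tends to the boundary. *)
Lemma strict_diff D f z0 (e : R) : open D -> D z0 -> Ck 1 D f -> 0 < e ->
  exists2 d : R, 0 < d & forall z v,
    (forall i, `|z 0 i - z0 0 i| < d) -> (forall i, `|v 0 i| < d) ->
    `|f (z + v) - f z - \sum_i v 0 i * pd i f z0| <= e * \sum_i `|v 0 i|.
Proof.
move=> Do Dz0 hf e0.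
have : \forall y \near z0, D y /\ forall i, `|pd i f z0 - pd i f y| < e.
  apply: filterI; first exact: open_nbhs_nbhs.
  apply: (@filter_forall _ _ (fun i y => `|pd i f z0 - pd i f y| < e) (nbhs z0)) => i.
  have /cvgrPdist_lt /(_ e e0) := Ck_cont (Ck_pd i hf) Dz0.
  exact.
(* A point of the coordinate path differs from [z0] by the offset of [z] and by part of [v]; each
   gets half of [d]. *)
move=> /nbhs_coordP[d d0 hd]; exists (d / 2); first by rewrite divr_gt0.
move=> z v hz hv.
have -> : f (z + v) - f z = \sum_(i < N) (f (z + trunc_rV v i.+1) - f (z + trunc_rV v i)).
  rewrite -(big_mkord xpredT (fun k => f (z + trunc_rV v k.+1) - f (z + trunc_rV v k))).
  rewrite telescope_sumr//; congr (f _ - f _).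
    by congr (_ + _); apply/rowP => i; rewrite mxE ltn_ord.
  by rewrite -[LHS]addr0; congr (_ + _); apply/rowP => i; rewrite !mxE ltn0.
rewrite -sumrB mulr_sumr; apply: le_trans (ler_norm_sum _ _ _) _.
apply: ler_sum => i _.
have near_pt (c : R) j : `|c| <= `|v 0 i| ->
    `|(z + trunc_rV v i + c *: delta_mx 0 i) 0 j - z0 0 j| < d.
  move=> cv; rewrite !mxE eqxx /=.
  have -> : z 0 j + (if (j < i)%N then v 0 j else 0) + c * (j == i)%:R - z0 0 j =
     (z 0 j - z0 0 j) + (if (j < i)%N then v 0 j else c * (j == i)%:R).
    case: ltnP => ji; last by ring.
    by rewrite (_ : (j == i) = false) ?mulr0; [ring|rewrite -val_eqE ltn_eqF].
  rewrite [ltRHS](splitr d); apply: le_lt_trans (ler_normD _ _) _; apply: ltrD => //.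
  case: ltnP => // _; rewrite normrM; case: (j == i); rewrite ?normr1 ?mulr1.
    exact: le_lt_trans cv _.
  by rewrite normr0 mulr0 divr_gt0.
rewrite trunc_rVS addrA.
have [|c cv ->] := @mean_value_pd i f (z + trunc_rV v i) (v 0 i).
  move=> c cv; apply: (Ck_derivable (D := D)) hf _.
  by case: (hd _ (fun j => near_pt c j cv)).
rewrite -mulrBr normrM mulrC; apply: ler_wpM2r => //.
by rewrite distrC; apply/ltW; case: (hd _ (fun j => near_pt c j cv)).
Qed.

End MeanValue.

(** * Symmetry of second derivatives *)

Section Schwarz.
Context (R : realType) (N : nat).
Implicit Types (f : 'rV[R]_N -> R) (z : 'rV[R]_N) (D : set 'rV[R]_N).

Let second_difference f z i j (s : R) :=
  f (z + s *: delta_mx 0 i + s *: delta_mx 0 j) - f (z + s *: delta_mx 0 i)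
  - f (z + s *: delta_mx 0 j) + f z.

Let second_differenceC f z i j s :
  second_difference f z i j s = second_difference f z j i s.
Proof.
rewrite /second_difference.
rewrite [z + s *: delta_mx 0 j + _]addrAC; ring.
Qed.

Let second_differenceP D f z i j : open D -> D z -> Ck 2 D f ->
  forall e : R, 0 < e -> exists2 d : R, 0 < d & forall s : R, 0 < s -> s < d ->
   exists2 y, `|pd j (pd i f) y - pd j (pd i f) z| < e &
    second_difference f z i j s = s * s * pd j (pd i f) y.
Proof.
move=> Do Dz hf e e0.
have : \forall y \near z, D y /\ `|pd j (pd i f) z - pd j (pd i f) y| < e.
  apply: filterI; first exact: open_nbhs_nbhs.
  have /cvgrPdist_lt /(_ e e0) := Ck_cont (Ck_pd j (Ck_pd i hf)) Dz.
  exact.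
move=> /nbhs_coordP[d d0 hd]; exists (d / 2); first by rewrite divr_gt0.
move=> s s0 sd.
have near_pt (c c' : R) k : `|c| <= `|s| -> `|c'| <= `|s| ->
    `|(z + c' *: delta_mx 0 j + c *: delta_mx 0 i) 0 k - z 0 k| < d.
  move=> cs cs'; rewrite !mxE eqxx /=.
  have -> : z 0 k + c' * (k == j)%:R + c * (k == i)%:R - z 0 k =
    c' * (k == j)%:R + c * (k == i)%:R by ring.
  have E (b : bool) (x : R) : `|x| <= `|s| -> `|x * b%:R| < d / 2.
    move=> xs; rewrite -(gtr0_norm s0) in sd; apply: le_lt_trans sd.
    case: b; rewrite ?mulr1 ?mulr0// normr0; exact: normr_ge0.
  rewrite [ltRHS](splitr d); apply: le_lt_trans (ler_normD _ _) _.
  by apply: ltrD; apply: E.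
pose phi y := f (y + s *: delta_mx 0 j) - f y.
have Dpt c c' : `|c| <= `|s| -> `|c'| <= `|s| ->
   D (z + c' *: delta_mx 0 j + c *: delta_mx 0 i).
  by move=> h1 h2; case: (hd _ (fun k => near_pt c c' k h1 h2)).
have shE y v (h : R) : f (h *: delta_mx 0 i + y + v) = f (h *: delta_mx 0 i + (y + v)).
  by rewrite addrA.
have shiftE y v : pd i (fun y => f (y + v)) y = pd i f (y + v).
  exact: (derive_same_line (f := fun y => f (y + v)) (shE y v)).
have shiftd y v : derivable f (y + v) (delta_mx 0 i) ->
    derivable (fun y => f (y + v)) y (delta_mx 0 i).
  exact: (derivable_same_line (f := fun y => f (y + v)) (shE y v)).
have z0 : 0 = 0 *: delta_mx 0 j :> 'rV[R]_N by rewrite scale0r.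
have n0 : `|0 : R| <= `|s| by rewrite normr0.
have d1 c : `|c| <= `|s| -> derivable f (z + c *: delta_mx 0 i) (delta_mx 0 i).
  move=> cs; apply: (Ck_derivable (D := D)) hf _.
  by have := Dpt c 0 cs n0; rewrite scale0r addr0.
have d2 c : `|c| <= `|s| ->
    derivable f (z + c *: delta_mx 0 i + s *: delta_mx 0 j) (delta_mx 0 i).
  move=> cs; apply: (Ck_derivable (D := D)) hf _.
  by rewrite addrAC; apply: Dpt.
have [|c cs e1] := @mean_value_pd R N i phi z s.
  by move=> c cs; apply: derivableB; [apply: shiftd; apply: d2|apply: d1].
have e2 : pd i phi (z + c *: delta_mx 0 i) =
    pd i f (z + c *: delta_mx 0 i + s *: delta_mx 0 j) - pd i f (z + c *: delta_mx 0 i).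
  rewrite [LHS]deriveB; [|by apply: shiftd; apply: d2|exact: d1].
  by congr (_ - _); exact: shiftE.
have [|c' cs' e3] := @mean_value_pd R N j (pd i f) (z + c *: delta_mx 0 i) s.
  move=> c' cs'; apply: (Ck_derivable (D := D)) (Ck_pd i hf) _.
  by rewrite addrAC; apply: Dpt.
exists (z + c *: delta_mx 0 i + c' *: delta_mx 0 j).
  by rewrite distrC addrAC; case: (hd _ (fun k => near_pt c c' k cs cs')).
rewrite -mulrA -e3 -e2 -e1 /second_difference /phi; ring.
Qed.

(** The second difference over a square of side s is symmetric in the two directions. Two
    applications of the mean value theorem make it s^2 times either mixed derivative at some nearby
    point, and continuity moves both points to [z]. *)
Lemma pdC D f z i j : open D -> D z -> Ck 2 D f ->
  pd i (pd j f) z = pd j (pd i f) z.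
Proof.
move=> Do Dz hf; apply/eqP; rewrite -subr_eq0 -normr_le0.
apply/ler_addgt0Pl => e e0; rewrite addr0.
have e2 : 0 < e / 2 by rewrite divr_gt0.
have [d d0 h] := second_differenceP i j Do Dz hf e2.
have [d' d'0 h'] := second_differenceP j i Do Dz hf e2.
pose m := Num.min d d' / 2.
have m0 : 0 < Num.min d d' by rewrite lt_min d0 d'0.
have mm : m < Num.min d d' by rewrite /m ltr_pdivrMr// mulr_natr mulr2n ltrDl.
have mgt0 : 0 < m by rewrite divr_gt0.
move: (mm); rewrite lt_min => /andP[md md'].
have [y hy ey] := h m mgt0 md.
have [y' hy' ey'] := h' m mgt0 md'.
have yy : pd j (pd i f) y = pd i (pd j f) y'.
  have mm0 : m * m != 0 by rewrite mulf_neq0// gt_eqF.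
  apply: (mulfI mm0).
  exact: etrans (esym ey) (etrans (second_differenceC _ _ _ _ _) ey').
have -> : pd i (pd j f) z - pd j (pd i f) z =
  (pd j (pd i f) y - pd j (pd i f) z) - (pd i (pd j f) y' - pd i (pd j f) z).
  by rewrite yy; move: (pd i _ z) (pd j _ z) (pd i _ y') => p q t; ring.
rewrite [leRHS](splitr e); apply: le_trans (ler_normB _ _) _.
exact: lerD (ltW hy) (ltW hy').
Qed.

End Schwarz.

Lemma continuous_row (R : realType) (X : topologicalType) N (L : X -> 'rV[R]_N) :
  (forall K, continuous (fun x => L x 0 K)) -> continuous L.
Proof.
move=> h x; apply/cvgrPdist_lt => e e0.
have : \forall y \near x, forall K, `|L x 0 K - L y 0 K| < e.
  apply: filter_forall => K.
  by have /cvgrPdist_lt /(_ e e0) := h K x.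
apply: filterS => y hy.
rewrite /Num.norm /= mx_normrE; apply: bigmax_lt => // -[a K] _ /=.
by rewrite (ord1 a) !mxE.
Qed.

Section Restriction.
Context (R : realType) (m M : nat).
(* [L] embeds [R^m] as an affine coordinate plane of [R^M]. *)
Implicit Types (f : 'rV[R]_M -> R) (z : 'rV[R]_m).
Context (L : 'rV[R]_m -> 'rV[R]_M) (s : 'I_m -> 'I_M).
Hypothesis LE : forall (z : 'rV[R]_m) i (h : R),
  L (h *: delta_mx 0 i + z) = h *: delta_mx 0 (s i) + L z.

Lemma pd_restrict f z i : pd i (fun y => f (L y)) z = pd (s i) f (L z).
Proof.
by apply: (derive_same_line (f := fun y => f (L y))) => h; rewrite LE.
Qed.

Lemma derivable_restrict f z i : derivable f (L z) (delta_mx 0 (s i)) ->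
  derivable (fun y => f (L y)) z (delta_mx 0 i).
Proof.
by apply: (derivable_same_line (f := fun y => f (L y))) => h; rewrite LE.
Qed.

Lemma Ck_restrict k (D : set 'rV[R]_M) f : continuous L -> Ck k D f ->
  Ck k (L @^-1` D) (fun y => f (L y)).
Proof.
move=> Lc; elim: k f => [|k IH] f hf; split=> //;
  try by move=> z Dz; apply: (continuous_comp (f := L)); [exact: Lc|exact: Ck_cont hf Dz].
move=> i; split; first by move=> z Dz; apply: derivable_restrict; apply: Ck_derivable hf Dz.
rewrite (_ : pd i _ = fun y => pd (s i) f (L y)); first by apply: IH; apply: Ck_pd.
by apply/funext => z; rewrite pd_restrict.
Qed.

End Restriction.

(** * Christoffel symbols and curvature *)

Section SumDelta.
Context (R : pzRingType) (I : finType).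

Lemma sum_delta (F : I -> R) a : \sum_e F e * (e == a)%:R = F a.
Proof.
rewrite (bigD1 a)//= eqxx mulr1 big1 ?addr0// => e /negPf ->.
by rewrite mulr0.
Qed.

Lemma sum_delta' (F : I -> R) a : \sum_e F e * (a == e)%:R = F a.
Proof. by rewrite -[RHS]sum_delta; apply: eq_bigr => e _; rewrite eq_sym. Qed.

Lemma sum_deltal (F : I -> R) a : \sum_e (e == a)%:R * F e = F a.
Proof.
rewrite (bigD1 a)//= eqxx mul1r big1 ?addr0// => e /negPf ->.
by rewrite mul0r.
Qed.

Lemma sum_deltal' (F : I -> R) a : \sum_e (a == e)%:R * F e = F a.
Proof. by rewrite -[RHS]sum_deltal; apply: eq_bigr => e _; rewrite eq_sym. Qed.

End SumDelta.

Section InverseMetric.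
Context (R : fieldType) (n : nat) (A : 'M[R]_n).
Hypothesis Au : A \in unitmx.

Lemma sum_mulVmx a b : \sum_c invmx A a c * A c b = (a == b)%:R.
Proof. by have /matrixP /(_ a b) := mulVmx Au; rewrite !mxE. Qed.

Hypothesis As : A^T = A.

Lemma symE a b : A a b = A b a.
Proof. by rewrite -[in RHS]As mxE. Qed.

Lemma invmx_symE a b : invmx A a b = invmx A b a.
Proof. by rewrite -[in RHS]As -trmx_inv mxE. Qed.

Lemma raise_lower (F : 'I_n -> R) a :
  \sum_c invmx A a c * \sum_b F b * A b c = F a.
Proof.
under eq_bigr do rewrite mulr_sumr.
rewrite exchange_big -[RHS]sum_delta'; apply: eq_bigr => b _ /=.
under eq_bigr do rewrite mulrCA (symE b).
by rewrite -mulr_sumr sum_mulVmx.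
Qed.

Lemma lower_raise (F : 'I_n -> R) a :
  \sum_b (\sum_c invmx A b c * F c) * A b a = F a.
Proof.
under eq_bigr do rewrite mulr_suml.
rewrite exchange_big -[RHS]sum_delta'; apply: eq_bigr => b _ /=.
under eq_bigr do rewrite mulrAC invmx_symE.
by rewrite -mulr_suml sum_mulVmx mulrC eq_sym.
Qed.

End InverseMetric.

Section LeviCivita.
Context (R : realType) (N : nat).
Implicit Types (g : 'rV[R]_N -> 'M[R]_N) (z : 'rV[R]_N).

(* g(nabla_i d_j, d_l) *)
Definition christoffel1 g z (l i j : 'I_N) : R :=
  2^-1 * (pd i (fun y => g y j l) z + pd j (fun y => g y i l) z
          - pd l (fun y => g y i j) z).

Lemma christoffelE g z k i j :
  christoffel g z k i j = \sum_l invmx (g z) k l * christoffel1 g z l i j.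
Proof. by rewrite /christoffel mulr_sumr; apply: eq_bigr => l _; rewrite mulrCA. Qed.

Context (g : 'rV[R]_N -> 'M[R]_N) (D : set 'rV[R]_N) (m : nat).
Hypothesis D_open : open D.
Hypothesis gC : forall a b, Ck m.+1 D (fun z => g z a b).
Hypothesis gs : forall z, D z -> (g z)^T = g z.
Hypothesis gu : forall z, D z -> g z \in unitmx.

Lemma pd_metric_sym i a b z : D z ->
  pd i (fun y => g y a b) z = pd i (fun y => g y b a) z.
Proof. by move=> Dz; apply: (pd_on _ D_open Dz) => y Dy; apply: symE; exact: gs. Qed.

Lemma christoffel1_sym z l i j : D z -> christoffel1 g z l i j = christoffel1 g z l j i.
Proof.
move=> Dz; rewrite /christoffel1 [X in _ - X]pd_metric_sym//.
by rewrite [X in X - _]addrC.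
Qed.

Lemma christoffel_sym z k i j : D z -> christoffel g z k i j = christoffel g z k j i.
Proof.
by move=> Dz; rewrite !christoffelE; apply: eq_bigr => l _; rewrite christoffel1_sym.
Qed.

Lemma christoffel_lower z k i j : D z ->
  \sum_e christoffel g z e i j * g z e k = christoffel1 g z k i j.
Proof.
move=> Dz; under eq_bigr do rewrite christoffelE.
by apply: lower_raise; [exact: gu | exact: gs].
Qed.

Lemma metric_compat z a e c : D z ->
  pd a (fun y => g y e c) z = christoffel1 g z c a e + christoffel1 g z e a c.
Proof.
move=> Dz; rewrite /christoffel1 (pd_metric_sym a c e Dz).
move: (pd a _ z) (pd e _ z) (pd c _ z) => p q t.
lra.
Qed.

Lemma Ck_christoffel1 l i j : Ck m D (fun z => christoffel1 g z l i j).
Proof.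
by apply: CkM => //; [exact: Ck_cst | apply: CkB => //; [apply: CkD => //|]; apply: Ck_pd].
Qed.

Lemma Ck_christoffel k i j : Ck m D (fun z => christoffel g z k i j).
Proof.
apply: (Ck_ext D_open) => [z Dz|]; first by rewrite christoffelE.
apply: Ck_sum => // l _; apply: CkM => //; last exact: Ck_christoffel1.
by apply: Ck_invmx => // a b; apply: Ck_S.
Qed.

Lemma ricciE z b d : D z -> ricci g z b d = \sum_a curvature g z a b d a.
Proof.
move=> Dz; rewrite mxE; apply: eq_bigr => a _.
by apply: raise_lower; [exact: gu | exact: gs].
Qed.

Lemma riemann_skewl z a b c d : riemann g z a b c d = - riemann g z b a c d.
Proof.
rewrite /riemann -sumrN; apply: eq_bigr => e _; rewrite -mulNr; congr (_ * _).
rewrite /curvature opprD opprB; congr (_ + _).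
by rewrite -sumrN; apply: eq_bigr => f _; rewrite opprB.
Qed.

End LeviCivita.

Section RiemannSkew.
#[local] Opaque pd christoffel christoffel1.
Context (R : realType) (N : nat) (g : 'rV[R]_N -> 'M[R]_N) (D : set 'rV[R]_N).
Hypothesis D_open : open D.
Hypothesis gC : forall a b, Ck 2 D (fun z => g z a b).
Hypothesis gs : forall z, D z -> (g z)^T = g z.
Hypothesis gu : forall z, D z -> g z \in unitmx.
Notation G1 := (christoffel1 g).
Notation G := (christoffel g).

Let dG z a b c d : D z ->
  \sum_e pd a (fun y => G y e b d) z * g z e c =
  pd a (fun y => G1 y c b d) z - \sum_e G z e b d * (G1 z c a e + G1 z e a c).
Proof.
move=> Dz.
have -> : pd a (fun y => G1 y c b d) z = pd a (fun y => \sum_e G y e b d * g y e c) z.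
  by apply: (pd_on _ D_open Dz) => y Dy; rewrite (christoffel_lower gs gu).
rewrite (pd_bigsum (D := D))// => [|e].
  rewrite -sumrB; apply: eq_bigr => e _.
  rewrite (pd_mul (D := D))//; first by rewrite (metric_compat D_open gs _ _ _ Dz)// addrK.
    exact: (Ck_christoffel D_open gC).
  exact: Ck_S.
by apply: CkM => //; [exact: (Ck_christoffel D_open gC)|exact: Ck_S].
Qed.

(** Lowering the index inside a derivative costs a derivative of the metric, which metric
    compatibility turns into symbols of the first kind. The resulting quadratic terms have the form
    in which the antisymmetry in the last two indices can be read off. *)
Lemma riemannE z a b c d : D z -> riemann g z a b c d =
  pd a (fun y => G1 y c b d) z - pd b (fun y => G1 y c a d) z
  - \sum_e G z e b d * G1 z e a c + \sum_e G z e a d * G1 z e b c.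
Proof.
move=> Dz; rewrite /riemann /curvature.
under eq_bigr do rewrite mulrDl mulrBl.
rewrite big_split sumrB /= [X in X - _ + _ = _](dG a b c d Dz).
rewrite [X in _ - X + _ = _](dG b a c d Dz).
have -> : \sum_e (\sum_f (G z f b d * G z e a f - G z f a d * G z e b f)) * g z e c =
   \sum_f G z f b d * G1 z c a f - \sum_f G z f a d * G1 z c b f.
  under eq_bigr do rewrite mulr_suml.
  rewrite exchange_big -sumrB; apply: eq_bigr => f _ /=.
  rewrite -!(christoffel_lower gs gu _ _ _ Dz) !mulr_sumr -sumrB.
  by apply: eq_bigr => e _; rewrite mulrBl !mulrA.
have E (p : 'I_N -> R) q t : \sum_e p e * (q e + t e) = \sum_e p e * q e + \sum_e p e * t e.
  by rewrite -big_split; apply: eq_bigr => e _; rewrite /= mulrDr.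
rewrite !E.
move: (pd a _ z) (pd b _ z) (\sum_e _ e b d * _ c a _) (\sum_e _ e a d * _ c b _).
move: (\sum_e _) (\sum_e _) => p q s t v w; ring.
Qed.

(** The second-order terms add up to the commutator of two partial derivatives of g_cd, which
    vanishes by [pdC]; the quadratic terms cancel because the pairing of Christoffel symbols through
    the metric is symmetric. *)
Lemma riemann_skewr z a b c d : D z -> riemann g z a b c d = - riemann g z a b d c.
Proof.
move=> Dz; apply/eqP; rewrite -addr_eq0; apply/eqP; rewrite !riemannE//.
have S (x y x' y' : 'I_N) : \sum_e G z e x y * G1 z e x' y' = \sum_e G z e x' y' * G1 z e x y.
  under eq_bigr do rewrite -(christoffel_lower gs gu _ _ _ Dz) mulr_sumr.
  rewrite exchange_big; apply: eq_bigr => e _ /=.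
  rewrite -(christoffel_lower gs gu _ _ _ Dz) mulr_sumr.
  apply: eq_bigr => f _; rewrite (symE (gs Dz) f e); ring.
rewrite (S b c a d) (S a c b d).
have C1 l i j : Ck 1 D (fun y => G1 y l i j) by exact: (Ck_christoffel1 D_open gC).
have H x y : pd x (fun z' => G1 z' c y d) z + pd x (fun z' => G1 z' d y c) z =
    pd x (pd y (fun z' => g z' c d)) z.
  rewrite -(pd_add x (C1 _ _ _) (C1 _ _ _) Dz).
  apply: (pd_on _ D_open Dz) => w Dw.
  by rewrite (metric_compat D_open gs _ _ _ Dw) addrC.
have Hab := H a b; have Hba := H b a; rewrite (pdC a b D_open Dz (gC c d)) in Hab.
move: Hab Hba.
move: (pd b (pd a _) z) => p.
move: (pd a _ z) (pd a _ z) (pd b _ z) (pd b _ z).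
move: (\sum_e _) (\sum_e _) => s1 s2 q t v w h h'.
have -> : q = p - t by rewrite -h addrC addKr.
have -> : v = p - w by rewrite -h' addrC addKr.
ring.
Qed.

End RiemannSkew.

(** * The geometry of the surface in an adapted chart *)

Section GaussAlgebra.
Context (R : comRingType) (I J : finType).
Implicit Types (i j k : I) (b c : J).

Lemma sum2_sym (gi F : I -> I -> R) : (forall i j, gi i j = gi j i) ->
  \sum_i \sum_j gi i j * F i j = \sum_i \sum_j gi i j * F j i.
Proof.
move=> gs; rewrite exchange_big; apply: eq_bigr => i _; apply: eq_bigr => j _.
by rewrite gs.
Qed.

Lemma sum2D (F G : I -> I -> R) :
  \sum_i \sum_j (F i j + G i j) = \sum_i \sum_j F i j + \sum_i \sum_j G i j.
Proof. by rewrite -big_split; apply: eq_bigr => i _; rewrite /= big_split. Qed.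

(** The finite-sum core of [jacobi_identity]. For a fixed normal index, [a], [B] and [e] stand for
    its Christoffel symbols with two tangential, one tangential and one normal, and two normal lower
    indices; [Ct], [Ck], [Cn], [Cb] are the other blocks, and [h] is H. The last group on the right
    is the curvature written out in these symbols, and the middle group is what the normal Laplacian
    and the curvature leave over. *)
Lemma gauss_algebra (gi : I -> I -> R) (h : J -> R) (dh : I -> J -> R)
    (ddh : I -> I -> R) (dha : I -> R) (a : I -> I -> R) (B : I -> J -> R)
    (e : J -> J -> R) (Ct : I -> I -> I -> R) (Ck : I -> J -> I -> R)
    (Cn : J -> I -> I -> R) (Cb : J -> I -> J -> R)
    (dB : I -> I -> J -> R) (dCn : J -> I -> I -> R) :
  (forall i j, gi i j = gi j i) ->
  (forall c, h c = \sum_i \sum_j gi i j * Cn c i j) ->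
  \sum_i \sum_j gi i j * (ddh i j + 2 * (\sum_b B i b * dh j b)
     - \sum_k Ct k i j * dha k + \sum_b h b * dCn b i j)
  + \sum_b \sum_c e b c * h b * h c =
  \sum_i \sum_j gi i j * (ddh i j + \sum_b (dB i j b * h b + B j b * dh i b)
     + \sum_b B i b * (dh j b + \sum_c Cb b j c * h c)
     - \sum_k Ct k i j * (dha k + \sum_b B k b * h b))
  + \sum_i \sum_j gi i j * (\sum_b h b * \sum_k Ck k b j * a i k)
  + \sum_i \sum_j gi i j * \sum_b h b * (dCn b i j - dB i j b
       + ((\sum_k Ct k i j * B k b + \sum_c Cn c i j * e b c)
          - (\sum_k Ck k b j * a i k + \sum_c Cb c j b * B i c))).
Proof.
move=> gs hE.
have -> : \sum_b \sum_c e b c * h b * h c =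
    \sum_i \sum_j gi i j * \sum_b h b * \sum_c Cn c i j * e b c.
  transitivity (\sum_b \sum_c \sum_i \sum_j gi i j * (h b * (Cn c i j * e b c))).
    apply: eq_bigr => b _; apply: eq_bigr => c _; rewrite (hE c) mulr_sumr.
    apply: eq_bigr => i _; rewrite mulr_sumr; apply: eq_bigr => j _; ring.
  under eq_bigr do rewrite exchange_big.
  rewrite exchange_big; apply: eq_bigr => i _ /=.
  under eq_bigr do rewrite exchange_big.
  rewrite exchange_big; apply: eq_bigr => j _ /=.
  rewrite mulr_sumr; apply: eq_bigr => b _; rewrite !mulr_sumr.
  by apply: eq_bigr => c _.
rewrite -!sum2D.
(* Half of the cross term is transposed, using the symmetry of [gi]: one copy comes from
   differentiating the connection term of the inner normal derivative, the other from the outer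
   normal derivative. *)
have -> : \sum_i \sum_j (gi i j * (ddh i j + 2 * (\sum_b B i b * dh j b)
     - \sum_k Ct k i j * dha k + \sum_b h b * dCn b i j)
     + gi i j * \sum_b h b * \sum_c Cn c i j * e b c) =
  \sum_i \sum_j (gi i j * (ddh i j + \sum_b B i b * dh j b + \sum_b B j b * dh i b
     - \sum_k Ct k i j * dha k + \sum_b h b * dCn b i j)
     + gi i j * \sum_b h b * \sum_c Cn c i j * e b c).
  transitivity (\sum_i \sum_j (gi i j * (ddh i j + \sum_b B i b * dh j b
     - \sum_k Ct k i j * dha k + \sum_b h b * dCn b i j
     + \sum_b h b * \sum_c Cn c i j * e b c) + gi i j * \sum_b B i b * dh j b)).
    apply: eq_bigr => i _; apply: eq_bigr => j _; ring.
  rewrite sum2D [X in _ + X]sum2_sym// -sum2D.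
  apply: eq_bigr => i _; apply: eq_bigr => j _; ring.
apply: eq_bigr => i _; apply: eq_bigr => j _.
rewrite -!mulrDr; congr (_ * _).
have E1 : \sum_b B i b * (dh j b + \sum_c Cb b j c * h c) =
    \sum_b B i b * dh j b + \sum_b h b * \sum_c Cb c j b * B i c.
  under eq_bigr do rewrite mulrDr; rewrite big_split /=; congr (_ + _).
  under eq_bigr do rewrite mulr_sumr; rewrite exchange_big.
  apply: eq_bigr => b _; rewrite mulr_sumr; apply: eq_bigr => c _; ring.
have E2 : \sum_k Ct k i j * (dha k + \sum_b B k b * h b) =
    \sum_k Ct k i j * dha k + \sum_b h b * \sum_k Ct k i j * B k b.
  under eq_bigr do rewrite mulrDr; rewrite big_split /=; congr (_ + _).
  under eq_bigr do rewrite mulr_sumr; rewrite exchange_big.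
  apply: eq_bigr => b _; rewrite mulr_sumr; apply: eq_bigr => c _; ring.
have E3 : \sum_b h b * (dCn b i j - dB i j b
       + ((\sum_k Ct k i j * B k b + \sum_c Cn c i j * e b c)
          - (\sum_k Ck k b j * a i k + \sum_c Cb c j b * B i c))) =
  \sum_b h b * dCn b i j - \sum_b dB i j b * h b
  + \sum_b h b * (\sum_k Ct k i j * B k b) + \sum_b h b * (\sum_c Cn c i j * e b c)
  - \sum_b h b * (\sum_k Ck k b j * a i k) - \sum_b h b * (\sum_c Cb c j b * B i c).
  rewrite -!sumrB -!big_split -!sumrB /=; apply: eq_bigr => b _; ring.
rewrite E1 E2 E3 big_split /=; ring.
Qed.

Lemma trace_algebra (gi : I -> I -> R) (h : J -> R) (Nn : I -> I -> R)
    (a : I -> I -> R) (Q : I -> I -> J -> R) :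
  (forall i j, gi i j = gi j i) ->
  (forall j l, \sum_b h b * Q j l b = Nn j l) ->
  \sum_i \sum_j \sum_k \sum_l gi i j * gi k l * Nn i k * a j l =
  - \sum_i \sum_j gi i j * \sum_b h b * \sum_k (- \sum_l gi k l * Q j l b) * a i k.
Proof.
move=> gs hQ.
have E i j : \sum_b h b * (\sum_k (- \sum_l gi k l * Q j l b) * a i k) =
   - \sum_k \sum_l gi k l * Nn j l * a i k.
  transitivity (\sum_b \sum_k \sum_l - (h b * (gi k l * Q j l b * a i k))).
    apply: eq_bigr => b _; rewrite mulr_sumr; apply: eq_bigr => k _.
    by rewrite mulNr mulrN mulr_suml mulr_sumr -sumrN.
  rewrite exchange_big -sumrN; apply: eq_bigr => k _ /=.
  rewrite exchange_big -sumrN; apply: eq_bigr => l _ /=.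
  by rewrite sumrN -hQ mulr_sumr mulr_suml; congr (- _); apply: eq_bigr => b _; ring.
transitivity (\sum_i \sum_j gi i j * \sum_k \sum_l gi k l * Nn j l * a i k).
  rewrite sum2_sym//; apply: eq_bigr => i _; apply: eq_bigr => j _.
  rewrite exchange_big mulr_sumr; apply: eq_bigr => k _ /=.
  rewrite mulr_sumr; apply: eq_bigr => l _; rewrite (gs l k); ring.
rewrite -sumrN; apply: eq_bigr => i _; rewrite -sumrN; apply: eq_bigr => j _.
by rewrite E mulrN opprK.
Qed.

End GaussAlgebra.

Section BlockInverse.
Context (R : comUnitRingType) (n1 n2 : nat) (A : 'M[R]_(n1 + n2)).
Hypothesis A_unit : A \in unitmx.
Hypothesis A_ur : forall i j, A (lshift n2 i) (rshift n1 j) = 0.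
Hypothesis A_dl : forall i j, A (rshift n1 j) (lshift n2 i) = 0.

Let A_block : A = block_mx (ulsubmx A) 0 0 (drsubmx A).
Proof.
rewrite -[LHS]submxK; congr block_mx; apply/matrixP=> i j; rewrite !mxE.
  exact: A_ur.
exact: A_dl.
Qed.

Lemma ulsubmx_unit : ulsubmx A \in unitmx.
Proof. by move: A_unit; rewrite {1}A_block block_diag_mx_unit => /andP[]. Qed.

Let invmx_block_diag_sub :
  invmx A = block_mx (invmx (ulsubmx A)) 0 0 (invmx (drsubmx A)).
Proof. by rewrite {1}A_block invmx_block_diag// -A_block. Qed.

Lemma invmx_ul i j : invmx A (lshift n2 i) (lshift n2 j) = invmx (ulsubmx A) i j.
Proof. by rewrite invmx_block_diag_sub block_mxEul. Qed.

Lemma invmx_ur i j : invmx A (lshift n2 i) (rshift n1 j) = 0.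
Proof. by rewrite invmx_block_diag_sub block_mxEur mxE. Qed.

End BlockInverse.

Section SurfaceGeometry.
#[local] Opaque pd christoffel christoffel1.
Context (R : realType) (n : nat).
Notation T := (@tan_ix n).
Notation Nu := (@nor_ix n).

Lemma sum_TN (F : 'I_(2 + n) -> R) : \sum_K F K = \sum_i F (T i) + \sum_b F (Nu b).
Proof. exact: big_split_ord. Qed.

Lemma sigma_pt_line (x : 'rV[R]_2) i (h : R) :
  sigma_pt n (h *: delta_mx 0 i + x) = h *: delta_mx 0 (T i) + sigma_pt n x.
Proof.
rewrite /sigma_pt /tan_ix; apply/rowP=> K; case: (split_ordP K) => k ->; rewrite [RHS]mxE.
  by rewrite !row_mxEl !mxE eqxx eq_lshift.
by rewrite !row_mxEr !mxE eqxx eq_rlshift mulr0 addr0.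
Qed.

Lemma sigma_pt_continuous : continuous (@sigma_pt R n).
Proof.
apply: continuous_row => K; case: (split_ordP K) => k ->.
  under eq_fun do rewrite row_mxEl; exact: coord_continuous.
under eq_fun do rewrite row_mxEr mxE; exact: cst_continuous.
Qed.

Context (g : 'rV[R]_(2 + n) -> 'M[R]_(2 + n)) (V : set 'rV[R]_(2 + n)).
Context (B : set 'rV[R]_2).
Hypothesis V_open : open V.
Hypothesis gC : forall a b, Ck 3 V (fun z => g z a b).
Hypothesis gs : forall z, V z -> (g z)^T = g z.
Hypothesis gu : forall z, V z -> g z \in unitmx.
Hypothesis adapted : is_adapted V g.
Hypothesis B_open : open B.
Hypothesis B_sub : forall x, B x -> V (sigma_pt n x).
Notation C := (christoffel g).
Notation C1 := (christoffel1 g).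
Notation p := (sigma_pt n).
Implicit Types (x : 'rV[R]_2) (i j k l : 'I_2) (a b c : 'I_n).

Lemma adapted_TN x i a : B x -> g (p x) (T i) (Nu a) = 0.
Proof. by move=> Bx; exact: (adapted (B_sub Bx)). Qed.

Lemma adapted_NT x i a : B x -> g (p x) (Nu a) (T i) = 0.
Proof. by move=> Bx; rewrite (symE (gs (B_sub Bx))) adapted_TN. Qed.

Lemma ginv_TN x i a : B x -> invmx (g (p x)) (T i) (Nu a) = 0.
Proof.
move=> Bx; apply: invmx_ur => [|j b|j b]; first exact: gu (B_sub Bx).
  exact: adapted_TN.
exact: adapted_NT.
Qed.

Lemma ginv_NT x i a : B x -> invmx (g (p x)) (Nu a) (T i) = 0.
Proof. by move=> Bx; rewrite (invmx_symE (gs (B_sub Bx))) ginv_TN. Qed.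

Lemma ginv_tanE x i j : B x -> ginv_tan g x i j = invmx (g (p x)) (T i) (T j).
Proof.
move=> Bx; apply/esym; apply: invmx_ul => [|k b|k b]; first exact: gu (B_sub Bx).
  exact: adapted_TN.
exact: adapted_NT.
Qed.

Lemma sigma_metric_unit x : B x -> sigma_metric g x \in unitmx.
Proof.
move=> Bx; apply: ulsubmx_unit => [|k b|k b]; first exact: gu (B_sub Bx).
  exact: adapted_TN.
exact: adapted_NT.
Qed.

Lemma sigma_metric_sym x : B x -> (sigma_metric g x)^T = sigma_metric g x.
Proof. by move=> Bx; apply/matrixP=> i j; rewrite !mxE (symE (gs (B_sub Bx))). Qed.

Lemma ginv_tan_sym x i j : B x -> ginv_tan g x i j = ginv_tan g x j i.
Proof. by move=> Bx; apply: invmx_symE; exact: sigma_metric_sym. Qed.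

(** In an adapted chart the metric and its inverse are block diagonal on Sigma, so projecting to the
    normal bundle amounts to reading off normal components. *)
Lemma nabla_norE x K L a : B x -> nabla_nor g x K L a = C (p x) (Nu a) K L.
Proof.
move=> Bx; have Vx := B_sub Bx.
rewrite -[RHS](raise_lower (gu Vx) (gs Vx) (fun e => C (p x) e K L)) sum_TN.
by rewrite big1 ?add0r// => i _; rewrite ginv_NT// mul0r.
Qed.

Lemma second_formE x i j a : B x -> second_form g x i j 0 a = C (p x) (Nu a) (T i) (T j).
Proof. by move=> Bx; rewrite mxE nabla_norE. Qed.

Lemma HvecE x a : B x ->
  Hvec g x 0 a = \sum_i \sum_j ginv_tan g x i j * C (p x) (Nu a) (T i) (T j).
Proof.
move=> Bx; rewrite summxE; apply: eq_bigr => i _; rewrite summxE.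
by apply: eq_bigr => j _; rewrite mxE second_formE.
Qed.

Lemma pd_sigma_pt (f : 'rV[R]_(2 + n) -> R) i x :
  pd i (fun y => f (p y)) x = pd (T i) f (p x).
Proof. by apply: (pd_restrict (s := fun i => T i)) => z k h; exact: sigma_pt_line. Qed.

Lemma Ck_sigma_pt m (f : 'rV[R]_(2 + n) -> R) : Ck m V f -> Ck m B (fun y => f (p y)).
Proof.
move=> hf; apply: (@Ck_sub _ _ _ (p @^-1` V)); first by move=> x /B_sub.
apply: (Ck_restrict (s := fun i => T i)) => [z i h|//|//]; first exact: sigma_pt_line.
exact: sigma_pt_continuous.
Qed.

Lemma Ck_Hvec a : Ck 2 B (fun x => Hvec g x 0 a).
Proof.
apply: (Ck_ext B_open) => [x Bx|]; first by rewrite HvecE.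
apply: Ck_sum => // i _; apply: Ck_sum => // j _; apply: CkM => //.
  apply: (Ck_ext B_open (f := fun x => invmx (g (p x)) (T i) (T j))).
    by move=> x Bx; rewrite ginv_tanE.
  apply: (Ck_sigma_pt (f := fun z => invmx (g z) (T i) (T j))).
  by apply: Ck_invmx => // *; exact: Ck_S.
by apply: (Ck_sigma_pt (f := fun z => C z (Nu a) (T i) (T j))); exact: (Ck_christoffel V_open gC).
Qed.

Lemma pd_T_adapted x i j a : B x -> pd (T i) (fun y => g y (T j) (Nu a)) (p x) = 0.
Proof.
move=> Bx; rewrite -(pd_sigma_pt (fun y => g y (T j) (Nu a))).
rewrite (pd_on i B_open Bx (g := fun=> 0)) ?pd_cst// => y By; exact: adapted_TN.
Qed.

Lemma christoffel_sigma x k i j : B x ->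
  christoffel (sigma_metric g) x k i j = C (p x) (T k) (T i) (T j).
Proof.
move=> Bx; rewrite !christoffelE sum_TN [X in _ = _ + X]big1 ?addr0; last first.
  by move=> a _; rewrite ginv_TN// mul0r.
apply: eq_bigr => l _; rewrite -ginv_tanE//; congr (_ * _).
Transparent christoffel1.
rewrite /christoffel1; congr (_ * _).
Opaque christoffel1.
have E i' j' k' : pd i' (fun y => sigma_metric g y j' k') x =
    pd (T i') (fun y => g y (T j') (T k')) (p x).
  rewrite -(pd_sigma_pt (fun y => g y (T j') (T k'))).
  by congr (pd _ _ _); apply/funext => y; rewrite !mxE.
by rewrite !E.
Qed.

(** The Weingarten equation, obtained by differentiating the orthogonality of tangential and normal
    coordinate vectors along Sigma. *)
Lemma christoffel_TNT x k b j : B x ->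
  C (p x) (T k) (Nu b) (T j) =
  - \sum_l ginv_tan g x k l * \sum_c C (p x) (Nu c) (T j) (T l) * g (p x) (Nu c) (Nu b).
Proof.
move=> Bx; have Vx := B_sub Bx.
rewrite christoffelE sum_TN [X in _ + X]big1 ?addr0; last first.
  by move=> a _; rewrite ginv_TN// mul0r.
rewrite -sumrN; apply: eq_bigr => l _; rewrite -ginv_tanE// -mulrN; congr (_ * _).
have := metric_compat V_open gs (T j) (T l) (Nu b) Vx.
rewrite pd_T_adapted// => /esym/eqP; rewrite addrC addr_eq0 => /eqP.
rewrite (christoffel1_sym V_open gs _ _ _ Vx) => ->; congr (- _).
rewrite -(christoffel_lower gs gu _ _ _ Vx) sum_TN [X in X + _]big1 ?add0r//.
by move=> i _; rewrite adapted_TN// mulr0.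
Qed.

Notation H := (Hvec g).
Notation gi := (ginv_tan g).

Let nabla_perp_Hvec x j b : B x -> nabla_perp g H x j 0 b =
  pd j (fun y => H y 0 b) x + \sum_c C (p x) (Nu b) (T j) (Nu c) * H x 0 c.
Proof.
by move=> Bx; rewrite mxE; congr (_ + _); apply: eq_bigr => c _; rewrite nabla_norE.
Qed.

Lemma pd_nabla_perp_Hvec x i j a : B x -> pd i (fun y => nabla_perp g H y j 0 a) x =
  pd i (pd j (fun y => H y 0 a)) x
  + \sum_b (pd (T i) (fun y => C y (Nu a) (T j) (Nu b)) (p x) * H x 0 b
            + C (p x) (Nu a) (T j) (Nu b) * pd i (fun y => H y 0 b) x).
Proof.
move=> Bx; rewrite (pd_on i B_open Bx (fun y By => nabla_perp_Hvec j a By)).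
have CC c : Ck 1 B (fun y => C (p y) (Nu a) (T j) (Nu c)).
  apply: (Ck_sigma_pt (f := fun z => C z (Nu a) (T j) (Nu c))).
  by apply/Ck_S; exact: (Ck_christoffel V_open gC).
have HC c := Ck_S (Ck_Hvec c).
have CH c : Ck 1 B (fun y => C (p y) (Nu a) (T j) (Nu c) * H y 0 c).
  by apply: CkM.
have SH : Ck 1 B (fun y => \sum_c C (p y) (Nu a) (T j) (Nu c) * H y 0 c).
  by apply: Ck_sum.
rewrite (pd_add i (Ck_pd j (Ck_Hvec a)) SH Bx).
congr (_ + _); rewrite (pd_bigsum i B_open CH Bx); apply: eq_bigr => c _.
rewrite (pd_mul i (CC c) (HC c) Bx).
by rewrite (pd_sigma_pt (fun y => C y (Nu a) (T j) (Nu c))).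
Qed.

Lemma laplace_perp_Hvec x a : B x -> laplace_perp g H x 0 a =
  \sum_i \sum_j gi x i j *
   (pd i (pd j (fun y => H y 0 a)) x
    + \sum_b (pd (T i) (fun y => C y (Nu a) (T j) (Nu b)) (p x) * H x 0 b
            + C (p x) (Nu a) (T j) (Nu b) * pd i (fun y => H y 0 b) x)
    + \sum_b C (p x) (Nu a) (T i) (Nu b) * (pd j (fun y => H y 0 b) x
         + \sum_c C (p x) (Nu b) (T j) (Nu c) * H x 0 c)
    - \sum_k C (p x) (T k) (T i) (T j) * (pd k (fun y => H y 0 a) x
         + \sum_b C (p x) (Nu a) (T k) (Nu b) * H x 0 b)).
Proof.
move=> Bx; rewrite summxE; apply: eq_bigr => i _; rewrite summxE.
apply: eq_bigr => j _; rewrite [LHS]mxE; congr (_ * _).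
rewrite [LHS]mxE; congr (_ + _).
  rewrite mxE pd_nabla_perp_Hvec//; congr (_ + _); apply: eq_bigr => b _.
  by rewrite nabla_norE// nabla_perp_Hvec.
rewrite [LHS]mxE; congr (- _); rewrite summxE; apply: eq_bigr => k _.
by rewrite mxE nabla_perp_Hvec// christoffel_sigma.
Qed.

Lemma second_form_trace x a : B x ->
  \sum_i \sum_j \sum_k \sum_l
     gi x i j * gi x k l * nor_inner g x (second_form g x i k) (H x)
     * second_form g x j l 0 a =
  - \sum_i \sum_j gi x i j * \sum_b H x 0 b *
     \sum_k C (p x) (T k) (Nu b) (T j) * C (p x) (Nu a) (T i) (T k).
Proof.
move=> Bx.
under eq_bigr do under eq_bigr do under eq_bigr do under eq_bigr do rewrite second_formE//.
under [in RHS]eq_bigr do under eq_bigr do under eq_bigr do under eq_bigr do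
  rewrite christoffel_TNT//.
rewrite -(trace_algebra (Nn := fun i j => nor_inner g x (second_form g x i j) (H x))) //.
  by move=> i j; exact: ginv_tan_sym.
move=> j l; rewrite /nor_inner.
under eq_bigr do rewrite mulr_sumr.
rewrite exchange_big; apply: eq_bigr => b _; apply: eq_bigr => c _ /=.
by rewrite second_formE//; ring.
Qed.

(** The left side is the coordinate expression that the r^2 expansion produces. Completing the
    partial derivatives of H to normal covariant derivatives uses up all Christoffel products except
    those of the curvature and one product of a tangential with a normal component, which the
    Weingarten equation turns into the quadratic term in the second fundamental form. Its sign is
    opposite to that in the Jacobi operator because the inverse metric is not varied here;
    [ginv_tan_jet2_trace] supplies that variation. *)
Lemma jacobi_identity x a : B x ->
  \sum_i \sum_j gi x i j * (pd i (pd j (fun y => H y 0 a)) x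
     + 2 * (\sum_b C (p x) (Nu a) (T i) (Nu b) * pd j (fun y => H y 0 b) x)
     - \sum_k C (p x) (T k) (T i) (T j) * pd k (fun y => H y 0 a) x
     + \sum_b H x 0 b * pd (Nu b) (fun z => C z (Nu a) (T i) (T j)) (p x))
  + \sum_b \sum_c C (p x) (Nu a) (Nu b) (Nu c) * H x 0 b * H x 0 c =
  laplace_perp g H x 0 a
  - \sum_i \sum_j \sum_k \sum_l
     gi x i j * gi x k l * nor_inner g x (second_form g x i k) (H x)
     * second_form g x j l 0 a
  + \sum_i \sum_j gi x i j * \sum_b H x 0 b * curvature g (p x) (Nu b) (T i) (T j) (Nu a).
Proof.
move=> Bx; have Vx := B_sub Bx.
rewrite laplace_perp_Hvec// second_form_trace// opprK.
rewrite (@gauss_algebra R 'I_2 'I_n (gi x) (H x 0)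
  (fun j b => pd j (fun y => H y 0 b) x) (fun i j => pd i (pd j (fun y => H y 0 a)) x)
  (fun k => pd k (fun y => H y 0 a) x) (fun i k => C (p x) (Nu a) (T i) (T k))
  (fun i b => C (p x) (Nu a) (T i) (Nu b)) (fun b c => C (p x) (Nu a) (Nu b) (Nu c))
  (fun k i j => C (p x) (T k) (T i) (T j)) (fun k b j => C (p x) (T k) (Nu b) (T j))
  (fun c i j => C (p x) (Nu c) (T i) (T j)) (fun b j c => C (p x) (Nu b) (T j) (Nu c))
  (fun i j b => pd (T i) (fun z => C z (Nu a) (T j) (Nu b)) (p x))
  (fun b i j => pd (Nu b) (fun z => C z (Nu a) (T i) (T j)) (p x))
  (fun i j => ginv_tan_sym i j Bx) (fun c => HvecE c Bx)).
congr (_ + _); apply: eq_bigr => i _; apply: eq_bigr => j _; congr (_ * _).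
apply: eq_bigr => b _; congr (_ * _).
have E1 : pd (T i) (fun y => C y (Nu a) (Nu b) (T j)) (p x) =
    pd (T i) (fun y => C y (Nu a) (T j) (Nu b)) (p x).
  apply: (pd_on _ V_open Vx) => z Vz; exact: (christoffel_sym V_open gs).
have E2 k : C (p x) (Nu a) (Nu b) (T k) = C (p x) (Nu a) (T k) (Nu b) by exact: (christoffel_sym V_open gs).
have E3 c : C (p x) (Nu c) (Nu b) (T j) = C (p x) (Nu c) (T j) (Nu b) by exact: (christoffel_sym V_open gs).
rewrite /curvature E1; congr (_ + _).
rewrite sumrB sum_TN [X in _ = _ - X]sum_TN.
have E4 (q1 q2 q3 q4 r1 r4 : R) : q1 = r1 -> q4 = r4 ->
  q1 + q2 - (q3 + q4) = r1 + q2 - (q3 + r4) by move=> -> ->.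
by apply: E4; apply: eq_bigr => k _; [rewrite E2|rewrite E3].
Qed.

Notation gn := (ginv_nor g).

Lemma ginv_norP x a b : B x -> \sum_c gn x a c * g (p x) (Nu c) (Nu b) = (a == b)%:R.
Proof.
move=> Bx; have := sum_mulVmx (gu (B_sub Bx)) (Nu a) (Nu b).
rewrite sum_TN big1 ?add0r => [->|i _]; last by rewrite ginv_NT// mul0r.
by rewrite eq_rshift.
Qed.

Lemma ginv_tan_trace x : B x -> \sum_i \sum_j gi x i j * g (p x) (T i) (T j) = 2.
Proof.
move=> Bx; have E i : \sum_j gi x i j * g (p x) (T i) (T j) = 1.
  have := sum_mulVmx (gu (B_sub Bx)) (T i) (T i).
  rewrite sum_TN [X in _ + X]big1 ?addr0 => [|c _]; last by rewrite ginv_TN// mul0r.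
  rewrite eqxx => h; rewrite -[RHS](h : _ = 1); apply: eq_bigr => j _.
  by rewrite -ginv_tanE// (symE (gs (B_sub Bx))).
by rewrite (eq_bigr _ (fun i _ => E i)) sumr_const card_ord.
Qed.

(** One sign change in each pair of indices moves the normal index [c] to the third place, which is
    the slot lowered by the metric and hence the one that can be raised again. *)
Lemma riemann_nor_trace x i j a b : B x ->
  \sum_c gn x a c * riemann g (p x) (T i) (Nu b) (T j) (Nu c) =
  curvature g (p x) (Nu b) (T i) (T j) (Nu a).
Proof.
move=> Bx; have Vx := B_sub Bx.
rewrite -[RHS](raise_lower (gu Vx) (gs Vx) (curvature g (p x) (Nu b) (T i) (T j))).
rewrite sum_TN [X in _ = X + _]big1 ?add0r => [|k _]; last by rewrite ginv_NT// mul0r.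
apply: eq_bigr => c _; congr (_ * _).
rewrite (riemann_skewr V_open (fun K L => Ck_S (gC K L)) gs gu _ _ _ _ Vx).
by rewrite riemann_skewl opprK.
Qed.

(** Of the four products of P and g in the decomposition, two contain a mixed component of g and
    vanish on Sigma. The other two give the tangential trace of P and, with the factor 2 = dim
    Sigma, the normal part of P. *)
Lemma weyl_trace x a : B x ->
  \sum_i \sum_j \sum_b \sum_c
     gi x i j * gn x a c * H x 0 b * weyl g (p x) (T i) (Nu b) (T j) (Nu c) =
  \sum_i \sum_j gi x i j * \sum_b H x 0 b * curvature g (p x) (Nu b) (T i) (T j) (Nu a)
  - (\sum_i \sum_j gi x i j * schouten g (p x) (T i) (T j)) * H x 0 a
  - 2 * \sum_b \sum_c gn x a c * schouten g (p x) (Nu b) (Nu c) * H x 0 b.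
Proof.
move=> Bx; rewrite /weyl; move: (schouten g (p x)) => P.
rewrite -(ginv_tan_trace Bx) !mulr_suml -!sumrB; apply: eq_bigr => i _.
rewrite !mulr_suml -!sumrB; apply: eq_bigr => j _.
have -> : H x 0 a = \sum_b H x 0 b * (\sum_c gn x a c * g (p x) (Nu c) (Nu b)).
  by under eq_bigr do rewrite ginv_norP//; rewrite sum_delta'.
under [X in _ = _ * X - _ - _]eq_bigr do rewrite -riemann_nor_trace// mulr_sumr.
rewrite !mulr_sumr -!sumrB; apply: eq_bigr => b _.
rewrite !mulr_sumr -!sumrB; apply: eq_bigr => c _.
rewrite adapted_NT// adapted_TN// (symE (gs (B_sub Bx)) (Nu c) (Nu b)).
by move: (riemann _ _ _ _ _ _) => r; ring.
Qed.

End SurfaceGeometry.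

(** * The Ricci curvature of the collar metric *)

Section CollarMetric.
#[local] Opaque pd christoffel christoffel1.
Context (R : realType) (m : nat) (gt : 'rV[R]_(m + 1) -> 'M[R]_m).
Implicit Types (w : 'rV[R]_(m + 1)) (A B C D L F : 'I_m).
Notation T := (lshift 1).
Notation r_ := (r_index m).

Definition slice_christoffel1 w L B C : R :=
  2^-1 * (pd (T B) (fun y => gt y C L) w + pd (T C) (fun y => gt y B L) w
          - pd (T L) (fun y => gt y B C) w).

Definition slice_christoffel w A B C : R :=
  \sum_L invmx (gt w) A L * slice_christoffel1 w L B C.

Definition dr_metric w A B : R := pd r_ (fun y => gt y A B) w.

(** Half of this endomorphism is the covariant derivative of d_r for dr^2 + gt, that is, the shape
    operator of the slice up to sign. *)
Definition shape_op w A B : R := \sum_L invmx (gt w) A L * dr_metric w B L.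

(** The Ricci tensor of the slice metric at fixed r, written as a function of all coordinates so
    that it can be followed as r -> 0; [ricci_boundary] identifies its value at r = 0. *)
Definition slice_ricci w B D : R :=
  \sum_A (pd (T A) (fun y => slice_christoffel y A B D) w
          - pd (T B) (fun y => slice_christoffel y A A D) w
          + \sum_F (slice_christoffel w F B D * slice_christoffel w A A F
                    - slice_christoffel w F A D * slice_christoffel w A B F)).

Lemma sum_Tr (G : 'I_(m + 1) -> R) : \sum_K G K = \sum_A G (T A) + G r_.
Proof. by rewrite big_split_ord big_ord1. Qed.

Lemma pd_T_r A w : pd (T A) (@r_coord R m) w = 0.
Proof.
rewrite (_ : pd (T A) (@r_coord R m) w = (T A == r_)%:R); last exact: pd_coord.
by rewrite /r_index eq_lrshift.
Qed.

Lemma pd_r_r w : pd r_ (@r_coord R m) w = 1.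
Proof. by have := pd_coord r_ r_ w; rewrite eqxx. Qed.

Lemma Ck_r k Dm : Ck k Dm (@r_coord R m).
Proof. exact: Ck_coord. Qed.

Context (Dm : set 'rV[R]_(m + 1)).
Hypothesis D_open : open Dm.
Hypothesis D_pos : forall w, Dm w -> 0 < r_coord w.
Hypothesis gtC : forall A B, Ck 2 Dm (fun w => gt w A B).
Hypothesis gts : forall w, Dm w -> (gt w)^T = gt w.
Hypothesis gtu : forall w, Dm w -> gt w \in unitmx.
Notation gp := (g_plus gt).
Notation G1 := (christoffel1 (g_plus gt)).
Notation G := (christoffel (g_plus gt)).

Lemma g_plusTT w A B : gp w (T A) (T B) = (r_coord w ^+ 2)^-1 * gt w A B.
Proof. by rewrite mxE block_mxEul. Qed.
Lemma g_plusTr w A : gp w (T A) r_ = 0.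
Proof. by rewrite mxE block_mxEur mxE mulr0. Qed.
Lemma g_plusrT w A : gp w r_ (T A) = 0.
Proof. by rewrite mxE block_mxEdl mxE mulr0. Qed.
Lemma g_plusrr w : gp w r_ r_ = (r_coord w ^+ 2)^-1.
Proof. by rewrite mxE block_mxEdr mxE eqxx mulr1. Qed.

Lemma g_plus_block w : gp w = block_mx ((r_coord w ^+ 2)^-1 *: gt w) 0 0 ((r_coord w ^+ 2)^-1)%:M.
Proof. by rewrite /g_plus scale_block_mx !scaler0 scale_scalar_mx mulr1. Qed.

Lemma g_plus_unit w : Dm w -> gp w \in unitmx.
Proof.
move=> Dw; have r0 : r_coord w != 0 by rewrite gt_eqF// D_pos.
rewrite g_plus_block block_diag_mx_unit unitmxZ ?gtu//.
  by rewrite unitmxE det_scalar expr1 unitfE invr_eq0 expf_neq0.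
by rewrite unitfE invr_eq0 expf_neq0.
Qed.

Lemma g_plus_sym w : Dm w -> (gp w)^T = gp w.
Proof.
by move=> Dw; rewrite g_plus_block tr_block_mx !trmx0 linearZ /= gts// tr_scalar_mx.
Qed.

Lemma inv_g_plus w : Dm w ->
  invmx (gp w) = block_mx (r_coord w ^+ 2 *: invmx (gt w)) 0 0 (r_coord w ^+ 2)%:M.
Proof.
move=> Dw; have r0 : r_coord w != 0 by rewrite gt_eqF// D_pos.
have := g_plus_unit Dw; rewrite g_plus_block => u; rewrite invmx_block_diag//.
move: u; rewrite block_diag_mx_unit => /andP[u1 u2].
by rewrite invmxZ// invmx_scalar invrK.
Qed.

Lemma Ck_inv_r2 k : Ck k Dm (fun w => (r_coord w ^+ 2)^-1).
Proof.
apply: CkV => // [w Dw|]; first by rewrite expf_neq0// gt_eqF// D_pos.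
by apply: CkM => //; exact: Ck_r.
Qed.

Lemma pd_T_inv_r2 A w : Dm w -> pd (T A) (fun w => (r_coord w ^+ 2)^-1) w = 0.
Proof.
move=> Dw; have r0 : r_coord w != 0 by rewrite gt_eqF// D_pos.
rewrite (pd_inv (D := Dm))// ?expf_neq0//; last by apply: CkM => //; exact: Ck_r.
by rewrite (pd_mul (D := Dm) _ (Ck_r _ _) (Ck_r _ _) Dw) pd_T_r mul0r mulr0 addr0 mulr0.
Qed.

Lemma pd_r_inv_r2 w : Dm w ->
  pd r_ (fun w => (r_coord w ^+ 2)^-1) w = - 2 * (r_coord w)^-1 ^+ 3.
Proof.
move=> Dw; have r0 : r_coord w != 0 by rewrite gt_eqF// D_pos.
rewrite (pd_inv (D := Dm))// ?expf_neq0//; last by apply: CkM => //; exact: Ck_r.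
rewrite (pd_mul (D := Dm) _ (Ck_r _ _) (Ck_r _ _) Dw) pd_r_r.
by field.
Qed.

Lemma pd_g_plusTT K A B w : Dm w -> pd K (fun y => gp y (T A) (T B)) w =
  pd K (fun w => (r_coord w ^+ 2)^-1) w * gt w A B
  + (r_coord w ^+ 2)^-1 * pd K (fun y => gt y A B) w.
Proof.
move=> Dw; under eq_fun do rewrite g_plusTT.
by rewrite (pd_mul (D := Dm) _ (Ck_inv_r2 1) (Ck_S (gtC A B)) Dw).
Qed.

Lemma pd_g_plusTr K A w : pd K (fun y => gp y (T A) r_) w = 0.
Proof. by under eq_fun do rewrite g_plusTr; exact: pd_cst. Qed.

Lemma pd_g_plusrT K A w : pd K (fun y => gp y r_ (T A)) w = 0.
Proof. by under eq_fun do rewrite g_plusrT; exact: pd_cst. Qed.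

Lemma pd_g_plusrr K w : pd K (fun y => gp y r_ r_) w = pd K (fun w => (r_coord w ^+ 2)^-1) w.
Proof. by under eq_fun do rewrite g_plusrr. Qed.

Lemma christoffel_raiseT w A (K L : 'I_(m + 1)) : Dm w -> G w (T A) K L =
  r_coord w ^+ 2 * \sum_B invmx (gt w) A B * G1 w (T B) K L.
Proof.
move=> Dw; rewrite christoffelE sum_Tr inv_g_plus// block_mxEur mxE mul0r addr0.
by rewrite mulr_sumr; apply: eq_bigr => B _; rewrite block_mxEul [X in X * _]mxE -mulrA.
Qed.

Lemma christoffel_raiser w (K L : 'I_(m + 1)) : Dm w -> G w r_ K L = r_coord w ^+ 2 * G1 w r_ K L.
Proof.
move=> Dw; rewrite christoffelE sum_Tr inv_g_plus// big1 ?add0r => [|B _].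
  by rewrite block_mxEdr mxE eqxx.
by rewrite block_mxEdl mxE mul0r.
Qed.

Transparent christoffel1.
Lemma christoffel_TTT w A B C : Dm w -> G w (T A) (T B) (T C) = slice_christoffel w A B C.
Proof.
move=> Dw; have r0 : r_coord w != 0 by rewrite gt_eqF// D_pos.
rewrite christoffel_raiseT// mulr_sumr; apply: eq_bigr => L _.
rewrite /christoffel1 /slice_christoffel1 !pd_g_plusTT// !pd_T_inv_r2//.
move: (pd _ _ _) (pd _ _ _) (pd _ _ _) => p q t.
by field.
Qed.

Lemma christoffel_TTr w A B : Dm w ->
  G w (T A) (T B) r_ = 2^-1 * shape_op w A B - (A == B)%:R / r_coord w.
Proof.
move=> Dw; have r0 : r_coord w != 0 by rewrite gt_eqF// D_pos.
rewrite christoffel_raiseT// -(sum_mulVmx (gtu Dw)) !mulr_sumr mulr_suml -sumrB.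
apply: eq_bigr => L _.
rewrite /christoffel1 pd_g_plusrT pd_g_plusTr pd_g_plusTT// pd_r_inv_r2//.
rewrite (symE (gts Dw) B L) /dr_metric; move: (pd _ _ _) => p.
by field.
Qed.

Lemma christoffel_TrT w A B : Dm w ->
  G w (T A) r_ (T B) = 2^-1 * shape_op w A B - (A == B)%:R / r_coord w.
Proof.
by move=> Dw; rewrite (christoffel_sym D_open g_plus_sym)// christoffel_TTr.
Qed.

Lemma christoffel_Trr w A : Dm w -> G w (T A) r_ r_ = 0.
Proof.
move=> Dw; rewrite christoffel_raiseT// big1 ?mulr0// => L _.
rewrite /christoffel1 pd_g_plusrT pd_g_plusrr pd_T_inv_r2// addr0 subr0.
by rewrite !mulr0.
Qed.

Lemma christoffel_rTT w A B : Dm w ->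
  G w r_ (T A) (T B) = gt w A B / r_coord w - 2^-1 * dr_metric w A B.
Proof.
move=> Dw; have r0 : r_coord w != 0 by rewrite gt_eqF// D_pos.
rewrite christoffel_raiser// /christoffel1 !pd_g_plusTr pd_g_plusTT// pd_r_inv_r2//.
rewrite /dr_metric; move: (pd _ _ _) => p.
by field.
Qed.

Lemma christoffel_rTr w A : Dm w -> G w r_ (T A) r_ = 0.
Proof.
move=> Dw; rewrite christoffel_raiser// /christoffel1 pd_g_plusrr pd_g_plusTr.
by rewrite pd_T_inv_r2// addr0 subrr !mulr0.
Qed.

Lemma christoffel_rrT w A : Dm w -> G w r_ r_ (T A) = 0.
Proof.
by move=> Dw; rewrite (christoffel_sym D_open g_plus_sym)// christoffel_rTr.
Qed.

Lemma christoffel_rrr w : Dm w -> G w r_ r_ r_ = - (r_coord w)^-1.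
Proof.
move=> Dw; have r0 : r_coord w != 0 by rewrite gt_eqF// D_pos.
rewrite christoffel_raiser// /christoffel1 pd_g_plusrr pd_r_inv_r2//.
by field.
Qed.
#[local] Opaque christoffel1.

Lemma lower_shape_op w A B : Dm w -> \sum_F gt w F A * shape_op w F B = dr_metric w B A.
Proof.
move=> Dw; rewrite -[RHS](lower_raise (gtu Dw) (gts Dw) (dr_metric w B)).
by apply: eq_bigr => F _; rewrite mulrC.
Qed.

Lemma dr_metric_sym w A B : Dm w -> dr_metric w A B = dr_metric w B A.
Proof. by move=> Dw; apply: (pd_on _ D_open Dw) => y Dy; apply: symE; exact: gts. Qed.

(** The only term of order r^-2 is - m gt / r^2, which is exactly - m times g_+. The Einstein
    equation cancels it and leaves terms that are at worst of order 1 / r. *)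
Lemma ricci_g_plus w B D : Dm w -> ricci gp w (T B) (T D) =
  slice_ricci w B D - 2^-1 * pd r_ (fun y => dr_metric y B D) w
  + (m%:R - 1) / 2 * dr_metric w B D / r_coord w
  + 2^-1 * (\sum_A shape_op w A A) * gt w B D / r_coord w
  - 4^-1 * (\sum_A shape_op w A A) * dr_metric w B D
  + 2^-1 * (\sum_A dr_metric w A D * shape_op w A B)
  - m%:R * gt w B D / r_coord w ^+ 2.
Proof.
move=> Dw; have r0 : r_coord w != 0 by rewrite gt_eqF// D_pos.
(* [Q] and [S] are the Christoffel symbols of g_+ with upper index r, and with one lower index r. *)
pose Q A C := gt w A C / r_coord w - 2^-1 * dr_metric w A C.
pose S A C := 2^-1 * shape_op w A C - (A == C)%:R / r_coord w.
rewrite (ricciE g_plus_sym g_plus_unit)// sum_Tr /curvature.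
have -> : pd r_ (fun y => G y r_ (T B) (T D)) w =
    dr_metric w B D / r_coord w - gt w B D / r_coord w ^+ 2
    - 2^-1 * pd r_ (fun y => dr_metric y B D) w.
  rewrite (pd_on r_ D_open Dw (fun y Dy => christoffel_rTT B D Dy)).
  have CV : Ck 1 Dm (fun y => (r_coord y)^-1).
    by apply: CkV => // [y Dy|]; [rewrite gt_eqF// D_pos|exact: Ck_r].
  have C1 : Ck 1 Dm (fun y => gt y B D / r_coord y).
    exact: (CkM D_open (Ck_S (gtC B D)) CV).
  have C2 : Ck 1 Dm (fun y => 2^-1 * dr_metric y B D).
    exact: (CkM D_open (Ck_cst 1 Dm _) (Ck_pd r_ (gtC B D))).
  rewrite (pd_sub r_ C1 C2 Dw) (pd_scale r_ _ (Ck_pd r_ (gtC B D)) Dw).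
  rewrite (pd_mul r_ (Ck_S (gtC B D)) CV Dw) (pd_inv r_ (Ck_r 1 Dm) Dw r0) pd_r_r.
  rewrite -/(dr_metric w B D); move: (dr_metric w B D) (pd r_ _ w) => p q.
  by field.
rewrite (pd_on (T B) D_open Dw (fun y Dy => christoffel_rrT D Dy)) pd_cst subr0.
have -> : \sum_f (G w f (T B) (T D) * G w r_ r_ f - G w f r_ (T D) * G w r_ (T B) f) =
    - Q B D / r_coord w - \sum_A S A D * Q B A.
  rewrite sum_Tr christoffel_rTr// christoffel_rrr// christoffel_rrT// christoffel_rTT//.
  rewrite mul0r subr0 addrC mulrN mulNr -sumrN; congr (_ + _); apply: eq_bigr => A _.
  by rewrite christoffel_rrT// christoffel_TrT// christoffel_rTT// mulr0 sub0r.
have -> : \sum_A (pd (T A) (fun y => G y (T A) (T B) (T D)) w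
     - pd (T B) (fun y => G y (T A) (T A) (T D)) w
     + \sum_f (G w f (T B) (T D) * G w (T A) (T A) f
               - G w f (T A) (T D) * G w (T A) (T B) f)) =
    slice_ricci w B D + (Q B D * \sum_A S A A - \sum_A Q A D * S A B).
  rewrite mulr_sumr -sumrB /slice_ricci -big_split; apply: eq_bigr => A _ /=.
  rewrite (pd_on (T A) D_open Dw (fun y Dy => christoffel_TTT A B D Dy)).
  rewrite (pd_on (T B) D_open Dw (fun y Dy => christoffel_TTT A A D Dy)).
  rewrite -[RHS]addrA; congr (_ + _).
  rewrite sum_Tr !christoffel_TTr// !christoffel_rTT//; congr (_ + _).
  by apply: eq_bigr => F _; rewrite !christoffel_TTT.
have trS : \sum_A S A A = 2^-1 * \sum_A shape_op w A A - m%:R / r_coord w.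
  rewrite sumrB -mulr_sumr; congr (_ - _); rewrite -mulr_suml; congr (_ / _).
  by under eq_bigr do rewrite eqxx; rewrite sumr_const card_ord.
have QS (C E : 'I_m) : \sum_A Q A C * S A E =
   dr_metric w E C / r_coord w - gt w E C / r_coord w ^+ 2
   - 4^-1 * \sum_A dr_metric w A C * shape_op w A E.
  have -> : \sum_A Q A C * S A E = \sum_A (2^-1 * (gt w A C * shape_op w A E) / r_coord w
     - (r_coord w)^-1 * (Q A C * (A == E)%:R) - 4^-1 * (dr_metric w A C * shape_op w A E)).
    apply: eq_bigr => A _; rewrite /Q /S.
    by move: (_ == _)%:R (dr_metric _ _ _) (shape_op _ _ _) => b p q; field.
  rewrite !sumrB -mulr_suml -!mulr_sumr lower_shape_op// sum_delta /Q.
  by move: (dr_metric _ _ _) (\sum_A _) => p q; field.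
rewrite trS (QS D B).
have -> : \sum_A S A D * Q B A = \sum_A Q A B * S A D.
  apply: eq_bigr => A _; rewrite mulrC; congr (_ * _).
  by rewrite /Q (symE (gts Dw) B A) (dr_metric_sym B A Dw).
rewrite (QS B D) (symE (gts Dw) D B) (dr_metric_sym D B Dw).
have -> : \sum_A dr_metric w A B * shape_op w A D = \sum_A dr_metric w A D * shape_op w A B.
  rewrite /shape_op; under eq_bigr do rewrite mulr_sumr.
  rewrite exchange_big; apply: eq_bigr => A _ /=; rewrite mulr_sumr.
  apply: eq_bigr => C _; rewrite (invmx_symE (gts Dw) A C).
  by rewrite (dr_metric_sym C B Dw) (dr_metric_sym D A Dw); ring.
rewrite /Q; move: (\sum_A _) (\sum_A _) (slice_ricci _ _ _) (dr_metric w B D) => p q s t.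
by move: (pd _ _ _) => v; field.
Qed.

End CollarMetric.

(** * Limits at the boundary *)

Section RightLimits.
Context (R : realType).
Implicit Types (f g : R -> R) (a b l : R).

Lemma cvg_right_near f g l : (\forall r \near 0^'+, f r = g r) ->
  f @ 0^'+ --> l -> g @ 0^'+ --> l.
Proof. by move=> fg; apply: cvg_trans; apply: near_eq_cvg; apply: filterS fg. Qed.

Lemma right_pos : \forall r \near (0 : R)^'+, 0 < r.
Proof. exact: nbhs_right_gt. Qed.

Lemma cvg_right_id : (fun r : R => r) @ 0^'+ --> (0 : R).
Proof. exact: cvg_at_right_filter cvg_id. Qed.

Lemma cvg_right_cst l : (fun _ : R => l) @ 0^'+ --> l.
Proof. exact: cvg_cst. Qed.

Lemma cvg_rightD f g a b : f @ 0^'+ --> a -> g @ 0^'+ --> b ->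
  (fun r => f r + g r) @ 0^'+ --> a + b.
Proof. exact: cvgD. Qed.

Lemma cvg_rightB f g a b : f @ 0^'+ --> a -> g @ 0^'+ --> b ->
  (fun r => f r - g r) @ 0^'+ --> a - b.
Proof. exact: cvgB. Qed.

Lemma cvg_rightM f g a b : f @ 0^'+ --> a -> g @ 0^'+ --> b ->
  (fun r => f r * g r) @ 0^'+ --> a * b.
Proof. exact: cvgM. Qed.

Lemma cvg_rightZ f (c : R) a : f @ 0^'+ --> a -> (fun r => c * f r) @ 0^'+ --> c * a.
Proof. by apply: cvg_rightM; exact: cvg_right_cst. Qed.

Lemma cvg_right_sum (I : Type) (s : seq I) (P : pred I) (F : I -> R -> R) (l : I -> R) :
  (forall i, P i -> F i @ 0^'+ --> l i) ->
  (fun r => \sum_(i <- s | P i) F i r) @ 0^'+ --> \sum_(i <- s | P i) l i.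
Proof.
move=> h; elim: s => [|i s IH].
  by under eq_fun do rewrite big_nil; rewrite big_nil; exact: cvg_cst.
under eq_fun do rewrite big_cons; rewrite big_cons.
by case Pi : (P i) => //; apply: cvg_rightD => //; exact: h.
Qed.

Lemma cvg_right_unique f a b : f @ 0^'+ --> a -> f @ 0^'+ --> b -> a = b.
Proof. exact: cvg_unique. Qed.

Lemma cvg_right_mul_r f a : f @ 0^'+ --> a -> (fun r => r * f r) @ 0^'+ --> (0 : R).
Proof. by move=> h; have := cvg_rightM cvg_right_id h; rewrite mul0r. Qed.

Lemma cvg_right_r2 : (fun r : R => r ^+ 2) @ 0^'+ --> (0 : R).
Proof. by have := cvg_right_mul_r cvg_right_id; under eq_fun do rewrite -expr2. Qed.

End RightLimits.

(** * Limits along curves that reach the boundary *)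

Section RayLimits.
#[local] Opaque pd christoffel christoffel1.
Context (R : realType) (m : nat).
Implicit Types (f : 'rV[R]_(m + 1) -> R) (z : 'rV[R]_m).
Implicit Types (v : R -> 'rV[R]_m) (W : 'I_m -> R).
Notation T := (lshift 1).
Notation r_ := (r_index m).

Lemma at_r_line z (r : R) : at_r z r = at_r z 0 + r *: delta_mx 0 r_.
Proof.
apply/rowP=> K; rewrite [RHS]mxE; case: (split_ordP K) => k ->.
  by rewrite !row_mxEl !mxE /r_index eq_lrshift andbF mulr0 addr0.
by rewrite !row_mxEr !mxE /r_index (ord1 k) !eqxx mulr1 add0r.
Qed.

Lemma at_rD z z' (r s : R) : at_r (z + z') (r + s) = at_r z r + at_r z' s.
Proof.
apply/rowP=> K; rewrite [RHS]mxE; case: (split_ordP K) => k ->.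
  by rewrite !row_mxEl !mxE.
by rewrite !row_mxEr !mxE.
Qed.

Lemma at_r_slice z (r h : R) A :
  at_r (h *: delta_mx 0 A + z) r = h *: delta_mx 0 (T A) + at_r z r.
Proof.
apply/rowP=> K; rewrite [RHS]mxE; case: (split_ordP K) => k ->.
  by rewrite !row_mxEl !mxE eqxx eq_lshift.
by rewrite !row_mxEr !mxE eqxx eq_rlshift mulr0 add0r.
Qed.

Lemma at_rT z (r : R) A : at_r z r 0 (T A) = z 0 A.
Proof. by rewrite row_mxEl. Qed.

Lemma at_rr z (r : R) : r_coord (at_r z r) = r.
Proof. by rewrite /r_coord row_mxEr mxE. Qed.

Lemma at_r_lsubmx z (r : R) : lsubmx (at_r z r) = z.
Proof. exact: row_mxKl. Qed.

Lemma at_r_continuous (r : R) : continuous ((@at_r R m)^~ r).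
Proof.
apply: continuous_row => K; case: (split_ordP K) => k ->.
  under eq_fun do rewrite row_mxEl; exact: coord_continuous.
under eq_fun do rewrite row_mxEr mxE; exact: cst_continuous.
Qed.

Lemma lsubmx_continuous : continuous (fun w : 'rV[R]_(m + 1) => lsubmx w).
Proof.
apply: continuous_row => K.
under eq_fun do rewrite mxE; exact: coord_continuous.
Qed.

Lemma pd_slice f A z (r : R) : pd A (fun y => f (at_r y r)) z = pd (T A) f (at_r z r).
Proof. by apply: (pd_restrict (s := fun A => T A)) => y k h; exact: at_r_slice. Qed.

Lemma Ck_slice k (O : set 'rV[R]_(m + 1)) f (r : R) : Ck k O f ->
  Ck k [set z | O (at_r z r)] (fun y => f (at_r y r)).
Proof.
move=> hf; apply: (Ck_restrict (s := fun A => T A)) => // [y A h|].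
  exact: at_r_slice.
exact: at_r_continuous.
Qed.

Context (O : set 'rV[R]_(m + 1)) (z : 'rV[R]_m).
Hypothesis O_open : open O.
Hypothesis Oz : O (at_r z 0).

(** The slice displacement is r^2 W + o(r^2). At this order it contributes only first derivatives of
    a function to its r^2 coefficient along the curve. *)
Definition cvg_at_0 (v : R -> 'rV[R]_m) (W : 'I_m -> R) :=
  forall A, (fun r => v r 0 A / r ^+ 2) @ 0^'+ --> W A.

Lemma cvg_at_0_cvg0 v W A : cvg_at_0 v W -> (fun r => v r 0 A) @ 0^'+ --> (0 : R).
Proof.
move=> h; have := cvg_rightM (cvg_right_mul_r (@cvg_right_id R)) (h A).
rewrite mul0r; apply: cvg_right_near; near=> r.
have r0 : r != 0 by rewrite gt_eqF//; near: r; exact: right_pos.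
by field.
Unshelve. all: by end_near. Qed.

Lemma at_r_near (v : R -> 'rV[R]_m) W (d : R) : cvg_at_0 v W -> 0 < d ->
  \forall r \near 0^'+, forall K, `|at_r (z + v r) r 0 K - at_r z 0 0 K| < d.
Proof.
move=> h d0; apply: filter_forall => K; case: (split_ordP K) => k ->.
  have /cvgrPdist_lt /(_ d d0) := cvg_at_0_cvg0 k h; apply: filterS => r.
  by rewrite !row_mxEl !mxE [_ + v r _ _]addrC addrK sub0r normrN.
have /cvgrPdist_lt /(_ d d0) := @cvg_right_id R; apply: filterS => r.
by rewrite !row_mxEr !mxE subr0 sub0r normrN.
Qed.

Lemma at_r_in (v : R -> 'rV[R]_m) W (P : set 'rV[R]_(m + 1)) : cvg_at_0 v W ->
  nbhs (at_r z 0) P -> \forall r \near 0^'+, P (at_r (z + v r) r).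
Proof.
move=> h /nbhs_coordP[d d0 hd]; have := at_r_near h d0.
by apply: filterS => r; exact: hd.
Qed.

Lemma cvg_at_0_cst : cvg_at_0 (fun=> 0) (fun=> 0).
Proof. by move=> A; under eq_fun do rewrite mxE mul0r; exact: cvg_cst. Qed.

Lemma ray_in (P : set 'rV[R]_(m + 1)) : nbhs (at_r z 0) P ->
  \forall r \near 0^'+, P (at_r z r).
Proof. by move=> h; have := at_r_in cvg_at_0_cst h; apply: filterS => r; rewrite addr0. Qed.

Lemma curve_cvg f v W : cvg_at_0 v W -> {for at_r z 0, continuous f} ->
  (fun r => f (at_r (z + v r) r)) @ 0^'+ --> f (at_r z 0).
Proof.
move=> h fc; apply/cvgrPdist_lt => e e0.
have /cvgrPdist_lt /(_ e e0) fe := fc.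
exact: at_r_in h fe.
Qed.

Lemma ray_cvg f : {for at_r z 0, continuous f} ->
  (fun r => f (at_r z r)) @ 0^'+ --> f (at_r z 0).
Proof. by move=> /(curve_cvg cvg_at_0_cst); under eq_fun do rewrite addr0. Qed.

(** The difference is taken from the point of the ray at the same height r, which moves with r;
    strict differentiability at the boundary point handles all these base points at once. *)
Lemma strict_diff_curve f v W : Ck 1 O f -> cvg_at_0 v W ->
  (fun r => (f (at_r (z + v r) r) - f (at_r z r)) / r ^+ 2) @ 0^'+
    --> \sum_A W A * pd (T A) f (at_r z 0).
Proof.
move=> hf h.
have lim1 : (fun r => \sum_A (v r 0 A / r ^+ 2) * pd (T A) f (at_r z 0)) @ 0^'+ -->
    \sum_A W A * pd (T A) f (at_r z 0).
  by apply: cvg_right_sum => A _; apply: cvg_rightM; [exact: h|exact: cvg_right_cst].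
have lim2 : (fun r => (f (at_r (z + v r) r) - f (at_r z r)) / r ^+ 2
    - \sum_A (v r 0 A / r ^+ 2) * pd (T A) f (at_r z 0)) @ 0^'+ --> (0 : R).
  (* An eventual strict bound for the rescaled displacement; the [+ 1] makes it positive and larger
     than the limit, so tolerance [e / M] in [strict_diff] yields total error below [e]. *)
  pose M := \sum_A `|W A| + 1.
  have M0 : 0 < M by rewrite ltr_wpDl// sumr_ge0.
  have hM : \forall r \near 0^'+, \sum_A `|v r 0 A / r ^+ 2| < M.
    have : (fun r => \sum_A `|v r 0 A / r ^+ 2|) @ 0^'+ --> \sum_A `|W A|.
      by apply: cvg_right_sum => A _; apply: cvg_norm; exact: h.
    by move=> /cvgr_lt; apply; rewrite ltrDl.
  apply/cvgrPdist_lt => e e0.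
  have e1 : 0 < e / M by rewrite divr_gt0.
  have [d d0 hd] := strict_diff O_open Oz hf e1.
  have hv := at_r_near h d0.
  have hv0 : \forall r \near 0^'+, forall A, `|v r 0 A| < d.
    apply: filter_forall => A.
    have /cvgrPdist_lt /(_ d d0) := cvg_at_0_cvg0 A h; apply: filterS => r.
    by rewrite sub0r normrN.
  near=> r.
  have r0 : 0 < r by near: r; exact: right_pos.
  have rd : r < d by near: r; exact: nbhs_right_lt.
  rewrite sub0r normrN.
  have hz K : `|at_r z r 0 K - at_r z 0 0 K| < d.
    case: (split_ordP K) => k ->; first by rewrite !at_rT subrr normr0.
    by rewrite !row_mxEr !mxE subr0 gtr0_norm.
  have hv1 K : `|at_r (v r) 0 0 K| < d.
    case: (split_ordP K) => k ->; last by rewrite row_mxEr mxE normr0.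
    by rewrite at_rT; move: k; near: r.
  have := hd _ _ hz hv1; rewrite -at_rD addr0 !sum_Tr /=.
  have -> : at_r (v r) 0 0 r_ = 0 by rewrite row_mxEr mxE.
  rewrite mul0r addr0 normr0 addr0.
  under eq_bigr do rewrite at_rT.
  under [X in _ <= _ * X]eq_bigr do rewrite at_rT.
  move=> hh.
  have -> : (f (at_r (z + v r) r) - f (at_r z r)) / r ^+ 2
    - \sum_A (v r 0 A / r ^+ 2) * pd (T A) f (at_r z 0) =
    (f (at_r (z + v r) r) - f (at_r z r) - \sum_A v r 0 A * pd (T A) f (at_r z 0)) / r ^+ 2.
    rewrite [RHS]mulrBl mulr_suml; congr (_ - _); apply: eq_bigr => A _.
    by rewrite mulrAC.
  have rr : 0 < (r ^+ 2)^-1 by rewrite invr_gt0 exprn_gt0.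
  rewrite normrM [X in _ * X]gtr0_norm//.
  apply: (@le_lt_trans _ _ (e / M * \sum_A `|v r 0 A / r ^+ 2|)).
    under [X in _ <= _ * X]eq_bigr do rewrite normrM [X in _ * X]gtr0_norm//.
    by rewrite -mulr_suml mulrA ler_pM2r.
  rewrite mulrAC ltr_pdivrMr// ltr_pM2l//.
  by near: r.
have := cvg_rightD lim1 lim2; rewrite addr0; apply: cvg_right_near; near=> r.
by rewrite addrC subrK.
Unshelve. all: by end_near. Qed.

Lemma ray_derivative f : derivable f (at_r z 0) (delta_mx 0 r_) ->
  (fun r => (f (at_r z r) - f (at_r z 0)) / r) @ 0^'+ --> pd r_ f (at_r z 0).
Proof.
move=> /cvg_dnbhs_at_right; apply: cvg_right_near; near=> r.
by rewrite /= [in RHS]at_r_line [r *: _ + _]addrC [LHS]mulrC.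
Unshelve. all: by end_near. Qed.

(** The quadratic candidate is subtracted and the mean value theorem applied once; first-order
    differentiability of [pd r_ f] at the boundary point then bounds the result. This uses no
    derivative of order three. *)
Lemma ray_taylor2 f : Ck 2 O f -> pd r_ f (at_r z 0) = 0 ->
  (fun r => (f (at_r z r) - f (at_r z 0)) / r ^+ 2) @ 0^'+
    --> 2^-1 * pd r_ (pd r_ f) (at_r z 0).
Proof.
move=> hf f0; set q := at_r z 0; set a := pd r_ (pd r_ f) q.
have C2 : Ck 2 O (fun w => 2^-1 * a * (r_coord w * r_coord w)).
  exact: (CkM O_open (Ck_cst 2 O _) (CkM O_open (Ck_r 2 O) (Ck_r 2 O))).
pose psi w := f w - 2^-1 * a * (r_coord w * r_coord w).
have Cpsi : Ck 2 O psi by exact: CkB.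
have dpsi w : O w -> pd r_ psi w = pd r_ f w - a * r_coord w.
  move=> Ow; rewrite (pd_sub r_ (Ck_S hf) (Ck_S C2) Ow); congr (_ - _).
  rewrite (pd_scale r_ _ (CkM O_open (Ck_r 1 O) (Ck_r 1 O)) Ow).
  rewrite (pd_mul r_ (Ck_r 1 O) (Ck_r 1 O) Ow) !pd_r_r.
  by field.
apply/cvgrPdist_lt => e e0.
have e1 : 0 < e / 2 by rewrite divr_gt0.
have [d d0 hd] := strict_diff O_open Oz (Ck_pd r_ hf) e1.
have [d' d'0 hd'] := nbhs_coordP (open_nbhs_nbhs (conj O_open Oz)).
near=> r.
have r0 : 0 < r by near: r; exact: right_pos.
have rd : r < d by near: r; exact: nbhs_right_lt.
have rd' : r < d' by near: r; exact: nbhs_right_lt.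
have inO (c : R) : `|c| <= `|r| -> O (q + c *: delta_mx 0 r_).
  move=> cr; apply: hd' => K; rewrite mxE [X in `|X|]addrC addKr mxE.
  apply: le_lt_trans rd'; rewrite normrM; rewrite (gtr0_norm r0) in cr; apply: le_trans cr.
  by rewrite mxE eqxx /=; case: (K == r_); rewrite ?normr1 ?normr0 ?mulr1 ?mulr0.
have [c cr e2] := mean_value_pd (fun c cr => Ck_derivable (i := r_) Cpsi (inO c cr)).
rewrite -at_r_line -/q in e2.
have e3 : pd r_ psi (q + c *: delta_mx 0 r_) = pd r_ f (q + c *: delta_mx 0 r_) - c * a.
  by rewrite dpsi; [rewrite /q -at_r_line at_rr mulrC|exact: inO].
have /hd e4 : forall K, `|q 0 K - at_r z 0 0 K| < d by move=> K; rewrite subrr normr0.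
have cd K : `|(c *: delta_mx 0 r_ : 'rV[R]_(m + 1)) 0 K| < d.
  apply: le_lt_trans rd; rewrite (gtr0_norm r0) in cr; apply: le_trans cr.
  by rewrite !mxE eqxx normrM /=; case: (K == r_); rewrite ?normr1 ?normr0 ?mulr1 ?mulr0.
have := e4 _ cd; rewrite f0 subr0.
have -> : \sum_i (c *: delta_mx 0 r_ : 'rV[R]_(m + 1)) 0 i * pd i (pd r_ f) (at_r z 0) = c * a.
  under eq_bigr do rewrite !mxE eqxx /= -mulrA.
  by rewrite -mulr_sumr sum_deltal.
have -> : \sum_i `|(c *: delta_mx 0 r_ : 'rV[R]_(m + 1)) 0 i| = `|c|.
  under eq_bigr do rewrite !mxE eqxx /= normrM normr_nat.
  by rewrite -mulr_sumr -[RHS]mulr1; congr (_ * _); rewrite -[RHS](sum_deltal (fun=> 1) r_);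
     apply: eq_bigr => i _; rewrite mulr1.
move=> e5.
rewrite [X in `|X|](_ : _ =
    - (pd r_ f (q + c *: delta_mx 0 r_) - c * a) / r); last first.
  have : f (at_r z r) - f q = 2^-1 * a * r ^+ 2 + r * (pd r_ f (q + c *: delta_mx 0 r_) - c * a).
    rewrite -e3 -e2 /psi at_rr /q at_rr mulr0 mulr0 subr0 expr2.
    by move: (f _) (f _) => p t; ring.
  rewrite /= => ->; move: (pd _ _ _) => p; field; exact: lt0r_neq0.
rewrite normrM normrN normfV (gtr0_norm r0) ltr_pdivrMr//.
apply: le_lt_trans e5 _; rewrite (gtr0_norm r0) in cr.
apply: (@le_lt_trans _ _ (e / 2 * r)); first by rewrite ler_pM2l.
by rewrite ltr_pM2r// ltr_pdivrMr// ltr_pMr// ltr1n.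
Unshelve. all: by end_near. Qed.

(** The slice displacement contributes its first-order term and the height r its second-order term;
    there is no term of order r because the normal derivative vanishes. *)
Lemma curve_jet f v W : Ck 2 O f -> pd r_ f (at_r z 0) = 0 -> cvg_at_0 v W ->
  (fun r => (f (at_r (z + v r) r) - f (at_r z 0)) / r ^+ 2) @ 0^'+
    --> \sum_A W A * pd (T A) f (at_r z 0) + 2^-1 * pd r_ (pd r_ f) (at_r z 0).
Proof.
move=> hf f0 h; have := cvg_rightD (strict_diff_curve (Ck_S hf) h) (ray_taylor2 hf f0).
apply: cvg_right_near; near=> r.
by rewrite -mulrDl subrKA.
Unshelve. all: by end_near. Qed.

Lemma curve_jet1 f v W : Ck 1 O f -> f (at_r z 0) = 0 -> cvg_at_0 v W ->
  (fun r => f (at_r (z + v r) r) / r) @ 0^'+ --> pd r_ f (at_r z 0).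
Proof.
move=> hf f0 h.
have h1 := cvg_right_mul_r (strict_diff_curve hf h).
have h2 := ray_derivative (Ck_derivable (i := r_) hf Oz).
have := cvg_rightD h1 h2; rewrite add0r; apply: cvg_right_near; near=> r.
have r0 : r != 0 by rewrite gt_eqF//; near: r; exact: right_pos.
by rewrite f0; move: (f _) (f _) => p q; field.
Unshelve. all: by end_near. Qed.

End RayLimits.

(** * Boundary expansion of the Einstein metric *)

Section Germs.
#[local] Opaque pd.
Context (R : realType) (N : nat).
Implicit Types (g : 'rV[R]_N -> 'M[R]_N) (z : 'rV[R]_N).

Let entry_near (X : Type) (f1 f2 : 'rV[R]_N -> X) (Y : Type) (h : X -> Y) z :
  {near z, f1 =1 f2} -> {near z, (fun y => h (f1 y)) =1 (fun y => h (f2 y))}.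
Proof. by apply: filterS => y ->. Qed.

(** All curvature quantities depend on the germ of the metric. This allows the collar metric to be
    replaced by a smooth extension near a point. *)
Lemma christoffel_near g1 g2 z : {near z, g1 =1 g2} ->
  christoffel g1 z = christoffel g2 z.
Proof.
move=> h; have e : g1 z = g2 z by apply: nbhs_singleton h.
have E i a b : pd i (fun y => g1 y a b) z = pd i (fun y => g2 y a b) z.
  by apply: pd_near; apply: (entry_near (fun A : 'M[R]_N => A a b)).
apply/funext=> k; apply/funext => i; apply/funext => j.
rewrite /christoffel e; congr (_ * _); apply: eq_bigr => l _.
by rewrite !E.
Qed.

Lemma curvature_near g1 g2 z : {near z, g1 =1 g2} -> curvature g1 z = curvature g2 z.
Proof.
move=> h.
have h' : {near z, christoffel g1 =1 christoffel g2}.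
  by apply: filterS (near_join h) => y; exact: christoffel_near.
have E i k a b : pd i (fun y => christoffel g1 y k a b) z =
    pd i (fun y => christoffel g2 y k a b) z.
  by apply: pd_near; apply: (entry_near (fun G : 'I_N -> 'I_N -> 'I_N -> R => G k a b)).
apply/funext=> a; apply/funext => b; apply/funext => d; apply/funext => e.
by rewrite /curvature !E (christoffel_near h).
Qed.

Lemma riemann_near g1 g2 z : {near z, g1 =1 g2} -> riemann g1 z = riemann g2 z.
Proof.
move=> h; apply/funext=> a; apply/funext => b; apply/funext => c; apply/funext => d.
have e : g1 z = g2 z by apply: nbhs_singleton h.
by rewrite /riemann (curvature_near h) e.
Qed.

Lemma ricci_near g1 g2 z : {near z, g1 =1 g2} -> ricci g1 z = ricci g2 z.
Proof.
move=> h; have e : g1 z = g2 z by apply: nbhs_singleton h.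
by rewrite /ricci (riemann_near h) e.
Qed.

Lemma schouten_near g1 g2 z : {near z, g1 =1 g2} -> schouten g1 z = schouten g2 z.
Proof.
move=> h; have e : g1 z = g2 z by apply: nbhs_singleton h.
by rewrite /schouten /scalar_curvature (ricci_near h) e.
Qed.

End Germs.

Lemma schoutenE (R : realType) (N : nat) (g : 'rV[R]_N -> 'M[R]_N) z a b :
  schouten g z a b = (N%:R - 2)^-1 *
    (ricci g z a b - scalar_curvature g z / (2 * (N%:R - 1)) * g z a b).
Proof. by rewrite /schouten; move: (ricci g z) => A; rewrite !mxE. Qed.

Section BoundaryExpansion.
#[local] Opaque pd christoffel christoffel1.
Context (R : realType) (m : nat) (G : 'rV[R]_(m + 1) -> 'M[R]_m).
Context (O : set 'rV[R]_(m + 1)).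
Hypothesis m_ge3 : (2 < m)%N.
Hypothesis O_open : open O.
Hypothesis GC : forall A B, Ck 3 O (fun w => G w A B).
Hypothesis Gs : forall w, O w -> (G w)^T = G w.
Hypothesis Gu : forall w, O w -> G w \in unitmx.
Hypothesis G_einstein : forall w, O w -> 0 < r_coord w ->
  ricci (g_plus G) w = - m%:R *: g_plus G w.
Implicit Types (w : 'rV[R]_(m + 1)) (z : 'rV[R]_m) (A B C D L E : 'I_m).
Notation T := (lshift 1).
Notation r_ := (r_index m).
Notation at0 := ((@at_r R m)^~ 0).
Notation g := (boundary_metric G).
Notation N := [set z | O (at_r z 0)].

Let GC1 k A B : (k <= 3)%N -> Ck k O (fun w => G w A B).
Proof. by move=> h; exact: Ck_le h (GC A B). Qed.

Lemma Ck_slice_christoffel A B C : Ck 2 O (fun w => slice_christoffel G w A B C).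
Proof.
apply: Ck_sum => // L _; apply: (CkM O_open).
  by apply: Ck_invmx => // *; exact: GC1.
apply: (CkM O_open (Ck_cst 2 O _)).
exact: (CkB O_open (CkD O_open (Ck_pd _ (GC _ _)) (Ck_pd _ (GC _ _))) (Ck_pd _ (GC _ _))).
Qed.

Lemma Ck_dr_metric A B : Ck 2 O (fun w => dr_metric G w A B).
Proof. exact: (Ck_pd r_ (GC A B)). Qed.

Let Ck_inv A B : Ck 2 O (fun w => invmx (G w) A B).
Proof. by apply: Ck_invmx => // *; exact: GC1. Qed.

Lemma Ck_shape_op A B : Ck 2 O (fun w => shape_op G w A B).
Proof.
apply: Ck_sum => // L _.
exact: (CkM O_open (Ck_inv A L) (Ck_dr_metric B L)).
Qed.

Lemma Ck_slice_ricci B D : Ck 1 O (fun w => slice_ricci G w B D).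
Proof.
have S A B' C := Ck_S (Ck_slice_christoffel A B' C).
apply: Ck_sum => // A _; apply: (CkD O_open).
  exact: (CkB O_open (Ck_pd _ (Ck_slice_christoffel _ _ _)) (Ck_pd _ (Ck_slice_christoffel _ _ _))).
apply: Ck_sum => // F _.
exact: (CkB O_open (CkM O_open (S _ _ _) (S _ _ _)) (CkM O_open (S _ _ _) (S _ _ _))).
Qed.

Let Dm : set 'rV[R]_(m + 1) := [set w | O w /\ 0 < r_coord w].

Let Dm_open : open Dm.
Proof.
apply: openI => //.
have -> : (fun w : 'rV[R]_(m + 1) => is_true (0 < r_coord w)) = (@r_coord R m) @^-1` [set r | 0 < r] by [].
apply: open_comp; last exact: open_gt.
by move=> w _; exact: coord_continuous.
Qed.

Let einstein_slice w B D : Dm w ->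
  slice_ricci G w B D - 2^-1 * pd r_ (fun y => dr_metric G y B D) w
  + (m%:R - 1) / 2 * (dr_metric G w B D / r_coord w)
  + 2^-1 * (\sum_A shape_op G w A A / r_coord w) * G w B D
  - 4^-1 * (\sum_A shape_op G w A A) * dr_metric G w B D
  + 2^-1 * (\sum_A dr_metric G w A D * shape_op G w A B) = 0.
Proof.
move=> Dw; have [Ow r0] := Dw.
have r0' : r_coord w != 0 by rewrite gt_eqF.
have := @ricci_g_plus R m G Dm Dm_open (fun w Dw => proj2 Dw)
  (fun A B => Ck_sub (fun w Dw => proj1 Dw) (@GC1 2%N A B isT))
  (fun w Dw => Gs (proj1 Dw)) (fun w Dw => Gu (proj1 Dw)) w B D Dw.
rewrite G_einstein// mxE g_plusTT -mulr_suml.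
move: (\sum_A _) (\sum_A _) (slice_ricci _ _ _ _) (dr_metric _ _ _ _) (pd _ _ _) => p q s t v e.
have <- : - m%:R * ((r_coord w ^+ 2)^-1 * G w B D) + m%:R * G w B D / r_coord w ^+ 2 = 0 by field.
by rewrite e; field.
Qed.

Let ray_Dm z : N z -> \forall r \near 0^'+, Dm (at_r z r).
Proof.
move=> Nz; have h : nbhs (at_r z 0) O by apply: open_nbhs_nbhs.
near=> r; split; first by near: r; exact: ray_in.
by rewrite at_rr; near: r; exact: right_pos.
Unshelve. all: by end_near. Qed.

Let ray k z f : N z -> Ck k O f -> (fun r => f (at_r z r)) @ 0^'+ --> f (at_r z 0).
Proof. by move=> Nz hf; apply: ray_cvg; exact: Ck_cont hf Nz. Qed.

Let mR_neq c : (c < 3)%N -> m%:R - c%:R != 0 :> R.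
Proof.
move=> c3; rewrite -natrB ?pnatr_eq0 ?subn_eq0 -?ltnNge; last by apply: ltnW; apply: leq_trans m_ge3.
exact: leq_trans c3 m_ge3.
Qed.

Let metric_trace w : O w -> \sum_A \sum_L invmx (G w) A L * G w A L = m%:R.
Proof.
move=> Ow; transitivity (\sum_(A < m) (A == A)%:R : R).
  apply: eq_bigr => A _; rewrite -(sum_mulVmx (Gu Ow)).
  by apply: eq_bigr => L _; rewrite (symE (Gs Ow) A L).
by under eq_bigr do rewrite eqxx; rewrite sumr_const card_ord.
Qed.

(** Multiplying the Einstein equation by r and letting r -> 0 leaves a linear relation between the
    first r-derivative of the metric and its trace. Taking the trace gives (m - 1/2) t = 0, so t =
    0, and then m different from 1 kills the derivative itself. *)
Lemma dr_metric0 z A B : N z -> dr_metric G (at_r z 0) A B = 0.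
Proof.
move=> Nz; set q := at_r z 0.
have E C D : (m%:R - 1) / 2 * dr_metric G q C D
    + 2^-1 * (\sum_A shape_op G q A A) * G q C D = 0.
  pose tr w := \sum_A shape_op G w A A.
  have Ctr : Ck 2 O tr by exact: (Ck_bigsum O_open (fun F => Ck_shape_op F F)).
  pose K w := \sum_A dr_metric G w A D * shape_op G w A C.
  have CK : Ck 2 O K.
    by exact: (Ck_bigsum O_open (fun F => CkM O_open (Ck_dr_metric F D) (Ck_shape_op F C))).
  have L1 := ray Nz (CkM O_open (Ck_cst 2 O ((m%:R - 1) / 2)) (Ck_dr_metric C D)).
  have L2 := ray Nz (CkM O_open (CkM O_open (Ck_cst 2 O 2^-1) Ctr) (@GC1 2%N C D isT)).
  have L3 := ray Nz (CkB O_open (Ck_slice_ricci C D)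
     (CkM O_open (Ck_cst 1 O 2^-1) (Ck_pd r_ (Ck_dr_metric C D)))).
  have L4 := ray Nz (CkB O_open (CkM O_open (Ck_cst 2 O 2^-1) CK)
     (CkM O_open (CkM O_open (Ck_cst 2 O 4^-1) Ctr) (Ck_dr_metric C D))).
  have L5 := cvg_right_mul_r (cvg_rightD L3 L4).
  have := cvg_rightD (cvg_rightD L1 L2) L5; rewrite addr0 => L.
  apply: (cvg_right_unique L).
  have := @cvg_right_cst R 0; apply: cvg_right_near; near=> r.
  have Dr : Dm (at_r z r) by near: r; exact: ray_Dm.
  have r0 : r != 0 by have [_] := Dr; rewrite at_rr => /gt_eqF ->.
  have := einstein_slice C D Dr; rewrite at_rr -mulr_suml -/(tr _) -/(K _) => e.
  rewrite -[LHS](mulr0 r) -e.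
  move: (tr _) (K _) (slice_ricci _ _ _ _) (dr_metric _ _ _ _) (pd _ _ _) => p1 p2 p3 p4 p5.
  by field.
pose t := \sum_A shape_op G q A A.
have t0 : t = 0.
  have : \sum_C \sum_D invmx (G q) C D * ((m%:R - 1) / 2 * dr_metric G q C D
    + 2^-1 * t * G q C D) = 0.
    by apply: big1 => C _; apply: big1 => D _; rewrite E mulr0.
  rewrite (eq_bigr (fun C => (m%:R - 1) / 2 * shape_op G q C C
     + 2^-1 * t * \sum_D invmx (G q) C D * G q C D)); last first.
    move=> C _; rewrite /shape_op !mulr_sumr -big_split; apply: eq_bigr => D _ /=.
    by move: (dr_metric _ _ _ _) (invmx _ _ _) => p1 p2; ring.
  rewrite big_split -!mulr_sumr /= metric_trace// -/t => /eqP.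
  rewrite (_ : _ + _ = (m%:R - 2^-1) * t); last by field.
  rewrite mulf_eq0 => /orP[|/eqP//]; rewrite subr_eq0 => /eqP m2; exfalso.
  (* The value m = 1/2 is excluded by parity, since it would make 2 m = 1. *)
  have : (2 * m)%:R = 1 :> R by rewrite natrM m2; field.
  move/eqP; rewrite pnatr_eq1 => /eqP m21.
  by have := congr1 odd m21; rewrite oddM.
have := E A B; rewrite -/t t0 mulr0 mul0r addr0 => /eqP.
rewrite mulf_eq0 => /orP[|/eqP//]; rewrite mulf_eq0 invr_eq0 pnatr_eq0 orbF.
by rewrite (negPf (@mR_neq 1%N isT)).
Unshelve. all: by end_near. Qed.

Lemma boundary_open : open N.
Proof. by apply: open_comp => // z _; exact: at_r_continuous. Qed.

Lemma Ck_boundary k f : Ck k O f -> Ck k N (fun z => f (at_r z 0)).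
Proof. exact: Ck_slice. Qed.

Lemma boundary_metricC A B : Ck 3 N (fun z => g z A B).
Proof. exact: (Ck_boundary (GC A B)). Qed.

Let gs z : N z -> (g z)^T = g z. Proof. exact: Gs. Qed.
Let gu z : N z -> g z \in unitmx. Proof. exact: Gu. Qed.

Transparent christoffel1.
Lemma christoffel_boundary z A B C :
  christoffel g z A B C = slice_christoffel G (at_r z 0) A B C.
Proof.
rewrite christoffelE; apply: eq_bigr => L _; congr (_ * _); congr (_ * _).
by rewrite -!(pd_slice (fun w => G w _ _)).
Qed.
#[local] Opaque christoffel1.

Lemma ricci_boundary z B D : N z -> ricci g z B D = slice_ricci G (at_r z 0) B D.
Proof.
move=> Nz; rewrite (ricciE gs gu)//; apply: eq_bigr => A _; rewrite /curvature.
have E E' A' B' C' : pd E' (fun y => christoffel g y A' B' C') z =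
    pd (T E') (fun w => slice_christoffel G w A' B' C') (at_r z 0).
  rewrite -(pd_slice (fun w => slice_christoffel G w A' B' C')).
  by under eq_fun do rewrite christoffel_boundary.
have cong (a b c a' b' c' : R) : a = a' -> b = b' -> c = c' -> a - b + c = a' - b' + c'.
  by move=> -> -> ->.
apply: (cong _ _ _ _ _ _ (E _ _ _ _) (E _ _ _ _)).
by apply: eq_bigr => F _; rewrite !christoffel_boundary.
Qed.

(** Since the first r-derivative vanishes on the boundary, its quotient by r tends to the second
    derivative, and the Einstein equation itself has a limit. The coefficient (m - 2) / 2 is (m - 1)
    / 2 - 1 / 2, and the terms quadratic in the first derivative disappear. *)
Lemma einstein_boundary z B D : N z ->
  ricci g z B D + (m%:R - 2) / 2 * pd r_ (fun w => dr_metric G w B D) (at_r z 0)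
  + 2^-1 * (\sum_A \sum_L invmx (g z) A L * pd r_ (fun w => dr_metric G w A L) (at_r z 0))
    * g z B D = 0.
Proof.
move=> Nz; rewrite ricci_boundary//; set q := at_r z 0.
have dr_ray C D' : (fun r => dr_metric G (at_r z r) C D' / r) @ 0^'+
    --> pd r_ (fun w => dr_metric G w C D') q.
  have := ray_derivative (Ck_derivable (i := r_) (Ck_dr_metric C D') Nz).
  by rewrite dr_metric0//; apply: cvg_right_near; near=> r; rewrite subr0.
pose tr w := \sum_A shape_op G w A A.
have Ctr : Ck 2 O tr by exact: (Ck_bigsum O_open (fun F => Ck_shape_op F F)).
pose K w := \sum_A dr_metric G w A D * shape_op G w A B.
have CK : Ck 2 O K.
  by exact: (Ck_bigsum O_open (fun F => CkM O_open (Ck_dr_metric F D) (Ck_shape_op F B))).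
have K0 : K q = 0 by apply: big1 => A _; rewrite dr_metric0// mul0r.
have tr_ray : (fun r => tr (at_r z r) / r) @ 0^'+ -->
    \sum_A \sum_L invmx (g z) A L * pd r_ (fun w => dr_metric G w A L) q.
  have : (fun r => \sum_A \sum_L invmx (G (at_r z r)) A L * (dr_metric G (at_r z r) A L / r))
     @ 0^'+ --> \sum_A \sum_L invmx (g z) A L * pd r_ (fun w => dr_metric G w A L) q.
    apply: cvg_right_sum => A _; apply: cvg_right_sum => L _.
    exact: (cvg_rightM (ray Nz (Ck_inv A L)) (dr_ray A L)).
  apply: cvg_right_near; near=> r.
  rewrite mulr_suml; apply: eq_bigr => A _; rewrite mulr_suml; apply: eq_bigr => L _.
  by rewrite mulrA.
have L1 := ray Nz (CkB O_open (Ck_slice_ricci B D)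
     (CkM O_open (Ck_cst 1 O 2^-1) (Ck_pd r_ (Ck_dr_metric B D)))).
have L2 := cvg_rightZ (c := (m%:R - 1) / 2) (dr_ray B D).
have L3 := cvg_rightM (cvg_rightZ (c := 2^-1) tr_ray) (ray Nz (@GC1 2%N B D isT)).
have L4 := ray Nz (CkB O_open (CkM O_open (Ck_cst 2 O 2^-1) CK)
     (CkM O_open (CkM O_open (Ck_cst 2 O 4^-1) Ctr) (Ck_dr_metric B D))).
rewrite /= K0 dr_metric0// !mulr0 subr0 in L4.
have := cvg_rightD (cvg_rightD (cvg_rightD L1 L2) L3) L4; rewrite addr0 => L.
transitivity (slice_ricci G q B D - 2^-1 * pd r_ (fun w => dr_metric G w B D) q
  + (m%:R - 1) / 2 * pd r_ (fun w => dr_metric G w B D) q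
  + 2^-1 * (\sum_A \sum_L invmx (g z) A L * pd r_ (fun w => dr_metric G w A L) q) * G q B D).
  rewrite -/(g z); move: (\sum_A _) (slice_ricci _ _ _ _) (pd _ _ _) => p1 p2 p3.
  by field.
apply: (cvg_right_unique L).
have := @cvg_right_cst R 0; apply: cvg_right_near; near=> r.
have Dr : Dm (at_r z r) by near: r; exact: ray_Dm.
have := einstein_slice B D Dr; rewrite at_rr -mulr_suml -/(tr _) -/(K _) => e.
rewrite -e.
move: (tr _) (K _) (slice_ricci _ _ _ _) (dr_metric _ _ _ _) (pd _ _ _) => p1 p2 p3 p4 p5.
by ring.
Unshelve. all: by end_near. Qed.

(* The expansion g^(2) = - P of the collar metric. *)
Lemma dr2_metric_schouten z B D : N z ->
  pd r_ (fun w => dr_metric G w B D) (at_r z 0) = - 2 * schouten g z B D.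
Proof.
move=> Nz; pose t := \sum_A \sum_L invmx (g z) A L * pd r_ (fun w => dr_metric G w A L) (at_r z 0).
have m1 := @mR_neq 1%N isT; have m2 := @mR_neq 2%N isT.
(* The trace of the boundary equation is Scal + (m - 2) / 2 * t + m / 2 * t = 0. Substituting [t]
   back and dividing by m - 2 produces the Schouten tensor. *)
have t_scal : t = - scalar_curvature g z / (m%:R - 1).
  have : \sum_A \sum_L invmx (g z) A L * (ricci g z A L
     + (m%:R - 2) / 2 * pd r_ (fun w => dr_metric G w A L) (at_r z 0) + 2^-1 * t * g z A L) = 0.
    by apply: big1 => A _; apply: big1 => L _; rewrite einstein_boundary// mulr0.
  rewrite (eq_bigr (fun A => \sum_L invmx (g z) A L * ricci g z A L
     + (m%:R - 2) / 2 * (\sum_L invmx (g z) A L * pd r_ (fun w => dr_metric G w A L) (at_r z 0))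
     + 2^-1 * t * \sum_L invmx (g z) A L * g z A L)); last first.
    move=> A _; rewrite !mulr_sumr -!big_split; apply: eq_bigr => L _ /=.
    by move: (ricci _ _ _ _) (pd _ _ _) (invmx _ _ _) => p1 p2 p3; ring.
  rewrite !big_split -!mulr_sumr /= metric_trace// -/t -/(scalar_curvature g z) => e.
  apply: (mulIf m1); rewrite mulfVK//; apply/eqP; rewrite -subr_eq0 opprK -e; apply/eqP.
  by clear e; clearbody t; move: (scalar_curvature _ _) => p1; field.
have := einstein_boundary B D Nz; rewrite -/t t_scal schoutenE => /eqP.
move: (scalar_curvature _ _) (ricci _ _ _ _) (pd _ _ _) => p1 p2 p3.
move=> /eqP e; apply: (mulfI m2).
have -> : (m%:R - 2) * p3 = 2 * ((m%:R - 2) / 2 * p3) by field.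
have -> : (m%:R - 2) / 2 * p3 = - p2 - 2^-1 * (- p1 / (m%:R - 1)) * g z B D.
  by move: e; move: (_ * p3) (2^-1 * _ * _) => a b e; rewrite -[- p2]addr0 -e; ring.
by field; rewrite m1 m2.
Qed.

Lemma metric_jet z v W A B : N z -> cvg_at_0 v W ->
  (fun r => (G (at_r (z + v r) r) A B - g z A B) / r ^+ 2) @ 0^'+
    --> \sum_C W C * pd C (fun y => g y A B) z - schouten g z A B.
Proof.
move=> Nz h; have := curve_jet O_open Nz (@GC1 2%N A B isT) (dr_metric0 A B Nz) h.
rewrite (dr2_metric_schouten A B Nz) mulNr mulrN mulrA mulVf ?pnatr_eq0// mul1r.
under [X in _ --> X - _ -> _]eq_bigr do rewrite -(pd_slice (fun w => G w A B)).
exact.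
Qed.

(** [curve_jet] for a slice derivative of the metric. Slice and normal derivatives commute, so its
    first r-derivative vanishes with that of the metric on the whole boundary, and its second is the
    slice derivative of -2 P. *)
Lemma metric_pd_jet z v W A B C : N z -> cvg_at_0 v W ->
  (fun r => (pd (T C) (fun w => G w A B) (at_r (z + v r) r) - pd C (fun y => g y A B) z) / r ^+ 2)
    @ 0^'+ --> \sum_E W E * pd E (pd C (fun y => g y A B)) z
              - pd C (fun y => schouten g y A B) z.
Proof.
move=> Nz h; have CC := Ck_pd (T C) (GC A B).
have d0 : pd r_ (pd (T C) (fun w => G w A B)) (at_r z 0) = 0.
  rewrite (pdC _ _ O_open Nz (@GC1 2%N A B isT)) -(pd_slice (pd r_ _)).
  rewrite (pd_on C boundary_open Nz (g := fun=> 0)) ?pd_cst// => y Ny.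
  exact: dr_metric0.
have := curve_jet O_open Nz CC d0 h.
have -> : pd r_ (pd r_ (pd (T C) (fun w => G w A B))) (at_r z 0) =
    - 2 * pd C (fun y => schouten g y A B) z.
  rewrite (pd_on r_ O_open Nz (fun w Ow => pdC r_ (T C) O_open Ow (@GC1 2%N A B isT))).
  rewrite (pdC _ _ O_open Nz (Ck_dr_metric A B)) -(pd_slice (pd r_ _)).
  rewrite (pd_on C boundary_open Nz (fun y Ny => dr2_metric_schouten A B Ny)).
  apply: (pd_scale (D := N)) => //.
  (* The differentiability of P is read off from the second r-derivative of the extended metric. *)
  apply: (Ck_ext boundary_open (f := fun y => - 2^-1 * pd r_ (fun w => dr_metric G w A B) (at_r y 0))).
    move=> y Ny; rewrite (dr2_metric_schouten A B Ny).
    by rewrite mulrA mulrNN mulVf ?pnatr_eq0// mul1r.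
  apply: (CkM boundary_open (Ck_cst 1 _ _)).
  exact: (Ck_boundary (Ck_pd r_ (Ck_dr_metric A B))).
rewrite mulNr mulrN mulrA mulVf ?pnatr_eq0// mul1r.
under [X in _ --> X - _ -> _]eq_bigr do rewrite -(pd_slice (pd (T C) (fun w => G w A B))).
rewrite -(pd_slice (fun w => G w A B)).
have -> : (fun y => pd (T C) (fun w => G w A B) (at_r y 0)) = pd C (fun y => g y A B).
  by apply/funext => y; rewrite -(pd_slice (fun w => G w A B)).
exact.
Qed.

Lemma dr_metric_jet z v W A B : N z -> cvg_at_0 v W ->
  (fun r => dr_metric G (at_r (z + v r) r) A B / r) @ 0^'+ --> - 2 * schouten g z A B.
Proof.
move=> Nz h; rewrite -dr2_metric_schouten//.
exact: (curve_jet1 O_open Nz (Ck_S (Ck_dr_metric A B)) (dr_metric0 A B Nz) h).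
Qed.

(** P is a multiple of the second r-derivative of a symmetric matrix, so its symmetry follows
    without the pair symmetry of the curvature tensor. *)
Lemma schouten_boundary_sym z A B : N z -> schouten g z A B = schouten g z B A.
Proof.
move=> Nz; apply: (@mulfI _ (- 2)); first by rewrite oppr_eq0 pnatr_eq0.
rewrite -(dr2_metric_schouten A B Nz) -(dr2_metric_schouten B A Nz).
apply: (pd_on r_ O_open Nz) => w Ow.
by apply: (pd_on r_ O_open Ow) => w' Ow'; exact: symE (Gs Ow') _ _.
Qed.

End BoundaryExpansion.

Lemma posdef_unitmx (R : realFieldType) n (A : 'M[R]_n) :
  (forall v : 'rV[R]_n, v != 0 -> 0 < (v *m A *m v^T) 0 0) -> A \in unitmx.
Proof.
move=> h; rewrite unitmxE unitfE; apply/det0P => -[v v0 vA].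
by have := h v v0; rewrite vA mul0mx mxE ltxx.
Qed.

Lemma Ck_local (R : realType) N k (D : set 'rV[R]_N) (f : 'rV[R]_N -> R) : 
  (forall z, D z -> exists O : set 'rV[R]_N, [/\ open O, O z & Ck k O f]) -> Ck k D f.
Proof.
elim: k f => [|k IH] f h; split=> //; try by move=> z /h[U [_ Uz hf]]; exact: Ck_cont hf Uz.
move=> i; split=> [z /h[U [_ Uz hf]]|]; first exact: Ck_derivable hf Uz.
by apply: IH => z /h[U [Uo Uz hf]]; exists U; split=> //; exact: Ck_pd.
Qed.

(** * Transfer to a metric that is C^3 up to the boundary *)

Section Collar.
#[local] Opaque pd christoffel christoffel1.
Context (R : realType) (m : nat) (V : set 'rV[R]_m) (eps : R).
Context (gt : 'rV[R]_(m + 1) -> 'M[R]_m).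
Hypothesis m_ge3 : (2 < m)%N.
Hypothesis V_open : open V.
Hypothesis eps_gt0 : 0 < eps.
Hypothesis gt_metric : is_metric_on (collar V eps) gt.
Hypothesis gt_C3 : forall a b, Ck_on 3 (collar V eps) (fun w => gt w a b).
Hypothesis g_plus_einstein :
  is_einstein_on (open_collar V eps) (- m%:R) (g_plus gt).
Implicit Types (w : 'rV[R]_(m + 1)) (z : 'rV[R]_m) (A B C E : 'I_m).
Notation T := (lshift 1).
Notation r_ := (r_index m).
Notation g := (boundary_metric gt).

Lemma collar_sym w : collar V eps w -> (gt w)^T = gt w.
Proof. by move=> /gt_metric[]. Qed.

Lemma collar_unit w : collar V eps w -> gt w \in unitmx.
Proof. by move=> /gt_metric[_ h]; exact: posdef_unitmx. Qed.

Lemma collar_at_r z r : V z -> 0 <= r < eps -> collar V eps (at_r z r).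
Proof. by move=> Vz hr; split; rewrite ?at_r_lsubmx// at_rr. Qed.

Lemma open_collar_sub w : open_collar V eps w -> collar V eps w.
Proof. by move=> [h1 /andP[/ltW h2 h3]]; split=> //; rewrite h2. Qed.

Lemma open_collar_open (D : set 'rV[R]_m) (e : R) : open D -> open (open_collar D e).
Proof.
move=> Do.
have -> : open_collar D e = ((fun w : 'rV[R]_(m + 1) => lsubmx w) @^-1` D) `&`
    ((@r_coord R m) @^-1` [set r | 0 < r]) `&` ((@r_coord R m) @^-1` [set r | r < e]).
  apply/seteqP; split=> w; first by move=> [h1 /andP[h2 h3]]; split.
  by move=> [[h1 h2] h3]; split=> //; apply/andP.
apply: openI; first apply: openI.
- by apply: open_comp => // w _; exact: lsubmx_continuous.
- by apply: open_comp; [move=> w _; exact: coord_continuous|exact: open_gt].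
- by apply: open_comp; [move=> w _; exact: coord_continuous|exact: open_lt].
Qed.

(** The hypothesis extends each matrix entry separately. Averaging the extensions of the entries (A,
    B) and (B, A) restores symmetry without changing values at r >= 0, and invertibility persists
    near the point because the determinant is continuous. *)
Lemma metric_extension z : V z ->
  exists O : set 'rV[R]_(m + 1), exists G : 'rV[R]_(m + 1) -> 'M[R]_m,
  [/\ open O, O (at_r z 0),
      forall w, O w -> V (lsubmx w) /\ r_coord w < eps &
      forall w, O w -> 0 <= r_coord w -> gt w = G w] /\
  [/\ forall A B, Ck 3 O (fun w => G w A B), forall w, O w -> (G w)^T = G w &
      forall w, O w -> G w \in unitmx].
Proof.
move=> Vz; have cz : collar V eps (at_r z 0) by apply: collar_at_r; rewrite ?lexx.
have ex (AB : 'I_m * 'I_m) : exists Uf : set 'rV[R]_(m + 1) * ('rV[R]_(m + 1) -> R),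
  [/\ open Uf.1, Uf.1 (at_r z 0), Ck 3 Uf.1 Uf.2 &
     forall y, Uf.1 y -> collar V eps y -> gt y AB.1 AB.2 = Uf.2 y].
  by have [U [f [h1 h2 h3 h4]]] := gt_C3 AB.1 AB.2 cz; exists (U, f).
have [Uf hUf] := choice ex.
pose G w : 'M[R]_m := \matrix_(A, B) (2^-1 * ((Uf (A, B)).2 w + (Uf (B, A)).2 w)).
pose U0 := [set w | (forall AB, (Uf AB).1 w) /\ V (lsubmx w) /\ r_coord w < eps].
have U0_open : open U0.
  apply: openI.
    rewrite openE => w hw; apply: (@filter_forall _ _ (fun AB => (Uf AB).1) (nbhs w)) => AB.
    by apply: open_nbhs_nbhs; split; [case: (hUf AB)|exact: hw].
  apply: openI.
    by apply: open_comp => // w _; exact: lsubmx_continuous.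
  have -> : (fun w : 'rV[R]_(m + 1) => is_true (r_coord w < eps)) =
    (@r_coord R m) @^-1` [set r | r < eps] by [].
  by apply: open_comp; [move=> w _; exact: coord_continuous|exact: open_lt].
have GC A B : Ck 3 U0 (fun w => G w A B).
  apply: (Ck_ext U0_open (f := fun w => 2^-1 * ((Uf (A, B)).2 w + (Uf (B, A)).2 w))).
    by move=> w _; rewrite mxE.
  have CU AB : Ck 3 U0 (Uf AB).2.
    by have [_ _ h _] := hUf AB; apply: Ck_sub h => w [+ _]; exact.
  exact: (CkM U0_open (Ck_cst 3 _ _) (CkD U0_open (CU _) (CU _))).
have Gs w : (G w)^T = G w by apply/matrixP => A B; rewrite !mxE addrC.
have GE w : U0 w -> 0 <= r_coord w -> gt w = G w.
  move=> [h1 [h2 h3]] h4; have cw : collar V eps w by split=> //; rewrite h4.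
  apply/matrixP => A B; rewrite mxE.
  have [_ _ _ e1] := hUf (A, B); have [_ _ _ e2] := hUf (B, A).
  rewrite -e1// -e2// (symE (collar_sym cw) B A) /=.
  by move: (gt w A B) => p; field.
have Cdet : Ck 0 U0 (fun w => \det (G w)).
  by apply: Ck_det => // A B; apply: Ck_le (GC A B).
have U0z : U0 (at_r z 0).
  split; first by move=> AB; case: (hUf AB).
  by rewrite at_r_lsubmx at_rr.
exists [set w | U0 w /\ \det (G w) != 0], G; split; split.
- rewrite openE => w [U0w dw]; apply: filterI; first exact: open_nbhs_nbhs.
  exact: (cvgr_neq0 _ (Ck_cont Cdet U0w) dw).
- split=> //; rewrite -GE// ?at_rr// -unitfE -unitmxE; exact: collar_unit.
- by move=> w [[_ h] _].
- by move=> w [h _]; exact: GE.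
- by move=> A B; apply: Ck_sub (GC A B) => w [].
- by move=> w _; exact: Gs.
- by move=> w [_ dw]; rewrite unitmxE unitfE.
Qed.

Lemma gt_near (O : set 'rV[R]_(m + 1)) (G : 'rV[R]_(m + 1) -> 'M[R]_m) :
  open O -> (forall w, O w -> 0 <= r_coord w -> gt w = G w) ->
  forall w, O w -> 0 < r_coord w -> {near w, gt =1 G}.
Proof.
move=> Oo h w Ow r0; pose D := [set y : 'rV[R]_(m + 1) | O y /\ 0 < r_coord y].
have Do : open D.
  apply: openI => //.
  rewrite (_ : (fun y => is_true (0 < r_coord y)) = (@r_coord R m) @^-1` [set r | 0 < r])//.
  by apply: open_comp; [move=> y _; exact: coord_continuous|exact: open_gt].
apply: (open_near_eq Do) => // y [Oy ry].
by apply: h => //; exact: ltW.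
Qed.

Lemma g_plus_near (G : 'rV[R]_(m + 1) -> 'M[R]_m) w :
  {near w, gt =1 G} -> {near w, g_plus gt =1 g_plus G}.
Proof. by apply: filterS => y; rewrite /g_plus => ->. Qed.

Variant local_model z : Prop := LocalModel (O : set 'rV[R]_(m + 1))
    (G : 'rV[R]_(m + 1) -> 'M[R]_m) of open O & O (at_r z 0)
  & (forall w, O w -> V (lsubmx w) /\ r_coord w < eps)
  & (forall w, O w -> 0 <= r_coord w -> gt w = G w)
  & (forall A B, Ck 3 O (fun w => G w A B))
  & (forall w, O w -> (G w)^T = G w)
  & (forall w, O w -> G w \in unitmx)
  & (forall w, O w -> 0 < r_coord w -> ricci (g_plus G) w = - m%:R *: g_plus G w).

Lemma local_modelP z : V z -> local_model z.
Proof.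
move=> Vz; have [U [G [[h1 h2 h3 h4] [h5 h6 h7]]]] := metric_extension Vz.
apply: (LocalModel h1 h2 h3 h4 h5 h6 h7) => w Uw r0.
rewrite -(ricci_near (g_plus_near (gt_near h1 h4 Uw r0))) g_plus_einstein.
  by congr (_ *: _); rewrite /g_plus h4// ltW.
by have [h8 h9] := h3 w Uw; split=> //; rewrite r0 h9.
Qed.

Lemma boundary_near z (O : set 'rV[R]_(m + 1)) (G : 'rV[R]_(m + 1) -> 'M[R]_m) :
  open O -> O (at_r z 0) -> (forall w, O w -> 0 <= r_coord w -> gt w = G w) ->
  {near z, g =1 boundary_metric G}.
Proof.
move=> Oo Oz h; apply: (open_near_eq (boundary_open Oo) Oz) => y Oy.
by apply: h => //; rewrite at_rr.
Qed.

Lemma collar_boundaryC A B : Ck 3 V (fun z => g z A B).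
Proof.
apply: Ck_local => z Vz; have [U G Uo Uz _ h4 h5 _ _ _] := local_modelP Vz.
exists [set z | U (at_r z 0)]; split=> //; first exact: boundary_open.
apply: (Ck_ext (boundary_open Uo)) (boundary_metricC h5 A B) => y Uy.
by rewrite /boundary_metric h4// at_rr.
Qed.

Lemma collar_boundary_sym z : V z -> (g z)^T = g z.
Proof. by move=> Vz; apply: collar_sym; apply: collar_at_r; rewrite ?lexx. Qed.

Lemma collar_boundary_unit z : V z -> g z \in unitmx.
Proof. by move=> Vz; apply: collar_unit; apply: collar_at_r; rewrite ?lexx. Qed.

Lemma collar_schouten_sym z A B : V z -> schouten g z A B = schouten g z B A.
Proof.
move=> Vz; have [U G Uo Uz _ h4 h5 h6 h7 h8] := local_modelP Vz.
rewrite (schouten_near (boundary_near Uo Uz h4)).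
exact: (schouten_boundary_sym m_ge3 Uo h5 h6 h7 h8).
Qed.

Let curve_near z v W (O : set 'rV[R]_(m + 1)) : open O -> O (at_r z 0) -> cvg_at_0 v W ->
  \forall r \near 0^'+, O (at_r (z + v r) r) /\ 0 < r.
Proof.
move=> Oo Oz h; near=> r; split; last by near: r; exact: right_pos.
by near: r; apply: (at_r_in h); exact: open_nbhs_nbhs.
Unshelve. all: by end_near. Qed.

Lemma collar_metric_jet z v W A B : V z -> cvg_at_0 v W ->
  (fun r => (gt (at_r (z + v r) r) A B - g z A B) / r ^+ 2) @ 0^'+
    --> \sum_C W C * pd C (fun y => g y A B) z - schouten g z A B.
Proof.
move=> Vz h; have [U G Uo Uz _ h4 h5 h6 h7 h8] := local_modelP Vz.
have bn := boundary_near Uo Uz h4.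
rewrite (schouten_near bn).
have pdE C : pd C (fun y => g y A B) z = pd C (fun y => boundary_metric G y A B) z.
  by apply: pd_near; apply: filterS bn => y ->.
under [X in _ --> X - _]eq_bigr do rewrite pdE.
have := metric_jet m_ge3 Uo h5 h6 h7 h8 (A := A) (B := B) Uz h; apply: cvg_right_near.
near=> r.
have [Ur r0] : U (at_r (z + v r) r) /\ 0 < r by near: r; exact: curve_near.
by rewrite h4 ?at_rr ?ltW// (nbhs_singleton bn).
Unshelve. all: by end_near. Qed.

Lemma collar_metric_pd_jet z v W A B C : V z -> cvg_at_0 v W ->
  (fun r => (pd (T C) (fun w => gt w A B) (at_r (z + v r) r) - pd C (fun y => g y A B) z) / r ^+ 2)
    @ 0^'+ --> \sum_E W E * pd E (pd C (fun y => g y A B)) z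
              - pd C (fun y => schouten g y A B) z.
Proof.
move=> Vz h; have [U G Uo Uz _ h4 h5 h6 h7 h8] := local_modelP Vz.
have bn := boundary_near Uo Uz h4.
have bnAB : {near z, (fun y => g y A B) =1 (fun y => boundary_metric G y A B)}.
  by apply: filterS bn => y ->.
have -> : pd C (fun y => schouten g y A B) z = pd C (fun y => schouten (boundary_metric G) y A B) z.
  apply: pd_near; apply: filterS (near_join bn) => y hy.
  by rewrite (schouten_near hy).
have pdE E : pd E (pd C (fun y => g y A B)) z = pd E (pd C (fun y => boundary_metric G y A B)) z.
  by apply: pd_near; exact: near_pd_near.
under [X in _ --> X - _]eq_bigr do rewrite pdE.
rewrite (pd_near C bnAB).
have := metric_pd_jet m_ge3 Uo h5 h6 h7 h8 (A := A) (B := B) (C := C) Uz h; apply: cvg_right_near.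
near=> r.
have [Ur r0] : U (at_r (z + v r) r) /\ 0 < r by near: r; exact: curve_near.
have r0' : 0 < r_coord (at_r (z + v r) r) by rewrite at_rr.
rewrite (pd_near (T C) (f := fun w => gt w A B) (g := fun w => G w A B))//.
by apply: filterS (gt_near Uo h4 Ur r0') => y ->.
Unshelve. all: by end_near. Qed.

Lemma collar_dr_metric_jet z v W A B : V z -> cvg_at_0 v W ->
  (fun r => dr_metric gt (at_r (z + v r) r) A B / r) @ 0^'+ --> - 2 * schouten g z A B.
Proof.
move=> Vz h; have [U G Uo Uz _ h4 h5 h6 h7 h8] := local_modelP Vz.
rewrite (schouten_near (boundary_near Uo Uz h4)).
have := dr_metric_jet m_ge3 Uo h5 h6 h7 h8 (A := A) (B := B) Uz h; apply: cvg_right_near.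
near=> r.
have [Ur r0] : U (at_r (z + v r) r) /\ 0 < r by near: r; exact: curve_near.
have r0' : 0 < r_coord (at_r (z + v r) r) by rewrite at_rr.
rewrite /dr_metric (pd_near r_ (f := fun w => gt w A B) (g := fun w => G w A B))//.
by apply: filterS (gt_near Uo h4 Ur r0') => y ->.
Unshelve. all: by end_near. Qed.

Lemma open_collarC A B : Ck 3 (open_collar V eps) (fun w => gt w A B).
Proof.
apply: Ck_local => w Dw; have [U [f [Uo Uw hf e]]] := gt_C3 A B (open_collar_sub Dw).
exists (U `&` open_collar V eps); split.
- by apply: openI => //; exact: open_collar_open.
- by [].
- apply: (@Ck_ext _ _ _ _ f); first by apply: openI => //; exact: open_collar_open.
    by move=> y [Uy /open_collar_sub cy]; rewrite e.
  by apply: Ck_sub hf => y [].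
Qed.

End Collar.

(** * Traced Hessians and bilinear sums in coordinates *)

Lemma innerE (R : realType) N (g : 'rV[R]_N -> 'M[R]_N) z v w :
  inner g z v w = \sum_K \sum_L v 0 K * g z K L * w 0 L.
Proof.
rewrite /inner mxE exchange_big; apply: eq_bigr => L _ /=.
by rewrite !mxE mulr_suml.
Qed.

(** If the normal part vanishes, the traced Hessian equals its tangential projection. Recording only
    that it is some combination of the tangent vectors avoids computing the normal projection of a
    graph. *)
Lemma mean_curvature0 (R : realType) N m (g : 'rV[R]_N -> 'M[R]_N)
    (F : 'rV[R]_m -> 'rV[R]_N) s : mean_curvature g F s = 0 ->
  exists c : 'I_m -> R, forall K,
    \sum_a \sum_b invmx (first_form g F s) a b * cov_hessian g F s a b 0 K
    = \sum_d c d * tangent F s d 0 K.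
Proof.
move=> mc0; set h := invmx (first_form g F s).
exists (fun d => \sum_a \sum_b h a b *
  \sum_c h c d * inner g (F s) (cov_hessian g F s a b) (tangent F s c)) => K.
have /rowP/(_ K) := mc0; rewrite /mean_curvature -/h summxE mxE => e.
apply/eqP; rewrite -subr_eq0; apply/eqP; rewrite -[RHS]e.
rewrite [X in _ - X = _](_ : _ =
  \sum_a \sum_b h a b * \sum_c \sum_d h c d *
     inner g (F s) (cov_hessian g F s a b) (tangent F s c) * tangent F s d 0 K); last first.
  under eq_bigr do rewrite /= mulr_suml.
  rewrite exchange_big; apply: eq_bigr => a _ /=.
  under eq_bigr do rewrite mulr_suml.
  rewrite exchange_big; apply: eq_bigr => b _ /=.
  under eq_bigr do rewrite -mulrA.
  rewrite -mulr_sumr [in RHS]exchange_big; congr (_ * _); apply: eq_bigr => d _ /=.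
  by rewrite mulr_suml.
rewrite -sumrB; apply: eq_bigr => a _; rewrite summxE -sumrB; apply: eq_bigr => b _.
rewrite -mulrBr [RHS]mxE; congr (_ * _); rewrite /normal_part -/h [RHS]mxE [X in _ = _ + X]mxE summxE.
congr (_ - _); apply: eq_bigr => c _; rewrite summxE; apply: eq_bigr => d _.
by rewrite [RHS]mxE.
Qed.

Lemma cov_hessianE (R : realType) N m (g : 'rV[R]_N -> 'M[R]_N)
    (F : 'rV[R]_m -> 'rV[R]_N) s a b K : cov_hessian g F s a b 0 K =
  pd a (fun t => tangent F t b 0 K) s
  + \sum_L \sum_M christoffel g (F s) K L M * tangent F s a 0 L * tangent F s b 0 M.
Proof. exact: mxE. Qed.

Lemma first_formE (R : realType) N m (g : 'rV[R]_N -> 'M[R]_N)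
    (F : 'rV[R]_m -> 'rV[R]_N) s a b :
  first_form g F s a b = inner g (F s) (tangent F s a) (tangent F s b).
Proof. exact: mxE. Qed.

Lemma bilinear_Tr (R : realType) m (G : 'I_(m + 1) -> 'I_(m + 1) -> R)
    (ta tb : 'I_(m + 1) -> R) (S : 'I_m -> 'I_m -> R) (p q : 'I_m -> R) (c : R)
    (ta' tb' : 'I_m -> R) (ra rb : R) :
  (forall A B, G (lshift 1 A) (lshift 1 B) = S A B) ->
  (forall A, G (lshift 1 A) (r_index m) = p A) ->
  (forall B, G (r_index m) (lshift 1 B) = q B) -> G (r_index m) (r_index m) = c ->
  (forall A, ta (lshift 1 A) = ta' A) -> (forall A, tb (lshift 1 A) = tb' A) ->
  ta (r_index m) = ra -> tb (r_index m) = rb ->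
  \sum_K \sum_L G K L * ta K * tb L =
  \sum_A \sum_B S A B * ta' A * tb' B + (\sum_A p A * ta' A) * rb
  + (\sum_B q B * tb' B) * ra + c * ra * rb.
Proof.
move=> hS hp hq hc ha hb hra hrb; rewrite sum_Tr sum_Tr hc hra hrb.
rewrite -[RHS]addrA; congr (_ + (_ + _)).
  rewrite mulr_suml -big_split; apply: eq_bigr => A _ /=.
  rewrite sum_Tr hp ha hrb; congr (_ + _); apply: eq_bigr => B _.
  by rewrite hS hb.
rewrite mulr_suml; apply: eq_bigr => B _; rewrite hq hb; ring.
Qed.

Lemma bilinear_Tr0 (R : realType) m (G : 'I_(m + 1) -> 'I_(m + 1) -> R)
    (ta tb : 'I_(m + 1) -> R) (S : 'I_m -> 'I_m -> R) (c : R)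
    (ta' tb' : 'I_m -> R) (ra rb : R) :
  (forall A B, G (lshift 1 A) (lshift 1 B) = S A B) ->
  (forall A, G (lshift 1 A) (r_index m) = 0) ->
  (forall B, G (r_index m) (lshift 1 B) = 0) -> G (r_index m) (r_index m) = c ->
  (forall A, ta (lshift 1 A) = ta' A) -> (forall A, tb (lshift 1 A) = tb' A) ->
  ta (r_index m) = ra -> tb (r_index m) = rb ->
  \sum_K \sum_L G K L * ta K * tb L =
  \sum_A \sum_B S A B * ta' A * tb' B + c * ra * rb.
Proof.
move=> hS hp hq hc ha hb hra hrb; rewrite (bilinear_Tr hS hp hq hc ha hb hra hrb).
have Z (f : 'I_m -> R) : \sum_A 0 * f A = 0 by rewrite big1// => A _; rewrite mul0r.
by rewrite !Z !mul0r !addr0.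
Qed.

Lemma bilinear_sumC (R : comPzRingType) (I : finType) (G : I -> I -> R) (t t' : I -> R) :
  (forall A B, G A B = G B A) ->
  \sum_A \sum_B G A B * t A * t' B = \sum_A \sum_B G A B * t' A * t B.
Proof.
move=> Gs; rewrite exchange_big; apply: eq_bigr => A _; apply: eq_bigr => B _.
by rewrite Gs mulrAC.
Qed.

(** * The minimal surface equation of a graph *)

Section MinimalGraph.
#[local] Opaque pd christoffel christoffel1 slice_christoffel shape_op dr_metric.
Context (R : realType) (n : nat) (gt : 'rV[R]_(2 + n + 1) -> 'M[R]_(2 + n)).
Context (Dm : set 'rV[R]_(2 + n + 1)) (u : 'rV[R]_(2 + 1) -> 'rV[R]_n).
Hypothesis D_open : open Dm.
Hypothesis D_pos : forall w, Dm w -> 0 < r_coord w.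
Hypothesis gtC : forall A B, Ck 2 Dm (fun w => gt w A B).
Hypothesis gts : forall w, Dm w -> (gt w)^T = gt w.
Hypothesis gtu : forall w, Dm w -> gt w \in unitmx.
Implicit Types (s : 'rV[R]_(2 + 1)) (a b d : 'I_(2 + 1)) (A B C : 'I_(2 + n)).
Implicit Types (i : 'I_2) (al be : 'I_n).
Notation T := (lshift 1).
Notation r_ := (r_index (2 + n)).
Notation rs := (r_index 2).
Notation F := (graph u).

Let chTTT := christoffel_TTT D_open D_pos gtC gtu.
Let chTTr := christoffel_TTr D_open D_pos gtC gts gtu.
Let chTrT := christoffel_TrT D_open D_pos gtC gts gtu.
Let chTrr := christoffel_Trr D_open D_pos gtu.
Let chrTT := christoffel_rTT D_open D_pos gtC gtu.
Let chrTr := christoffel_rTr D_open D_pos gtu.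
Let chrrT := christoffel_rrT D_open D_pos gts gtu.
Let chrrr := christoffel_rrr D_open D_pos gtu.

(* The components of d_a F, for F(x, r) = (x, u(x, r), r), along the slice and
   along r. *)
Definition slice_tangent s a : 'rV[R]_(2 + n) :=
  row_mx (\row_i (a == T i)%:R) (\row_al pd a (fun t => u t 0 al) s).
Definition r_tangent a : R := (a == rs)%:R.

Lemma slice_tangent_tan s a i : slice_tangent s a 0 (tan_ix n i) = (a == T i)%:R.
Proof. by rewrite row_mxEl mxE. Qed.

Lemma slice_tangent_nor s a al :
  slice_tangent s a 0 (nor_ix al) = pd a (fun t => u t 0 al) s.
Proof. by rewrite row_mxEr mxE. Qed.

Lemma r_coord_graph t : r_coord (F t) = r_coord t.
Proof. exact: at_rr. Qed.

Lemma graph_tan t i : F t 0 (T (tan_ix n i)) = t 0 (T i).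
Proof. by rewrite row_mxEl row_mxEl mxE. Qed.
Lemma graph_nor t al : F t 0 (T (nor_ix al)) = u t 0 al.
Proof. by rewrite row_mxEl row_mxEr. Qed.
Lemma graph_r t : F t 0 r_ = t 0 rs.
Proof. by rewrite row_mxEr mxE. Qed.

Lemma tangent_T s a A : tangent F s a 0 (T A) = slice_tangent s a 0 A.
Proof.
rewrite mxE; case: (split_ordP A) => k ->.
  by under eq_fun do rewrite graph_tan; rewrite pd_coord slice_tangent_tan.
by under eq_fun do rewrite graph_nor; rewrite slice_tangent_nor.
Qed.

Lemma tangent_r s a : tangent F s a 0 r_ = r_tangent a.
Proof. by rewrite mxE; under eq_fun do rewrite graph_r; rewrite pd_coord. Qed.

#[local] Opaque tangent cov_hessian first_form inner slice_tangent r_coord graph.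

Lemma pd_tangent_tan s a b i : pd a (fun t => tangent F t b 0 (T (tan_ix n i))) s = 0.
Proof. by under eq_fun do rewrite tangent_T slice_tangent_tan; exact: pd_cst. Qed.

Lemma pd_tangent_nor s a b al : pd a (fun t => tangent F t b 0 (T (nor_ix al))) s =
  pd a (pd b (fun t => u t 0 al)) s.
Proof. by under eq_fun do rewrite tangent_T slice_tangent_nor. Qed.

Lemma pd_tangent_r s a b : pd a (fun t => tangent F t b 0 r_) s = 0.
Proof. by under eq_fun do rewrite tangent_r; exact: pd_cst. Qed.

Definition slice_form (gm : 'I_(2 + n) -> 'I_(2 + n) -> R) s a b : R :=
  \sum_A \sum_B gm A B * slice_tangent s a 0 A * slice_tangent s b 0 B.

(* The first fundamental form of the graph for dr^2 + gt. *)
Definition bar_form s : 'M[R]_(2 + 1) :=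
  \matrix_(a, b) (slice_form (gt (F s)) s a b + r_tangent a * r_tangent b).

Lemma bar_formE s a b :
  bar_form s a b = slice_form (gt (F s)) s a b + r_tangent a * r_tangent b.
Proof. exact: mxE. Qed.

Lemma slice_form_sym (gm : 'I_(2 + n) -> 'I_(2 + n) -> R) s a b :
  (forall A B, gm A B = gm B A) -> slice_form gm s a b = slice_form gm s b a.
Proof.
by move=> gms; exact: (bilinear_sumC _ _ gms).
Qed.

Lemma bar_form_sym s : Dm (F s) -> (bar_form s)^T = bar_form s.
Proof.
move=> Ds; apply/matrixP => a b; rewrite mxE !bar_formE.
have e1 := mulrC (r_tangent b) (r_tangent a).
have e2 := slice_form_sym s b a (symE (gts Ds)).
exact: (congr2 +%R e2 e1).
Qed.
#[local] Opaque bar_form.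

Lemma first_form_graph s : first_form (g_plus gt) F s = (r_coord s ^+ 2)^-1 *: bar_form s.
Proof.
apply/matrixP=> a b; rewrite first_formE innerE.
have -> : \sum_K \sum_L tangent F s a 0 K * g_plus gt (F s) K L * tangent F s b 0 L =
   \sum_K \sum_L g_plus gt (F s) K L * tangent F s a 0 K * tangent F s b 0 L.
  by apply: eq_bigr => K _; apply: eq_bigr => L _; congr (_ * _); exact: mulrC.
have rF := r_coord_graph s.
rewrite (bilinear_Tr0 (g_plusTT gt _) (g_plusTr gt _) (g_plusrT gt _) (g_plusrr gt _)
  (tangent_T s a) (tangent_T s b) (tangent_r s a) (tangent_r s b)) rF.
rewrite [RHS]mxE bar_formE mulrDr mulrA; congr (_ + _).
rewrite /slice_form mulr_sumr; apply: eq_bigr => A _.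
by rewrite mulr_sumr; apply: eq_bigr => B _; rewrite !mulrA.
Qed.

(** The part of the mixed Christoffel symbols of g_+ that stays regular at r = 0, contracted with a
    tangent vector of the graph. *)
Definition shape_tangent s A a : R :=
  \sum_B 2^-1 * shape_op gt (F s) A B * slice_tangent s a 0 B.
Notation M := shape_tangent.

Lemma gamma_graph_T s a b A : Dm (F s) ->
  \sum_K \sum_L christoffel (g_plus gt) (F s) (T A) K L * tangent F s a 0 K * tangent F s b 0 L =
  slice_form (slice_christoffel gt (F s) A) s a b
  + (M s A a * r_tangent b + M s A b * r_tangent a)
  - (slice_tangent s a 0 A * r_tangent b + slice_tangent s b 0 A * r_tangent a) / r_coord s.
Proof.
move=> Ds; rewrite -(r_coord_graph s); have r0 : r_coord (F s) != 0 by rewrite gt_eqF// D_pos.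
have E c : \sum_B (2^-1 * shape_op gt (F s) A B - (A == B)%:R / r_coord (F s)) * slice_tangent s c 0 B
    = M s A c - slice_tangent s c 0 A / r_coord (F s).
  rewrite -[X in _ - X / _](sum_deltal' (fun B => slice_tangent s c 0 B) A) mulr_suml -sumrB.
  apply: eq_bigr => B _; move: (slice_tangent _ _ _ _) => t; ring.
have fld (x p q t p' q' c d : R) : x != 0 ->
  p + (q - p' / x) * d + (t - q' / x) * c + 0 * c * d =
  p + (q * d + t * c) - (p' * d + q' * c) / x by move=> x0; field.
have := bilinear_Tr (fun B C => chTTT A B C Ds) (fun B => chTTr A B Ds)
  (fun B => chTrT A B Ds) (chTrr A Ds)
  (tangent_T s a) (tangent_T s b) (tangent_r s a) (tangent_r s b).
move=> e; apply: (etrans e).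
apply: (etrans (congr2 (fun x y => _ + x * _ + y * _ + _) (E a) (E b))).
exact: fld.
Qed.

Lemma slice_form_comb (G1 G2 : 'I_(2 + n) -> 'I_(2 + n) -> R) s a b (x y : R) :
  slice_form (fun A B => G1 A B / x - y * G2 A B) s a b =
  slice_form G1 s a b / x - y * slice_form G2 s a b.
Proof.
rewrite /slice_form mulr_suml mulr_sumr -sumrB; apply: eq_bigr => B _.
rewrite mulr_suml mulr_sumr -sumrB; apply: eq_bigr => C _.
by move: (G1 B C) (G2 B C) => p q; ring.
Qed.

Lemma gamma_graph_r s a b : Dm (F s) ->
  \sum_K \sum_L christoffel (g_plus gt) (F s) r_ K L * tangent F s a 0 K * tangent F s b 0 L =
  slice_form (gt (F s)) s a b / r_coord s - 2^-1 * slice_form (dr_metric gt (F s)) s a b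
  - r_tangent a * r_tangent b / r_coord s.
Proof.
move=> Ds; have rF := r_coord_graph s.
have fld (x p q c d : R) : p / x - 2^-1 * q + (- x^-1) * c * d =
  p / x - 2^-1 * q - c * d / x by ring.
have e := bilinear_Tr0 (fun B C => chrTT B C Ds) (fun B => chrTr B Ds)
  (fun B => chrrT B Ds) (chrrr Ds)
  (tangent_T s a) (tangent_T s b) (tangent_r s a) (tangent_r s b).
rewrite -rF; apply: (etrans e).
apply: (etrans (congr1 (fun x => x + _) (slice_form_comb _ _ s a b _ _))).
exact: fld.
Qed.
#[local] Opaque slice_form shape_tangent.

(* The trace V of the Hessian of F is tangent to the graph iff
   V^al - V^i d_i u^al - V^r d_r u^al = 0; in this combination the 1/r terms of
   the Christoffel symbols of g_+ cancel, except for the trace 3 d_r u^al / r of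
   the first fundamental form. *)
Definition graph_term s al a b : R :=
  pd a (pd b (fun t => u t 0 al)) s
  + slice_form (slice_christoffel gt (F s) (nor_ix al)) s a b
  - \sum_i pd (T i) (fun t => u t 0 al) s
       * slice_form (slice_christoffel gt (F s) (tan_ix n i)) s a b
  + (M s (nor_ix al) a * r_tangent b + M s (nor_ix al) b * r_tangent a)
  - \sum_i pd (T i) (fun t => u t 0 al) s
       * (M s (tan_ix n i) a * r_tangent b + M s (tan_ix n i) b * r_tangent a)
  + 2^-1 * pd rs (fun t => u t 0 al) s * slice_form (dr_metric gt (F s)) s a b.

Lemma minimal_graph_equation s al : Dm (F s) -> bar_form s \in unitmx ->
  mean_curvature (g_plus gt) F s = 0 ->
  \sum_a \sum_b invmx (bar_form s) a b * graph_term s al a b =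
  3 * (pd rs (fun t => u t 0 al) s / r_coord s).
Proof.
move=> Ds hu /mean_curvature0[c hc].
have rF := r_coord_graph s.
have r0 : r_coord s != 0 by rewrite gt_eqF// -rF D_pos.
have r20 : (r_coord s ^+ 2)^-1 != 0 by rewrite invr_eq0 expf_neq0.
set ua := fun a => pd a (fun t => u t 0 al) s.
(* The slice components of d_a F along x^i, and its r component, are Kronecker deltas; this
   splitting of d_a u makes the singular terms cancel in [term]. *)
have uaE a : ua a = \sum_i ua (T i) * (a == T i)%:R + ua rs * r_tangent a.
  rewrite /r_tangent -(sum_delta' (fun b => ua b) a) sum_Tr.
  by congr (_ + _).
pose h a b := invmx (first_form (g_plus gt) F s) a b.
pose V K := \sum_a \sum_b h a b * cov_hessian (g_plus gt) F s a b 0 K.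
(* The tangential and r components of the traced Hessian are the coefficients [c] themselves, so its
   normal component is determined by them. *)
have VE : V (T (nor_ix al)) = \sum_i V (T (tan_ix n i)) * ua (T i) + V r_ * ua rs.
  have Vt i : V (T (tan_ix n i)) = c (T i).
    rewrite /V hc; under eq_bigr do rewrite tangent_T slice_tangent_tan.
    exact: sum_delta.
  have Vr : V r_ = c rs.
    rewrite /V hc; under eq_bigr do rewrite tangent_r.
    exact: sum_delta.
  rewrite Vr; under [in RHS]eq_bigr do rewrite Vt.
  rewrite /V hc; under [LHS]eq_bigr do rewrite tangent_T slice_tangent_nor.
  by rewrite sum_Tr.
have uaE' a : \sum_i ua (T i) * (a == T i)%:R = ua a - ua rs * r_tangent a.
  by rewrite [in RHS]uaE addrK.
have term a b : cov_hessian (g_plus gt) F s a b 0 (T (nor_ix al))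
    - \sum_i cov_hessian (g_plus gt) F s a b 0 (T (tan_ix n i)) * ua (T i)
    - cov_hessian (g_plus gt) F s a b 0 r_ * ua rs =
    graph_term s al a b - ua rs / r_coord s * bar_form s a b.
  rewrite [X in X - _ - _]cov_hessianE pd_tangent_nor gamma_graph_T//.
  rewrite [X in _ - _ - X * _]cov_hessianE pd_tangent_r gamma_graph_r// add0r.
  under eq_bigr => i _.
    rewrite [X in X * _]cov_hessianE pd_tangent_tan gamma_graph_T// add0r !slice_tangent_tan.
    over.
  rewrite (_ : \sum_i _ = \sum_i ua (T i) * slice_form (slice_christoffel gt (F s) (tan_ix n i)) s a b
     + \sum_i ua (T i) * (M s (tan_ix n i) a * r_tangent b + M s (tan_ix n i) b * r_tangent a)
     - ((ua a - ua rs * r_tangent a) * r_tangent b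
        + (ua b - ua rs * r_tangent b) * r_tangent a) / r_coord s); last first.
    rewrite -!uaE' !mulr_suml -[X in X / _]big_split /= [X in _ - X]mulr_suml -big_split -sumrB /=.
    apply: eq_bigr => i _.
    by move: (ua _) (slice_form _ _ _ _) (M _ _ _) (M _ _ _) => p1 p2 p3 p4; ring.
  rewrite /graph_term bar_formE !slice_tangent_nor -/(ua a) -/(ua b) -/(ua rs).
  move: (\sum_i _) (\sum_i _) (ua a) (ua b) (ua rs) (pd a _ s) (M _ _ _) (M _ _ _) => p1 p2 p3 p4 p5 p6 p7 p8.
  move: (slice_form _ _ _ _) (slice_form _ _ _ _) (slice_form _ _ _ _) => q1 q2 q3.
  by field.
have : \sum_a \sum_b h a b * (graph_term s al a b - ua rs / r_coord s * bar_form s a b) = 0.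
  transitivity (V (T (nor_ix al)) - (\sum_i V (T (tan_ix n i)) * ua (T i) + V r_ * ua rs)).
    rewrite /V mulr_suml; under [X in _ - (X + _)]eq_bigr do rewrite mulr_suml.
    rewrite [X in _ - (X + _)]exchange_big -big_split -sumrB /=; apply: eq_bigr => a _.
    rewrite mulr_suml; under [X in _ - (X + _)]eq_bigr do rewrite mulr_suml.
    rewrite [X in _ - (X + _)]exchange_big -big_split -sumrB /=; apply: eq_bigr => b _.
    rewrite -term !mulrBr opprD addrA; congr (_ - _ - _); last by rewrite mulrA.
    by rewrite mulr_sumr; apply: eq_bigr => i _; rewrite mulrA.
  by rewrite VE subrr.
have hE a b : h a b = r_coord s ^+ 2 * invmx (bar_form s) a b.
  rewrite /h first_form_graph invmxZ ?invrK 1?mxE//.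
  by rewrite unitmxZ// unitfE.
have bar_sym := bar_form_sym Ds.
have tr3 : \sum_a \sum_b invmx (bar_form s) a b * bar_form s a b = 3.
  have E a : \sum_b invmx (bar_form s) a b * bar_form s a b = 1.
    have := sum_mulVmx hu a a; rewrite eqxx => e; rewrite -[RHS](e : _ = 1).
    by apply: eq_bigr => b _; rewrite (symE bar_sym a b).
  by under eq_bigr do rewrite E; rewrite sumr_const card_ord.
have -> : \sum_a \sum_b h a b * (graph_term s al a b - ua rs / r_coord s * bar_form s a b) =
  r_coord s ^+ 2 * (\sum_a \sum_b invmx (bar_form s) a b * graph_term s al a b
    - ua rs / r_coord s * \sum_a \sum_b invmx (bar_form s) a b * bar_form s a b).
  rewrite mulr_sumr -sumrB mulr_sumr; apply: eq_bigr => a _.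
  rewrite mulr_sumr -sumrB mulr_sumr; apply: eq_bigr => b _; rewrite hE.
  by move: (graph_term _ _ _ _) (invmx _ _ _) (bar_form _ _ _) => p1 p2 p3; ring.
move=> /eqP; rewrite mulf_eq0 expf_eq0 (negPf r0) /= subr_eq0 tr3 => /eqP ->.
by rewrite mulrC.
Qed.

End MinimalGraph.

(** * Asymptotics of the graph *)

(** For 0 < r < 1, sublinearity of the logarithm at 1 / r gives |ln r| < 1 / r, so the product is
    below r in absolute value. *)
Lemma cvg_r2_ln (R : realType) : (fun r : R => r ^+ 2 * ln r) @ 0^'+ --> (0 : R).
Proof.
apply/cvgrPdist_lt => e e0; near=> r.
have r0 : 0 < r by near: r; exact: right_pos.
have r1 : r < 1 by near: r; exact: nbhs_right_lt.
have re : r < e by near: r; exact: nbhs_right_lt.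
have lnr : ln r < 0 by apply: ln_lt0; rewrite r0 r1.
rewrite sub0r normrN normrM (ltr0_norm lnr) ger0_norm ?exprn_ge0 ?ltW//.
apply: lt_trans re.
have := ln_sublinear (x := r^-1); rewrite invr_gt0 => /(_ r0).
rewrite lnV ?posrE// => h; rewrite expr2 -mulrA gtr_pMr//.
by rewrite -(divff (lt0r_neq0 r0)) ltr_pM2l.
Unshelve. all: by end_near. Qed.

Section SeparatedExpansion.
#[local] Opaque pd.
Context (R : realType) (m : nat) (B : set 'rV[R]_m) (delta : R).
Hypothesis B_open : open B.
Notation Q := (open_collar B delta).
Notation T := (lshift 1).
Notation r_ := (r_index m).
Implicit Types (s : 'rV[R]_(m + 1)) (f : 'rV[R]_(m + 1) -> R) (h : 'rV[R]_m -> R) (i j : 'I_m).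

Let Qo : open Q. Proof. exact: open_collar_open. Qed.

Lemma collar_rpos s : Q s -> 0 < r_coord s.
Proof. by move=> [_ /andP[]]. Qed.

Lemma lsubmx_lineT s i (t : R) :
  lsubmx (t *: delta_mx 0 (T i) + s) = t *: delta_mx 0 i + lsubmx s.
Proof. by apply/rowP=> k; rewrite !mxE eq_lshift. Qed.

Lemma lsubmx_liner s (t : R) : lsubmx (t *: delta_mx 0 r_ + s) = lsubmx s.
Proof. by apply/rowP=> k; rewrite !mxE eq_lrshift andbF mulr0 add0r. Qed.

Lemma r_coord_lineT s i (t : R) : r_coord (t *: delta_mx 0 (T i) + s) = r_coord s.
Proof. by rewrite /r_coord !mxE eq_rlshift andbF mulr0 add0r. Qed.

Lemma r_coord_liner s (t : R) : r_coord (t *: delta_mx 0 r_ + s) = t + r_coord s.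
Proof. by rewrite /r_coord !mxE !eqxx mulr1. Qed.

Transparent pd.
Lemma pd_base_T h s i : pd (T i) (fun t => h (lsubmx t)) s = pd i h (lsubmx s).
Proof.
by apply: (derive_same_line (f := fun t : 'rV[R]_(m + 1) => h (lsubmx t))) => t; rewrite lsubmx_lineT.
Qed.

Lemma pd_base_r h s : pd r_ (fun t => h (lsubmx t)) s = 0.
Proof.
rewrite -(derive_cst (h (lsubmx s)) s (delta_mx 0 r_)).
by apply: (derive_same_line (f := fun t : 'rV[R]_(m + 1) => h (lsubmx t))) => t; rewrite lsubmx_liner.
Qed.

Lemma pd_ln_T s i : pd (T i) (fun t => ln (r_coord t)) s = 0.
Proof.
rewrite -(derive_cst (ln (r_coord s)) s (delta_mx 0 (T i))).
by apply: (derive_same_line (f := fun t => ln (r_coord t))) => t; rewrite r_coord_lineT.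
Qed.

Let ln_line s (t : R) : ln (r_coord (t *: delta_mx 0 r_ + s)) = ln (t *: (1 : R) + r_coord s).
Proof. by rewrite r_coord_liner [t *: _]mulr1. Qed.

Lemma pd_ln_r s : Q s -> pd r_ (fun t => ln (r_coord t)) s = (r_coord s)^-1.
Proof.
move=> /collar_rpos s0; have d := is_derive1_ln s0; rewrite -(@derive_val _ _ _ _ _ _ _ d).
exact: (derive_same_line (f := fun t => ln (r_coord t)) (ln_line s)).
Qed.

Lemma Ck_base k h : Ck k B h -> Ck k Q (fun t => h (lsubmx t)).
Proof.
elim: k h => [|k IH] h hh; split=> //;
  try by move=> s [Bs _]; apply: (continuous_comp (f := fun t : 'rV[R]_(m + 1) => lsubmx t));
    [exact: lsubmx_continuous|exact: Ck_cont hh Bs].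
move=> K; case: (split_ordP K) => i ->; split.
- move=> s [Bs _].
  have E (t : R) : h (lsubmx (t *: delta_mx 0 (T i) + s)) = h (t *: delta_mx 0 i + lsubmx s).
    by rewrite lsubmx_lineT.
  exact: (derivable_same_line (f := fun t : 'rV[R]_(m + 1) => h (lsubmx t)) E (Ck_derivable hh Bs)).
- apply: (Ck_ext Qo (f := fun t => pd i h (lsubmx t))); first by move=> s _; rewrite pd_base_T.
  by apply: IH; exact: Ck_pd.
- move=> s _; rewrite (ord1 i) -/(r_index m).
  have E (t : R) : h (lsubmx (t *: delta_mx 0 r_ + s)) = cst (h (lsubmx s)) (t *: delta_mx 0 r_ + s).
    by rewrite lsubmx_liner.
  apply: (derivable_same_line (f := fun t : 'rV[R]_(m + 1) => h (lsubmx t)) E).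
  exact: derivable_cst.
- rewrite (ord1 i) -/(r_index m).
  apply: (Ck_ext Qo (f := fun=> 0)); first by move=> s _; rewrite pd_base_r.
  exact: Ck_cst.
Qed.

Lemma Ck_ln k : Ck k Q (fun t => ln (r_coord t)).
Proof.
case: k => [|k]; split=> //;
  try by move=> s /collar_rpos s0; apply: (continuous_comp (f := @r_coord R m));
    [exact: coord_continuous|exact: continuous_ln].
move=> K; case: (split_ordP K) => i ->; split.
- move=> s _.
  have E (t : R) : ln (r_coord (t *: delta_mx 0 (T i) + s)) = cst (ln (r_coord s)) (t *: delta_mx 0 (T i) + s).
    by rewrite r_coord_lineT.
  apply: (derivable_same_line (f := fun t => ln (r_coord t)) E).
  exact: derivable_cst.
- apply: (Ck_ext Qo (f := fun=> 0)); first by move=> s _; rewrite pd_ln_T.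
  exact: Ck_cst.
- move=> s /collar_rpos s0; rewrite (ord1 i) -/(r_index m).
  apply: (derivable_same_line (f := fun t => ln (r_coord t)) (ln_line s)).
  exact: (@ex_derive _ _ _ _ _ _ _ (is_derive1_ln s0)).
- rewrite (ord1 i) -/(r_index m).
  apply: (Ck_ext Qo (f := fun t => (r_coord t)^-1)); first by move=> s Qs; rewrite pd_ln_r.
  apply: CkV => // [s /collar_rpos s0|]; first by rewrite gt_eqF.
  exact: Ck_r.
Qed.
#[local] Opaque pd.

Lemma Ck_rX k (j : nat) : Ck k Q (fun t => r_coord t ^+ j).
Proof.
elim: j => [|j IH]; first by under eq_fun do rewrite expr0; exact: Ck_cst.
by under eq_fun do rewrite exprS; exact: (CkM Qo (Ck_r k Q) IH).
Qed.

Lemma pd_rX_T i (j : nat) s : Q s -> pd (T i) (fun t => r_coord t ^+ j) s = 0.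
Proof.
move=> Qs; elim: j => [|j IH]; first by under eq_fun do rewrite expr0; exact: pd_cst.
under eq_fun do rewrite exprS.
by rewrite (pd_mul (T i) (Ck_r 1 Q) (Ck_rX 1 j) Qs) pd_T_r IH mul0r mulr0 addr0.
Qed.

Lemma pd_rX_r (j : nat) s : Q s -> pd r_ (fun t => r_coord t ^+ j) s = j%:R * r_coord s ^+ j.-1.
Proof.
move=> Qs; elim: j => [|j IH].
  by under eq_fun do rewrite expr0; rewrite pd_cst mul0r.
under eq_fun do rewrite exprS.
rewrite (pd_mul r_ (Ck_r 1 Q) (Ck_rX 1 j) Qs) pd_r_r IH mul1r.
case: j IH => [|j] _; first by rewrite !expr0 mul0r mulr0 addr0 mulr1.
by rewrite [in RHS]mulrS mulrDl mul1r mulrCA -exprS.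
Qed.

(** A form stable under all derivatives that occur: d_r acts on the radial factors and d/dx^i on the
    coefficients, so each differentiated expansion keeps the same shape. *)
Definition r_expansion (f0 f1 f2 : 'rV[R]_(m + 1) -> R) (h0 h1 h2 : 'rV[R]_m -> R) s : R :=
  f0 s * h0 (lsubmx s) + f1 s * h1 (lsubmx s) + f2 s * h2 (lsubmx s).

Section Derivatives.
Context (f0 f1 f2 : 'rV[R]_(m + 1) -> R) (h0 h1 h2 : 'rV[R]_m -> R).

Lemma Ck_r_expansion k : Ck k Q f0 -> Ck k Q f1 -> Ck k Q f2 ->
  Ck k B h0 -> Ck k B h1 -> Ck k B h2 -> Ck k Q (r_expansion f0 f1 f2 h0 h1 h2).
Proof.
move=> c0 c1 c2 d0 d1 d2.
exact: (CkD Qo (CkD Qo (CkM Qo c0 (Ck_base d0)) (CkM Qo c1 (Ck_base d1))) (CkM Qo c2 (Ck_base d2))).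
Qed.

Hypotheses (c0 : Ck 1 Q f0) (c1 : Ck 1 Q f1) (c2 : Ck 1 Q f2).
Hypotheses (d0 : Ck 1 B h0) (d1 : Ck 1 B h1) (d2 : Ck 1 B h2).

Let pd_r_expansion K s : Q s -> pd K (r_expansion f0 f1 f2 h0 h1 h2) s =
  pd K f0 s * h0 (lsubmx s) + f0 s * pd K (fun t => h0 (lsubmx t)) s
  + (pd K f1 s * h1 (lsubmx s) + f1 s * pd K (fun t => h1 (lsubmx t)) s)
  + (pd K f2 s * h2 (lsubmx s) + f2 s * pd K (fun t => h2 (lsubmx t)) s).
Proof.
move=> Qs; have e0 := CkM Qo c0 (Ck_base d0).
have e1 := CkM Qo c1 (Ck_base d1); have e2 := CkM Qo c2 (Ck_base d2).
rewrite (pd_add K (CkD Qo e0 e1) e2 Qs) (pd_add K e0 e1 Qs).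
by rewrite (pd_mul K c0 (Ck_base d0) Qs) (pd_mul K c1 (Ck_base d1) Qs) (pd_mul K c2 (Ck_base d2) Qs).
Qed.

Lemma pd_r_expansion_r s : Q s -> pd r_ (r_expansion f0 f1 f2 h0 h1 h2) s =
  r_expansion (pd r_ f0) (pd r_ f1) (pd r_ f2) h0 h1 h2 s.
Proof. by move=> Qs; rewrite pd_r_expansion// !pd_base_r !mulr0 !addr0. Qed.

Lemma pd_r_expansion_T i s : Q s ->
  pd (T i) f0 s = 0 -> pd (T i) f1 s = 0 -> pd (T i) f2 s = 0 ->
  pd (T i) (r_expansion f0 f1 f2 h0 h1 h2) s =
  r_expansion f0 f1 f2 (pd i h0) (pd i h1) (pd i h2) s.
Proof. by move=> Qs e0 e1 e2; rewrite pd_r_expansion// e0 e1 e2 !mul0r !add0r !pd_base_T. Qed.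

End Derivatives.

Definition ucoef0 s : R := 4^-1 * r_coord s ^+ 2.
Definition ucoef1 s : R := r_coord s ^+ 4 * ln (r_coord s).
Definition ucoef2 s : R := r_coord s ^+ 4.
(** The r-derivatives of the radial factors of the expansion; the exponent 1 keeps the same power
    form as in the other factors. *)
Definition ducoef0 s : R := 2^-1 * r_coord s ^+ 1.
Definition ducoef1 s : R := 4 * (r_coord s ^+ 3 * ln (r_coord s)) + r_coord s ^+ 3.
Definition ducoef2 s : R := 4 * r_coord s ^+ 3.

Lemma Ck_ucoef k : [/\ Ck k Q ucoef0, Ck k Q ucoef1 & Ck k Q ucoef2].
Proof.
split; last exact: Ck_rX.
- exact: (CkM Qo (Ck_cst k Q _) (Ck_rX k 2)).
- exact: (CkM Qo (Ck_rX k 4) (Ck_ln k)).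
Qed.

Lemma Ck_ducoef k : [/\ Ck k Q ducoef0, Ck k Q ducoef1 & Ck k Q ducoef2].
Proof.
split.
- exact: (CkM Qo (Ck_cst k Q _) (Ck_rX k 1)).
- exact: (CkD Qo (CkM Qo (Ck_cst k Q _) (CkM Qo (Ck_rX k 3) (Ck_ln k))) (Ck_rX k 3)).
- exact: (CkM Qo (Ck_cst k Q _) (Ck_rX k 3)).
Qed.

Lemma pd_ucoef_T i s : Q s ->
  [/\ pd (T i) ucoef0 s = 0, pd (T i) ucoef1 s = 0 & pd (T i) ucoef2 s = 0].
Proof.
move=> Qs; split; last exact: pd_rX_T.
- by rewrite (pd_scale (T i) _ (Ck_rX 1 2) Qs) pd_rX_T// mulr0.
- by rewrite (pd_mul (T i) (Ck_rX 1 4) (Ck_ln 1) Qs) pd_rX_T// pd_ln_T mul0r mulr0 addr0.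
Qed.

Lemma pd_ducoef_T i s : Q s ->
  [/\ pd (T i) ducoef0 s = 0, pd (T i) ducoef1 s = 0 & pd (T i) ducoef2 s = 0].
Proof.
move=> Qs; have e := CkM Qo (Ck_rX 1 3) (Ck_ln 1); split.
- by rewrite (pd_scale (T i) _ (Ck_rX 1 1) Qs) pd_rX_T// mulr0.
- rewrite (pd_add (T i) (CkM Qo (Ck_cst 1 Q _) e) (Ck_rX 1 3) Qs) pd_rX_T// addr0.
  rewrite (pd_scale (T i) _ e Qs) (pd_mul (T i) (Ck_rX 1 3) (Ck_ln 1) Qs).
  by rewrite pd_rX_T// pd_ln_T mul0r mulr0 addr0 mulr0.
- by rewrite (pd_scale (T i) _ (Ck_rX 1 3) Qs) pd_rX_T// mulr0.
Qed.

Lemma pd_ucoef_r s : Q s ->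
  [/\ pd r_ ucoef0 s = ducoef0 s, pd r_ ucoef1 s = ducoef1 s & pd r_ ucoef2 s = ducoef2 s].
Proof.
move=> Qs; have s0 := lt0r_neq0 (collar_rpos Qs); split.
- rewrite (pd_scale r_ _ (Ck_rX 1 2) Qs) pd_rX_r// /ducoef0 /= mulrA.
  by congr (_ * _); field.
- rewrite (pd_mul r_ (Ck_rX 1 4) (Ck_ln 1) Qs) pd_rX_r// pd_ln_r// /ducoef1 /=.
  by move: (ln _) => l; field.
- by rewrite pd_rX_r.
Qed.

Lemma pd_ducoef_r s : Q s ->
  [/\ pd r_ ducoef0 s = 2^-1,
      pd r_ ducoef1 s = 12 * (r_coord s ^+ 2 * ln (r_coord s)) + 7 * r_coord s ^+ 2 &
      pd r_ ducoef2 s = 12 * r_coord s ^+ 2].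
Proof.
move=> Qs; have s0 := lt0r_neq0 (collar_rpos Qs).
have e := CkM Qo (Ck_rX 1 3) (Ck_ln 1); split.
- by rewrite (pd_scale r_ _ (Ck_rX 1 1) Qs) pd_rX_r// /= expr0 !mulr1.
- rewrite (pd_add r_ (CkM Qo (Ck_cst 1 Q _) e) (Ck_rX 1 3) Qs) (pd_scale r_ _ e Qs).
  rewrite (pd_mul r_ (Ck_rX 1 3) (Ck_ln 1) Qs) !pd_rX_r// pd_ln_r//.
  by move: (ln _) => l; rewrite /=; field.
- by rewrite (pd_scale r_ _ (Ck_rX 1 3) Qs) pd_rX_r//= mulrA; congr (_ * _); ring.
Qed.

End SeparatedExpansion.

(** * Asymptotics of the derivatives of one component of u *)

Section ScalarAsymptotics.
#[local] Opaque pd.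
Context (R : realType) (m : nat) (B : set 'rV[R]_m) (delta : R).
Context (U : 'rV[R]_(m + 1) -> R) (h0 h1 h2 : 'rV[R]_m -> R) (x : 'rV[R]_m).
Notation Q := (open_collar B delta).
Notation T := (lshift 1).
Notation r_ := (r_index m).
Notation E := (r_expansion (@ucoef0 R m) (@ucoef1 R m) (@ucoef2 R m) h0 h1 h2).
Hypothesis B_open : open B.
Hypothesis delta_gt0 : 0 < delta.
Hypothesis Bx : B x.
Hypothesis UC : Ck 2 Q U.
Hypothesis h0C : Ck 2 B h0.
Hypothesis h1C : Ck 2 B h1.
Hypothesis h2C : Ck 2 B h2.
Hypothesis U_remainder : remainder_o 4 (fun s => U s - E s) x.
Implicit Types (s : 'rV[R]_(m + 1)) (i j : 'I_m).

Let Qo : open Q. Proof. exact: open_collar_open. Qed.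

Lemma ray_in_collar : \forall r \near 0^'+, Q (at_r x r) /\ 0 < r.
Proof.
near=> r.
have r0 : 0 < r by near: r; exact: right_pos.
split=> //; split; rewrite ?at_r_lsubmx// at_rr r0 /=.
by near: r; exact: nbhs_right_lt.
Unshelve. all: by end_near. Qed.

Let EC : Ck 2 Q E.
Proof.
have [k0 k1 k2] := @Ck_ucoef R m B delta B_open 2.
exact: (Ck_r_expansion B_open k0 k1 k2 h0C h1C h2C).
Qed.

Let f s := U s - E s.

Let pdf K s : Q s -> pd K f s = pd K U s - pd K E s.
Proof. exact: (pd_sub K (Ck_S UC) (Ck_S EC)). Qed.

Let pdpdf K L s : Q s -> pd K (pd L f) s = pd K (pd L U) s - pd K (pd L E) s.
Proof.
move=> Qs; rewrite (pd_on K Qo Qs (fun t Qt => pdf L Qt)).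
exact: (pd_sub K (Ck_pd L UC) (Ck_pd L EC) Qs).
Qed.

Let fC : Ck 2 Q f. Proof. exact: (CkB Qo UC EC). Qed.

Let E_T i s : Q s -> pd (T i) E s =
  r_expansion (@ucoef0 R m) (@ucoef1 R m) (@ucoef2 R m) (pd i h0) (pd i h1) (pd i h2) s.
Proof.
move=> Qs; have [k0 k1 k2] := @Ck_ucoef R m B delta B_open 1.
have [e0 e1 e2] := pd_ucoef_T B_open i Qs.
exact: (pd_r_expansion_T B_open k0 k1 k2 (Ck_S h0C) (Ck_S h1C) (Ck_S h2C)).
Qed.

Let E_r s : Q s -> pd r_ E s =
  r_expansion (@ducoef0 R m) (@ducoef1 R m) (@ducoef2 R m) h0 h1 h2 s.
Proof.
move=> Qs; have [k0 k1 k2] := @Ck_ucoef R m B delta B_open 1.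
rewrite (pd_r_expansion_r B_open k0 k1 k2 (Ck_S h0C) (Ck_S h1C) (Ck_S h2C) Qs).
by have [e0 e1 e2] := pd_ucoef_r B_open Qs; rewrite /r_expansion e0 e1 e2.
Qed.

Let E_TT i j s : Q s -> pd (T i) (pd (T j) E) s =
  r_expansion (@ucoef0 R m) (@ucoef1 R m) (@ucoef2 R m)
    (pd i (pd j h0)) (pd i (pd j h1)) (pd i (pd j h2)) s.
Proof.
move=> Qs; have [k0 k1 k2] := @Ck_ucoef R m B delta B_open 1.
have [e0 e1 e2] := pd_ucoef_T B_open i Qs.
rewrite (pd_on (T i) Qo Qs (fun t Qt => E_T j Qt)).
exact: (pd_r_expansion_T B_open k0 k1 k2 (Ck_pd j h0C) (Ck_pd j h1C) (Ck_pd j h2C)).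
Qed.

Let E_Tr i s : Q s -> pd (T i) (pd r_ E) s =
  r_expansion (@ducoef0 R m) (@ducoef1 R m) (@ducoef2 R m) (pd i h0) (pd i h1) (pd i h2) s.
Proof.
move=> Qs; have [k0 k1 k2] := @Ck_ducoef R m B delta B_open 1.
have [e0 e1 e2] := pd_ducoef_T B_open i Qs.
rewrite (pd_on (T i) Qo Qs (fun t Qt => E_r Qt)).
exact: (pd_r_expansion_T B_open k0 k1 k2 (Ck_S h0C) (Ck_S h1C) (Ck_S h2C)).
Qed.

Let E_rT i s : Q s -> pd r_ (pd (T i) E) s =
  r_expansion (@ducoef0 R m) (@ducoef1 R m) (@ducoef2 R m) (pd i h0) (pd i h1) (pd i h2) s.
Proof.
move=> Qs; have [k0 k1 k2] := @Ck_ucoef R m B delta B_open 1.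
rewrite (pd_on r_ Qo Qs (fun t Qt => E_T i Qt)).
rewrite (pd_r_expansion_r B_open k0 k1 k2 (Ck_pd i h0C) (Ck_pd i h1C) (Ck_pd i h2C) Qs).
by have [e0 e1 e2] := pd_ucoef_r B_open Qs; rewrite /r_expansion e0 e1 e2.
Qed.

Let E_rr s : Q s -> pd r_ (pd r_ E) s =
  2^-1 * h0 (lsubmx s)
  + (12 * (r_coord s ^+ 2 * ln (r_coord s)) + 7 * r_coord s ^+ 2) * h1 (lsubmx s)
  + 12 * r_coord s ^+ 2 * h2 (lsubmx s).
Proof.
move=> Qs; have [k0 k1 k2] := @Ck_ducoef R m B delta B_open 1.
rewrite (pd_on r_ Qo Qs (fun t Qt => E_r Qt)).
rewrite (pd_r_expansion_r B_open k0 k1 k2 (Ck_S h0C) (Ck_S h1C) (Ck_S h2C) Qs).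
by have [e0 e1 e2] := pd_ducoef_r B_open Qs; rewrite /r_expansion e0 e1 e2.
Qed.

Let bderiv_T i (p : 'rV[R]_(m + 1) -> R) s : bderiv (T i) p s = pd (T i) p s.
Proof. by rewrite /bderiv eq_lrshift mul1r. Qed.

Let bderiv_r (p : 'rV[R]_(m + 1) -> R) s : bderiv r_ p s = r_coord s * pd r_ p s.
Proof. by rewrite /bderiv eqxx. Qed.

Let bderiv_TE i : bderiv (T i) = @pd R _ (T i).
Proof. by apply/funext => p; apply/funext => s; exact: bderiv_T. Qed.

Let bderiv_rE (p : 'rV[R]_(m + 1) -> R) : bderiv r_ p = fun s => r_coord s * pd r_ p s.
Proof. by apply/funext => s; exact: bderiv_r. Qed.

Let rem0 : (fun r => f (at_r x r) / r ^+ 4) @ 0^'+ --> (0 : R).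
Proof. exact: (U_remainder (l := [::])). Qed.

Let remT i : (fun r => pd (T i) f (at_r x r) / r ^+ 4) @ 0^'+ --> (0 : R).
Proof. by have := @U_remainder [:: T i] isT; rewrite /= bderiv_TE. Qed.

Let remTT i j : (fun r => pd (T i) (pd (T j) f) (at_r x r) / r ^+ 4) @ 0^'+ --> (0 : R).
Proof. by have := @U_remainder [:: T i; T j] isT; rewrite /= !bderiv_TE. Qed.

Let remr : (fun r => r * pd r_ f (at_r x r) / r ^+ 4) @ 0^'+ --> (0 : R).
Proof.
have := @U_remainder [:: r_] isT; rewrite /= bderiv_rE.
by under [X in X @ _]eq_fun do rewrite at_rr.
Qed.

Let rC : Ck 1 Q (fun s => r_coord s). Proof. exact: Ck_r. Qed.

Let remTr i : (fun r => r * pd (T i) (pd r_ f) (at_r x r) / r ^+ 4) @ 0^'+ --> (0 : R).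
Proof.
have := @U_remainder [:: T i; r_] isT; rewrite /= bderiv_rE bderiv_TE.
apply: cvg_right_near; near=> r.
have [Qr _] : Q (at_r x r) /\ 0 < r by near: r; exact: ray_in_collar.
by rewrite (pd_mul (T i) rC (Ck_pd r_ fC) Qr) pd_T_r mul0r add0r at_rr.
Unshelve. all: by end_near. Qed.

Let remrT i : (fun r => r * pd r_ (pd (T i) f) (at_r x r) / r ^+ 4) @ 0^'+ --> (0 : R).
Proof.
have := @U_remainder [:: r_; T i] isT; rewrite /= bderiv_rE bderiv_TE.
by under [X in X @ _]eq_fun do rewrite at_rr.
Qed.

(** The square of r d_r is r d_r + r^2 d_r^2; the remainder is controlled for this operator and not
    for d_r^2 alone. *)
Let remrr : (fun r => (r * pd r_ f (at_r x r) + r ^+ 2 * pd r_ (pd r_ f) (at_r x r)) / r ^+ 4)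
  @ 0^'+ --> (0 : R).
Proof.
have := @U_remainder [:: r_; r_] isT; rewrite /= !bderiv_rE.
apply: cvg_right_near; near=> r.
have [Qr _] : Q (at_r x r) /\ 0 < r by near: r; exact: ray_in_collar.
rewrite (pd_mul r_ rC (Ck_pd r_ fC) Qr) pd_r_r mul1r at_rr.
by congr (_ / _); rewrite mulrDr mulrA expr2.
Unshelve. all: by end_near. Qed.

Let lim_main (c0 c1 c2 a1 a2 : R) :
  (fun r : R => c0 + a1 * (r ^+ 2 * ln r) * c1 + a2 * r ^+ 2 * c2) @ 0^'+ --> c0.
Proof.
have l1 := cvg_rightM (cvg_rightZ (c := a1) (@cvg_r2_ln R)) (@cvg_right_cst R c1).
have l2 := cvg_rightM (cvg_rightZ (c := a2) (@cvg_right_r2 R)) (@cvg_right_cst R c2).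
have := cvg_rightD (cvg_rightD (@cvg_right_cst R c0) l1) l2.
by rewrite !mulr0 !mul0r !addr0.
Qed.

(** After division by r^2, both r^4 log r and r^4 tend to zero, so the quadratic term alone gives
    the limit. *)
Let lim_quot (p q : R -> R) (c0 c1 c2 : R) :
  (fun r => p r / r ^+ 4) @ 0^'+ --> (0 : R) ->
  (\forall r \near 0^'+, q r = p r + (4^-1 * r ^+ 2 * c0 + r ^+ 4 * ln r * c1 + r ^+ 4 * c2)) ->
  (fun r => q r / r ^+ 2) @ 0^'+ --> 4^-1 * c0.
Proof.
move=> hp hq.
have := cvg_rightD (cvg_rightM (@cvg_right_r2 R) hp) (@lim_main (4^-1 * c0) c1 c2 1 1).
rewrite mul0r add0r; apply: cvg_right_near; near=> r.
have r0 : r != 0 by rewrite gt_eqF//; near: r; exact: right_pos.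
have -> : q r = p r + (4^-1 * r ^+ 2 * c0 + r ^+ 4 * ln r * c1 + r ^+ 4 * c2) by near: r.
by move: (p r) (ln r) => a b; field.
Unshelve. all: by end_near. Qed.

Let lim_dquot (p q : R -> R) (c0 c1 c2 : R) :
  (fun r => r * p r / r ^+ 4) @ 0^'+ --> (0 : R) ->
  (\forall r \near 0^'+, q r = p r +
     (2^-1 * r ^+ 1 * c0 + (4 * (r ^+ 3 * ln r) + r ^+ 3) * c1 + 4 * r ^+ 3 * c2)) ->
  (fun r => q r / r) @ 0^'+ --> 2^-1 * c0.
Proof.
move=> hp hq.
have := cvg_rightD (cvg_rightD (cvg_rightM (@cvg_right_r2 R) hp) (@lim_main (2^-1 * c0) c1 c2 4 4))
  (cvg_rightM (@cvg_right_r2 R) (@cvg_right_cst R c1)).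
rewrite !mul0r add0r addr0; apply: cvg_right_near; near=> r.
have r0 : r != 0 by rewrite gt_eqF//; near: r; exact: right_pos.
have -> : q r = p r +
  (2^-1 * r ^+ 1 * c0 + (4 * (r ^+ 3 * ln r) + r ^+ 3) * c1 + 4 * r ^+ 3 * c2) by near: r.
by move: (p r) (ln r) => a b; field.
Unshelve. all: by end_near. Qed.

Lemma asymp_u : (fun r => U (at_r x r) / r ^+ 2) @ 0^'+ --> 4^-1 * h0 x.
Proof.
apply: (@lim_quot _ _ _ (h1 x) (h2 x) rem0); near=> r.
by rewrite /f /r_expansion /ucoef0 /ucoef1 /ucoef2 at_rr at_r_lsubmx subrK.
Unshelve. all: by end_near. Qed.

Lemma asymp_uT i : (fun r => pd (T i) U (at_r x r) / r ^+ 2) @ 0^'+ --> 4^-1 * pd i h0 x.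
Proof.
apply: (@lim_quot _ _ _ (pd i h1 x) (pd i h2 x) (remT i)); near=> r.
have [Qr _] : Q (at_r x r) /\ 0 < r by near: r; exact: ray_in_collar.
by rewrite (pdf _ Qr) (E_T i Qr) /r_expansion /ucoef0 /ucoef1 /ucoef2 at_rr at_r_lsubmx subrK.
Unshelve. all: by end_near. Qed.

Lemma asymp_uTT i j :
  (fun r => pd (T i) (pd (T j) U) (at_r x r) / r ^+ 2) @ 0^'+ --> 4^-1 * pd i (pd j h0) x.
Proof.
apply: (@lim_quot _ _ _ (pd i (pd j h1) x) (pd i (pd j h2) x) (remTT i j)); near=> r.
have [Qr _] : Q (at_r x r) /\ 0 < r by near: r; exact: ray_in_collar.
by rewrite (pdpdf _ _ Qr) (E_TT i j Qr) /r_expansion /ucoef0 /ucoef1 /ucoef2 at_rr at_r_lsubmx subrK.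
Unshelve. all: by end_near. Qed.

Lemma asymp_ur : (fun r => pd r_ U (at_r x r) / r) @ 0^'+ --> 2^-1 * h0 x.
Proof.
apply: (@lim_dquot _ _ _ (h1 x) (h2 x) remr); near=> r.
have [Qr _] : Q (at_r x r) /\ 0 < r by near: r; exact: ray_in_collar.
by rewrite (pdf _ Qr) (E_r Qr) /r_expansion /ducoef0 /ducoef1 /ducoef2 at_rr at_r_lsubmx subrK.
Unshelve. all: by end_near. Qed.

Lemma asymp_uTr i : (fun r => pd (T i) (pd r_ U) (at_r x r) / r) @ 0^'+ --> 2^-1 * pd i h0 x.
Proof.
apply: (@lim_dquot _ _ _ (pd i h1 x) (pd i h2 x) (remTr i)); near=> r.
have [Qr _] : Q (at_r x r) /\ 0 < r by near: r; exact: ray_in_collar.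
by rewrite (pdpdf _ _ Qr) (E_Tr i Qr) /r_expansion /ducoef0 /ducoef1 /ducoef2 at_rr at_r_lsubmx subrK.
Unshelve. all: by end_near. Qed.

Lemma asymp_urT i : (fun r => pd r_ (pd (T i) U) (at_r x r) / r) @ 0^'+ --> 2^-1 * pd i h0 x.
Proof.
apply: (@lim_dquot _ _ _ (pd i h1 x) (pd i h2 x) (remrT i)); near=> r.
have [Qr _] : Q (at_r x r) /\ 0 < r by near: r; exact: ray_in_collar.
by rewrite (pdpdf _ _ Qr) (E_rT i Qr) /r_expansion /ducoef0 /ducoef1 /ducoef2 at_rr at_r_lsubmx subrK.
Unshelve. all: by end_near. Qed.

(* d_r^2 - 3 r^-1 d_r maps r^2 / 4 to -1, r^4 to 0 and r^4 log r to 4 r^2, which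
   is why the r^4 coefficient of the expansion is free. *)
Lemma asymp_urr_combination : (fun r => (pd r_ (pd r_ U) (at_r x r)
    - 3 * (pd r_ U (at_r x r) / r) + h0 x) / r ^+ 2) @ 0^'+ --> 4 * h1 x.
Proof.
(* Four copies of r d_r are subtracted because (r d_r)^2 - 4 r d_r = r^2 (d_r^2 - 3 r^-1 d_r). For
   r^4 log r the logarithms cancel, 12 - 12, and 7 - 3 = 4 remains. *)
have := cvg_rightD (cvg_rightB remrr (cvg_rightZ (c := 4) remr)) (@cvg_right_cst R (4 * h1 x)).
rewrite mulr0 subr0 add0r; apply: cvg_right_near; near=> r.
have [Qr r0] : Q (at_r x r) /\ 0 < r by near: r; exact: ray_in_collar.
have rn0 : r != 0 by rewrite gt_eqF.
rewrite (pdf _ Qr) (pdpdf _ _ Qr) (E_r Qr) (E_rr Qr).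
rewrite /r_expansion /ducoef0 /ducoef1 /ducoef2 at_rr at_r_lsubmx.
by move: (ln r) (pd r_ _ _) (pd r_ _ _) => a b c; field.
Unshelve. all: by end_near. Qed.

Lemma asymp_urr : (fun r => pd r_ (pd r_ U) (at_r x r)) @ 0^'+ --> 2^-1 * h0 x.
Proof.
have := cvg_rightD (cvg_rightM (@cvg_right_r2 R) asymp_urr_combination)
  (cvg_rightB (cvg_rightZ (c := 3) asymp_ur) (@cvg_right_cst R (h0 x))).
rewrite mul0r add0r (_ : 3 * (2^-1 * h0 x) - h0 x = 2^-1 * h0 x); last by field.
apply: cvg_right_near; near=> r.
have r0 : r != 0 by rewrite gt_eqF//; near: r; exact: right_pos.
by move: (pd r_ _ _) (pd r_ _ _) => b c; field.
Unshelve. all: by end_near. Qed.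

End ScalarAsymptotics.

(** * Expansions to second order *)

Section Jets.
Context (R : realType).
Implicit Types (f g : R -> R) (a b c d : R).

(* f(r) = a + b r^2 + o(r^2) as r -> 0+ *)
Definition jet f a b := (fun r => (f r - a) / r ^+ 2) @ 0^'+ --> b.

Lemma jetI f a b : (fun r => (f r - a) / r ^+ 2) @ 0^'+ --> b -> jet f a b.
Proof. by []. Qed.

Lemma jet_near f g a b : (\forall r \near 0^'+, f r = g r) -> jet f a b -> jet g a b.
Proof. by move=> h; apply: cvg_right_near; apply: filterS h => r ->. Qed.

Lemma jet_cvg f a b : jet f a b -> f @ 0^'+ --> a.
Proof.
move=> h; have := cvg_rightD (cvg_rightM (@cvg_right_r2 R) h) (@cvg_right_cst R a).
rewrite mul0r add0r; apply: cvg_right_near; near=> r.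
have r0 : r != 0 by rewrite gt_eqF//; near: r; exact: right_pos.
by move: (f r) => p; field.
Unshelve. all: by end_near. Qed.

Lemma jet_cst c : jet (fun=> c) c 0.
Proof. by rewrite /jet; under eq_fun do rewrite subrr mul0r; exact: cvg_cst. Qed.

Lemma jetD f g a b c d : jet f a b -> jet g c d -> jet (fun r => f r + g r) (a + c) (b + d).
Proof.
move=> hf hg; have := cvg_rightD hf hg; apply: cvg_right_near; near=> r.
by rewrite -mulrDl; congr (_ / _); rewrite opprD addrACA.
Unshelve. all: by end_near. Qed.

Lemma jetN f a b : jet f a b -> jet (fun r => - f r) (- a) (- b).
Proof.
move=> hf; have := cvg_rightB (@cvg_right_cst R 0) hf; rewrite sub0r.
apply: cvg_right_near; near=> r.
by rewrite sub0r -mulNr opprB opprK addrC.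
Unshelve. all: by end_near. Qed.

Lemma jetB f g a b c d : jet f a b -> jet g c d -> jet (fun r => f r - g r) (a - c) (b - d).
Proof. by move=> hf /jetN; exact: jetD. Qed.

Lemma jetM f g a b c d : jet f a b -> jet g c d ->
  jet (fun r => f r * g r) (a * c) (b * c + a * d).
Proof.
move=> hf hg; have := cvg_rightD (cvg_rightM hf (jet_cvg hg)) (cvg_rightZ (c := a) hg).
apply: cvg_right_near; near=> r.
by move: (f r) (g r) => p q; ring.
Unshelve. all: by end_near. Qed.

Lemma jetZ c f a b : jet f a b -> jet (fun r => c * f r) (c * a) (c * b).
Proof. by move=> h; have := jetM (jet_cst c) h; rewrite mul0r add0r. Qed.

Lemma jet_sum (I : finType) (F : I -> R -> R) (a b : I -> R) :
  (forall i, jet (F i) (a i) (b i)) ->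
  jet (fun r => \sum_i F i r) (\sum_i a i) (\sum_i b i).
Proof.
move=> h; have : (fun r => \sum_i (F i r - a i) / r ^+ 2) @ 0^'+ --> \sum_i b i.
  by apply: cvg_right_sum => i _; exact: h.
apply: cvg_right_near; near=> r.
by rewrite -mulr_suml sumrB.
Unshelve. all: by end_near. Qed.

(** A factor that is already O(r^2) needs only a limit of the other one. This covers entries of the
    graph equation whose own r^2 coefficients are never computed. *)
Lemma jet0_cvgM f g b c : jet f 0 b -> g @ 0^'+ --> c -> jet (fun r => f r * g r) 0 (b * c).
Proof.
move=> hf hg; have := cvg_rightM hf hg; apply: cvg_right_near; near=> r.
by rewrite !subr0 mulrAC.
Unshelve. all: by end_near. Qed.

Lemma lin_cvg f b : (fun r => f r / r) @ 0^'+ --> b -> f @ 0^'+ --> (0 : R).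
Proof.
move=> h; have := cvg_right_mul_r h; apply: cvg_right_near; near=> r.
have r0 : r != 0 by rewrite gt_eqF//; near: r; exact: right_pos.
by field.
Unshelve. all: by end_near. Qed.

(** Quantities with one r-derivative, such as d_r u and d_r gt, are only O(r) along the curve; they
    enter the r^2 coefficient in pairs. *)
Lemma linM f g b d : (fun r => f r / r) @ 0^'+ --> b -> (fun r => g r / r) @ 0^'+ --> d ->
  jet (fun r => f r * g r) 0 (b * d).
Proof.
move=> hf hg; have := cvg_rightM hf hg; apply: cvg_right_near; near=> r.
have r0 : r != 0 by rewrite gt_eqF//; near: r; exact: right_pos.
by field.
Unshelve. all: by end_near. Qed.

Lemma jet0E f b : (fun r => f r / r ^+ 2) @ 0^'+ --> b -> jet f 0 b.
Proof. by rewrite /jet; under [in X in _ -> X]eq_fun do rewrite subr0. Qed.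

Lemma jet_unique f a b c : jet f a b -> jet f a c -> b = c.
Proof. exact: cvg_right_unique. Qed.

Lemma cvg_right_prod (I : finType) (F : I -> R -> R) (l : I -> R) :
  (forall i, F i @ 0^'+ --> l i) ->
  (fun r => \prod_i F i r) @ 0^'+ --> \prod_i l i.
Proof.
move=> h; elim: (index_enum I) => [|i s IH].
  by under eq_fun do rewrite big_nil; rewrite big_nil; exact: cvg_cst.
by under eq_fun do rewrite big_cons; rewrite big_cons; apply: cvg_rightM.
Qed.

Lemma cvg_right_det n (M : R -> 'M[R]_n) (M0 : 'M[R]_n) :
  (forall i j, (fun r => M r i j) @ 0^'+ --> M0 i j) ->
  (fun r => \det (M r)) @ 0^'+ --> \det M0.
Proof.
move=> h; apply: cvg_right_sum => s _; apply: cvg_rightM; first exact: cvg_right_cst.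
by apply: cvg_right_prod => i; exact: h.
Qed.

Section MatrixJets.
Context (n : nat) (M : R -> 'M[R]_n) (M0 M1 : 'M[R]_n).
Hypothesis M0_unit : M0 \in unitmx.
Hypothesis M_jet : forall i j, jet (fun r => M r i j) (M0 i j) (M1 i j).

Let M_cvg i j : (fun r => M r i j) @ 0^'+ --> M0 i j.
Proof. exact: jet_cvg (@M_jet i j). Qed.

Let det0 : \det M0 != 0.
Proof. by rewrite -unitfE -unitmxE. Qed.

Lemma near_unitmx : \forall r \near 0^'+, M r \in unitmx.
Proof.
have h : \forall r \near 0^'+, \det (M r) != 0 by apply: cvgr_neq0 (cvg_right_det M_cvg) det0.
by apply: filterS h => r; rewrite unitmxE unitfE.
Qed.

Lemma invmx_cvg i j : (fun r => invmx (M r) i j) @ 0^'+ --> invmx M0 i j.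
Proof.
have -> : invmx M0 i j = (\det M0)^-1 * ((-1) ^+ (j + i) * \det (row' j (col' i M0))).
  by rewrite /invmx M0_unit !mxE.
have : (fun r => (\det (M r))^-1 * ((-1) ^+ (j + i) * \det (row' j (col' i (M r))))) @ 0^'+
    --> (\det M0)^-1 * ((-1) ^+ (j + i) * \det (row' j (col' i M0))).
  apply: cvg_rightM; first exact: (cvgV det0 (cvg_right_det M_cvg)).
  apply: cvg_rightZ; apply: cvg_right_det => k l; rewrite !mxE.
  by under [X in X @ _]eq_fun do rewrite !mxE; exact: M_cvg.
apply: cvg_right_near; near=> r.
have u : M r \in unitmx by near: r; exact: near_unitmx.
by rewrite /invmx u !mxE.
Unshelve. all: by end_near. Qed.

(** From M^-1 - M0^-1 = - M^-1 (M - M0) M0^-1: after division by r^2, only convergence of M^-1 is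
    needed, which the cofactor formula gives. *)
Lemma invmx_jet i j : jet (fun r => invmx (M r) i j) (invmx M0 i j)
  (- \sum_k \sum_l invmx M0 i k * M1 k l * invmx M0 l j).
Proof.
have : (fun r => - \sum_k \sum_l invmx (M r) i k * ((M r k l - M0 k l) / r ^+ 2) * invmx M0 l j)
    @ 0^'+ --> - \sum_k \sum_l invmx M0 i k * M1 k l * invmx M0 l j.
  apply: cvgN; apply: cvg_right_sum => k _; apply: cvg_right_sum => l _.
  apply: cvg_rightM; last exact: cvg_right_cst.
  by apply: cvg_rightM; [exact: invmx_cvg | exact: (@M_jet k l)].
apply: cvg_right_near; near=> r.
have u : M r \in unitmx by near: r; exact: near_unitmx.
have : invmx (M r) *m (M r - M0) *m invmx M0 = invmx M0 - invmx (M r).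
  by rewrite mulmxBr mulmxBl mulVmx// mul1mx -mulmxA mulmxV// mulmx1.
move=> /matrixP/(_ i j); rewrite [RHS]mxE [X in _ = _ + X]mxE => e.
rewrite -[X in _ = X / _]opprB -e mulNr; congr (- _).
rewrite mxE exchange_big mulr_suml; apply: eq_bigr => l _ /=.
rewrite mxE !mulr_suml; apply: eq_bigr => k _.
rewrite [(M r - M0) k l]mxE [(- M0) k l]mxE.
by move: (invmx _ _ _) (invmx _ _ _) => p q; ring.
Unshelve. all: by end_near. Qed.

End MatrixJets.
End Jets.

Section BilinearJets.
#[local] Opaque jet.
Context (R : realType) (I : finType) (G : I -> I -> R -> R) (f h : I -> R -> R).
Context (g0 g1 : I -> I -> R) (a0 a1 b0 b1 : I -> R).
Notation S := (fun r => \sum_A \sum_B G A B r * f A r * h B r).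

Lemma jet_bilinear : (forall A B, jet (G A B) (g0 A B) (g1 A B)) ->
  (forall A, jet (f A) (a0 A) (a1 A)) -> (forall A, jet (h A) (b0 A) (b1 A)) ->
  jet S (\sum_A \sum_B g0 A B * a0 A * b0 B)
    (\sum_A \sum_B ((g1 A B * a0 A + g0 A B * a1 A) * b0 B + g0 A B * a0 A * b1 B)).
Proof.
by move=> hG hf hh; apply: jet_sum => A; apply: jet_sum => B; do 2?apply: jetM.
Qed.

Lemma cvg_bilinear : (forall A B, G A B @ 0^'+ --> g0 A B) ->
  (forall A, f A @ 0^'+ --> a0 A) -> (forall A, h A @ 0^'+ --> b0 A) ->
  S @ 0^'+ --> \sum_A \sum_B g0 A B * a0 A * b0 B.
Proof.
move=> hG hf hh; apply: cvg_right_sum => A _; apply: cvg_right_sum => B _.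
by do 2?apply: cvg_rightM.
Qed.

Lemma lin_bilinear : (forall A B, (fun r => G A B r / r) @ 0^'+ --> g0 A B) ->
  (forall A, f A @ 0^'+ --> a0 A) -> (forall A, h A @ 0^'+ --> b0 A) ->
  (fun r => S r / r) @ 0^'+ --> \sum_A \sum_B g0 A B * a0 A * b0 B.
Proof.
move=> hG hf hh.
have -> : (fun r => S r / r) = fun r => \sum_A \sum_B G A B r / r * f A r * h B r.
  apply/funext => r; rewrite mulr_suml; apply: eq_bigr => A _.
  rewrite mulr_suml; apply: eq_bigr => B _.
  by rewrite mulrAC [G A B r * f A r / r]mulrAC.
apply: cvg_right_sum => A _; apply: cvg_right_sum => B _.
by do 2?apply: cvg_rightM.
Qed.

Lemma jet_bilinear_lin : (forall A B, G A B @ 0^'+ --> g0 A B) ->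
  (forall A, (fun r => f A r / r) @ 0^'+ --> a1 A) ->
  (forall A, (fun r => h A r / r) @ 0^'+ --> b1 A) ->
  jet S 0 (\sum_A \sum_B g0 A B * a1 A * b1 B).
Proof.
move=> hG hf hh.
have Z : \sum_(A : I) \sum_(B : I) 0 = (0 : R) by rewrite big1// => A _; rewrite big1.
rewrite -[X in jet _ X]Z; apply: jet_sum => A; apply: jet_sum => B; apply: linM; last exact: hh.
have := cvg_rightM (hG A B) (hf A).
by under eq_fun do rewrite mulrA.
Qed.

End BilinearJets.

Lemma sum4_reindex (V : nmodType) (I : finType) (F : I -> I -> I -> I -> V) :
  \sum_a \sum_b \sum_c \sum_d F a b c d = \sum_b \sum_d \sum_a \sum_c F a b c d.
Proof.
rewrite exchange_big; apply: eq_bigr => b _ /=.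
under eq_bigr do rewrite exchange_big.
exact: exchange_big.
Qed.

(** The finite-sum core of [graph_term_jet2_trace]. The two transposed copies of [D] have the same
    trace against the symmetric [gi] and combine into the factor 2 of [jacobi_identity]; [L] carries
    the derivative of the Christoffel symbols and [dp] the derivatives of P. *)
Lemma trace_graph_term (R : realFieldType) (I : finType)
    (gi dd D K L CJ Pm : I -> I -> R) (h dp : R) :
  (forall i j, gi i j = gi j i) ->
  \sum_i \sum_j gi i j * CJ i j = 4^-1 * (\sum_i \sum_j gi i j * L i j) + 2^-1 * dp ->
  \sum_i \sum_j gi i j * (4^-1 * dd i j + (CJ i j + 4^-1 * D j i + 4^-1 * D i j)
     - 4^-1 * K i j + 2^-1 * (2^-1 * h * (- 2 * Pm i j))) =
  4^-1 * (\sum_i \sum_j gi i j * (dd i j + 2 * D i j - K i j + L i j))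
  + 2^-1 * dp - 2^-1 * (\sum_i \sum_j gi i j * Pm i j) * h.
Proof.
move=> gs hCJ.
pose tr (F : I -> I -> R) := \sum_i \sum_j gi i j * F i j.
have trD F F' : tr (fun i j => F i j + F' i j) = tr F + tr F'.
  by rewrite /tr -sum2D; apply: eq_bigr => i _; apply: eq_bigr => j _; rewrite mulrDr.
have trZ c F : tr (fun i j => c * F i j) = c * tr F.
  rewrite /tr mulr_sumr; apply: eq_bigr => i _; rewrite mulr_sumr.
  by apply: eq_bigr => j _; rewrite mulrCA.
transitivity (tr (fun i j => 4^-1 * dd i j + (CJ i j + (4^-1 * D j i + (4^-1 * D i j
    + (- 4^-1 * K i j + - (2^-1 * h) * Pm i j)))))).
  by apply: eq_bigr => i _; apply: eq_bigr => j _; field.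
rewrite [X in _ = 4^-1 * X + _ - _](_ : _ =
    tr (fun i j => dd i j + (2 * D i j + (- 1 * K i j + L i j)))); last first.
  by apply: eq_bigr => i _; apply: eq_bigr => j _; ring.
rewrite !trD !trZ [tr CJ]hCJ -/(tr L) -/(tr Pm) (_ : tr (fun i j => D j i) = tr D); first by field.
by rewrite /tr -sum2_sym.
Qed.

Section BilinearSums.
Context (R : comPzRingType) (I : finType) (t t' e e' : I -> R) (k k' : I).
Hypothesis tk : forall f : I -> R, \sum_A f A * t A = f k.
Hypothesis tk' : forall f : I -> R, \sum_A f A * t' A = f k'.
Implicit Types (f : I -> I -> R).

Lemma bilinear_pick f : \sum_A \sum_C f A C * t A * t' C = f k k'.
Proof.
rewrite -(tk (fun A => f A k')); apply: eq_bigr => A _.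
by rewrite (tk' (fun C => f A C * t A)).
Qed.

Lemma bilinear_pick_jet f f' :
  \sum_A \sum_C ((f' A C * t A + f A C * e A) * t' C + f A C * t A * e' C) =
  f' k k' + \sum_A f A k' * e A + \sum_C f k C * e' C.
Proof.
rewrite -bilinear_pick -(tk (fun A => \sum_C f A C * e' C)).
rewrite -!big_split; apply: eq_bigr => A _ /=.
rewrite -(tk' (fun C => f A C * e A)) mulr_suml -!big_split.
by apply: eq_bigr => C _ /=; rewrite mulrDl [_ * e' C * _]mulrAC.
Qed.

End BilinearSums.

Lemma jet_zero (R : realType) (f : R -> R) (a b : R) :
  (\forall r \near 0^'+, f r = 0) -> jet f a b -> b = 0.
Proof.
move=> f0 hf; have c0 := jet_near f0 hf.
have a0 := cvg_right_unique (jet_cvg c0) (@cvg_right_cst R 0).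
by rewrite a0 in c0; exact: jet_unique c0 (jet_cst 0).
Qed.

(** * The minimal surface equation at order r^2 *)

Section GraphLimit.
#[local] Opaque pd christoffel christoffel1 jet.
Context (R : realType) (n : nat) (V : set 'rV[R]_(2 + n)) (eps : R).
Context (gt : 'rV[R]_(2 + n + 1) -> 'M[R]_(2 + n)) (B : set 'rV[R]_2) (delta : R).
Context (u : 'rV[R]_(2 + 1) -> 'rV[R]_n) (w2 u4 : 'rV[R]_2 -> 'rV[R]_n) (x : 'rV[R]_2).
Notation g := (boundary_metric gt).
Notation Q := (open_collar B delta).
Hypothesis n_gt0 : (0 < n)%N.
Hypothesis V_open : open V.
Hypothesis eps_gt0 : 0 < eps.
Hypothesis gt_metric : is_metric_on (collar V eps) gt.
Hypothesis gt_C3 : forall a b, Ck_on 3 (collar V eps) (fun w => gt w a b).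
Hypothesis g_plus_einstein : is_einstein_on (open_collar V eps) (- (2 + n)%:R) (g_plus gt).
Hypothesis adapted : is_adapted V g.
Hypothesis B_open : open B.
Hypothesis B_sub : forall x, B x -> V (sigma_pt n x).
Hypothesis delta_gt0 : 0 < delta.
Hypothesis Y_in_X : forall s, Q s -> open_collar V eps (graph u s).
Hypothesis uC : forall al, Ck 2 Q (fun s => u s 0 al).
Hypothesis w2C : forall al, Ck 2 B (fun y => w2 y 0 al).
Hypothesis u4C : forall al, Ck 2 B (fun y => u4 y 0 al).
Hypothesis Y_minimal : is_minimal_on Q (g_plus gt) (graph u).
Hypothesis u_rem : forall al, remainder_o 4 (fun s => u s 0 al
  - r_expansion (@ucoef0 R 2) (@ucoef1 R 2) (@ucoef2 R 2)
      (fun y => Hvec g y 0 al) (fun y => w2 y 0 al) (fun y => u4 y 0 al) s) x.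
Hypothesis Bx : B x.
Implicit Types (r : R) (i j k l : 'I_2) (al be c : 'I_n) (A C L : 'I_(2 + n)).
Notation T := (@tan_ix n).
Notation Nu := (@nor_ix n).
Notation Tl := (lshift 1).
Notation rs := (r_index 2).
Notation p := (sigma_pt n x).
Notation H := (Hvec g x 0).
Notation P := (schouten g p).
Notation gi := (ginv_tan g x).
Notation U al := (fun s => u s 0 al).

Let m_ge3 : (2 < 2 + n)%N. Proof. exact: n_gt0. Qed.
Let Vp : V p. Proof. exact: B_sub. Qed.
Let gC : forall A C, Ck 3 V (fun z => g z A C).
Proof. exact: collar_boundaryC V_open eps_gt0 gt_metric gt_C3 g_plus_einstein. Qed.
Let gsym : forall z, V z -> (g z)^T = g z.
Proof. exact: collar_boundary_sym eps_gt0 gt_metric. Qed.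
Let gunit : forall z, V z -> g z \in unitmx.
Proof. exact: collar_boundary_unit eps_gt0 gt_metric. Qed.
Let Xo : open (open_collar V eps). Proof. exact: open_collar_open. Qed.
Let HC al : Ck 2 B (fun y => Hvec g y 0 al).
Proof. exact: (Ck_Hvec V_open gC gsym gunit adapted B_open B_sub). Qed.

Let lim_u al := asymp_u (u_rem al).
Let lim_uT al i := @asymp_uT _ _ _ _ _ _ _ _ _ B_open delta_gt0 Bx (uC al) (HC al) (w2C al) (u4C al) (u_rem al) i.
Let lim_uTT al i j := @asymp_uTT _ _ _ _ _ _ _ _ _ B_open delta_gt0 Bx (uC al) (HC al) (w2C al) (u4C al) (u_rem al) i j.
Let lim_uTr al i := @asymp_uTr _ _ _ _ _ _ _ _ _ B_open delta_gt0 Bx (uC al) (HC al) (w2C al) (u4C al) (u_rem al) i.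
Let lim_urT al i := @asymp_urT _ _ _ _ _ _ _ _ _ B_open delta_gt0 Bx (uC al) (HC al) (w2C al) (u4C al) (u_rem al) i.
Let lim_ur al := asymp_ur B_open delta_gt0 Bx (uC al) (HC al) (w2C al) (u4C al) (u_rem al).
Let lim_urr al := asymp_urr B_open delta_gt0 Bx (uC al) (HC al) (w2C al) (u4C al) (u_rem al).
Let lim_urrc al := asymp_urr_combination B_open delta_gt0 Bx (uC al) (HC al) (w2C al) (u4C al) (u_rem al).

(* The curve is (p + v r, r) with v r = r^2 W + o(r^2), W = (0, H / 4). *)
Definition graph_offset r : 'rV[R]_(2 + n) := row_mx 0 (u (at_r x r)).
Definition graph_direction A : R := row_mx 0 (4^-1 *: Hvec g x) 0 A.
Notation v := graph_offset.
Notation W := graph_direction.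
Notation s r := (at_r x r).
Notation F r := (graph u (at_r x r)).

Lemma graph_curve r : F r = at_r (p + v r) r.
Proof.
rewrite /graph at_r_lsubmx at_rr; congr at_r.
by rewrite /sigma_pt /graph_offset add_row_mx addr0 add0r.
Qed.

Lemma graph_offset_cvg : cvg_at_0 v W.
Proof.
move=> A; rewrite /graph_direction; case: (split_ordP A) => k ->.
  rewrite row_mxEl mxE; under eq_fun do rewrite row_mxEl mxE mul0r.
  exact: cvg_right_cst.
rewrite row_mxEr mxE; under eq_fun do rewrite row_mxEr.
exact: lim_u.
Qed.

Lemma sum_direction (f : 'I_(2 + n) -> R) :
  \sum_A W A * f A = 4^-1 * \sum_be H be * f (Nu be).
Proof.
rewrite sum_TN big1 ?add0r => [|i _]; last by rewrite /graph_direction row_mxEl mxE mul0r.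
rewrite mulr_sumr; apply: eq_bigr => be _.
by rewrite /graph_direction row_mxEr mxE mulrA.
Qed.

(* [_jet2] marks the coefficient of r^2 along the curve r |-> (x, u(x, r), r). *)
Definition metric_jet2 : 'M[R]_(2 + n) :=
  \matrix_(A, C) (\sum_E W E * pd E (fun y => g y A C) p - P A C).
Notation G1 := metric_jet2.

Lemma jet_metric A C : jet (fun r => gt (F r) A C) (g p A C) (G1 A C).
Proof.
have := collar_metric_jet m_ge3 V_open eps_gt0 gt_metric gt_C3 g_plus_einstein
  (A := A) (B := C) Vp graph_offset_cvg.
by rewrite [X in jet _ _ X]mxE; under eq_fun do rewrite -graph_curve.
Qed.

Definition christoffel1_jet2 L A C : R := 2^-1 *
  ((\sum_E W E * pd E (pd A (fun y => g y C L)) p - pd A (fun y => schouten g y C L) p)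
   + (\sum_E W E * pd E (pd C (fun y => g y A L)) p - pd C (fun y => schouten g y A L) p)
   - (\sum_E W E * pd E (pd L (fun y => g y A C)) p - pd L (fun y => schouten g y A C) p)).

Lemma jet_pd_metric L A C : jet (fun r => pd (Tl L) (fun w => gt w A C) (F r))
  (pd L (fun y => g y A C) p)
  (\sum_E W E * pd E (pd L (fun y => g y A C)) p - pd L (fun y => schouten g y A C) p).
Proof.
have := collar_metric_pd_jet m_ge3 V_open eps_gt0 gt_metric gt_C3 g_plus_einstein
  (A := A) (B := C) (C := L) Vp graph_offset_cvg.
by under eq_fun do rewrite -graph_curve.
Qed.

Lemma jet_slice_christoffel1 L A C :
  jet (fun r => slice_christoffel1 gt (F r) L A C) (christoffel1 g p L A C)
    (christoffel1_jet2 L A C).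
Proof.
by apply: jetZ; apply: jetB; [apply: jetD|]; exact: jet_pd_metric.
Qed.

Lemma lin_dr_metric A C : (fun r => dr_metric gt (F r) A C / r) @ 0^'+ --> - 2 * P A C.
Proof.
have := collar_dr_metric_jet m_ge3 V_open eps_gt0 gt_metric gt_C3 g_plus_einstein
  (A := A) (B := C) Vp graph_offset_cvg.
by under eq_fun do rewrite -graph_curve.
Qed.

Definition ginv_jet2 A L : R :=
  - \sum_C \sum_E invmx (g p) A C * G1 C E * invmx (g p) E L.

Lemma jet_ginv A L : jet (fun r => invmx (gt (F r)) A L) (invmx (g p) A L) (ginv_jet2 A L).
Proof. exact: (@invmx_jet R _ _ _ _ (gunit Vp) jet_metric A L). Qed.

Lemma lin_shape_op A C : (fun r => shape_op gt (F r) A C / r) @ 0^'+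
  --> - 2 * \sum_L invmx (g p) A L * P C L.
Proof.
have -> : (fun r => shape_op gt (F r) A C / r) =
    fun r => \sum_L invmx (gt (F r)) A L * (dr_metric gt (F r) C L / r).
  by apply/funext => r; rewrite /shape_op mulr_suml; under eq_bigr do rewrite -mulrA.
have -> : - 2 * \sum_L invmx (g p) A L * P C L = \sum_L invmx (g p) A L * (- 2 * P C L).
  by rewrite mulr_sumr; apply: eq_bigr => L _; rewrite mulrCA.
apply: cvg_right_sum => L _; apply: cvg_rightM; last exact: lin_dr_metric.
exact: jet_cvg (@jet_ginv A L).
Qed.

Let ray_X : \forall r \near 0^'+, open_collar V eps (F r) /\ 0 < r.
Proof.
have := ray_in_collar delta_gt0 Bx; apply: filterS => r [Qr r0]; split=> //.
exact: Y_in_X.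
Qed.

Definition christoffel_jet2 A C E : R := \sum_L
  (ginv_jet2 A L * christoffel1 g p L C E + invmx (g p) A L * christoffel1_jet2 L C E).

Lemma jet_slice_christoffel A C E :
  jet (fun r => slice_christoffel gt (F r) A C E) (christoffel g p A C E) (christoffel_jet2 A C E).
Proof.
rewrite christoffelE; apply: jet_sum => L; apply: jetM; first exact: jet_ginv.
exact: jet_slice_christoffel1.
Qed.

(** The variation of the Levi-Civita connection under the metric variation -P, with its upper index
    lowered. [schouten_christoffelE] gives the tensorial form. *)
Definition schouten_christoffel L C E : R :=
  \sum_A christoffel g p A C E * P A L
  - 2^-1 * (pd C (fun y => schouten g y E L) p + pd E (fun y => schouten g y C L) p
            - pd L (fun y => schouten g y C E) p).

(* With the upper index lowered, the inverse metric need not be expanded. *)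
Lemma christoffel_jet2E A C E : christoffel_jet2 A C E =
  \sum_L W L * pd L (fun y => christoffel g y A C E) p
  + \sum_L invmx (g p) A L * schouten_christoffel L C E.
Proof.
(* For r > 0, lowering the index of the slice symbols gives the symbols of the first kind. Both
   sides have jets along the curve, and uniqueness equates their r^2 coefficients. *)
have low L : \sum_K (christoffel_jet2 K C E * g p K L + christoffel g p K C E * G1 K L)
    = christoffel1_jet2 L C E.
  have h : jet (fun r => slice_christoffel1 gt (F r) L C E)
      (\sum_K christoffel g p K C E * g p K L)
      (\sum_K (christoffel_jet2 K C E * g p K L + christoffel g p K C E * G1 K L)).
    apply: jet_near (jet_sum (fun K => jetM (@jet_slice_christoffel K C E) (@jet_metric K L))).
    apply: filterS ray_X => r [Xr _].
    rewrite /slice_christoffel.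
    have Xr' := open_collar_sub Xr.
    exact: (lower_raise (collar_unit gt_metric Xr') (collar_sym gt_metric Xr')).
  rewrite (christoffel_lower gsym gunit _ _ _ Vp) in h.
  exact: jet_unique h (@jet_slice_christoffel1 L C E).
have dlow K L : \sum_M (pd K (fun y => christoffel g y M C E) p * g p M L
     + christoffel g p M C E * pd K (fun y => g y M L) p) =
    pd K (fun y => christoffel1 g y L C E) p.
  have e : pd K (fun y => christoffel1 g y L C E) p =
      pd K (fun y => \sum_M christoffel g y M C E * g y M L) p.
    by apply: (pd_on _ V_open Vp) => y Vy; rewrite (christoffel_lower gsym gunit _ _ _ Vy).
  have CG M : Ck 1 V (fun y => christoffel g y M C E).
    by apply: Ck_S; exact: (Ck_christoffel V_open gC gunit).
  have Cg M : Ck 1 V (fun y => g y M L) by apply: Ck_S; apply: Ck_S.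
  rewrite e (pd_bigsum K V_open (fun M => CkM V_open (CG M) (Cg M)) Vp).
  by apply: eq_bigr => M _; rewrite (pd_mul K (CG M) (Cg M) Vp).
(* The same lowering identity differentiated in the direction [W] is subtracted. All terms with
   derivatives of g cancel, and what the metric contributes beyond the displacement, -P and its
   derivatives, remains. *)
have main L : \sum_K (christoffel_jet2 K C E
     - \sum_M W M * pd M (fun y => christoffel g y K C E) p) * g p K L
     = schouten_christoffel L C E.
  have c1E K : pd K (fun y => christoffel1 g y L C E) p =
      2^-1 * (pd K (pd C (fun y => g y E L)) p + pd K (pd E (fun y => g y C L)) p
              - pd K (pd L (fun y => g y C E)) p).
    have C2 J A' B' : Ck 1 V (pd J (fun y => g y A' B')) by apply: Ck_S; exact: Ck_pd.
    rewrite (pd_scale K _ (CkB V_open (CkD V_open (C2 C E L) (C2 E C L)) (C2 L C E)) Vp).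
    rewrite (pd_sub K (CkD V_open (C2 C E L) (C2 E C L)) (C2 L C E) Vp).
    by rewrite (pd_add K (C2 C E L) (C2 E C L) Vp).
  have c1W : \sum_K W K * pd K (fun y => christoffel1 g y L C E) p =
      2^-1 * (\sum_K W K * pd K (pd C (fun y => g y E L)) p
              + \sum_K W K * pd K (pd E (fun y => g y C L)) p
              - \sum_K W K * pd K (pd L (fun y => g y C E)) p).
    rewrite -big_split -sumrB mulr_sumr /=; apply: eq_bigr => K _; rewrite c1E.
    by move: (pd K _ p) (pd K _ p) (pd K _ p) => q1 q2 q3; ring.
  have eC : \sum_K christoffel_jet2 K C E * g p K L =
      christoffel1_jet2 L C E - \sum_K christoffel g p K C E * G1 K L.
    by rewrite -low big_split addrK.
  have eD : \sum_K (\sum_M W M * pd M (fun y => christoffel g y K C E) p) * g p K L =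
      \sum_M W M * pd M (fun y => christoffel1 g y L C E) p
      - \sum_K christoffel g p K C E * \sum_M W M * pd M (fun y => g y K L) p.
    under [X in _ = X - _]eq_bigr do rewrite -dlow big_split mulrDr /=.
    rewrite big_split /= [X in _ = _ + X - _](_ : _ =
      \sum_K christoffel g p K C E * \sum_M W M * pd M (fun y => g y K L) p); last first.
      under eq_bigr do rewrite mulr_sumr; rewrite exchange_big; apply: eq_bigr => K _.
      by rewrite mulr_sumr; apply: eq_bigr => M _; rewrite mulrCA.
    rewrite addrK; under [RHS]eq_bigr do rewrite mulr_sumr; rewrite exchange_big.
    by apply: eq_bigr => K _; rewrite mulr_suml; apply: eq_bigr => M _; rewrite mulrA.
  have eG : \sum_K christoffel g p K C E * G1 K L =
      \sum_K christoffel g p K C E * (\sum_M W M * pd M (fun y => g y K L) p)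
      - \sum_K christoffel g p K C E * P K L.
    by rewrite -sumrB; apply: eq_bigr => K _; rewrite mxE mulrBr.
  under eq_bigr do rewrite mulrBl.
  rewrite sumrB eC eD eG c1W /christoffel1_jet2 /schouten_christoffel.
  have alg (q1 q2 q3 q4 q5 t1 t2 t3 : R) :
    2^-1 * (q1 - t1 + (q2 - t2) - (q3 - t3)) - (q4 - q5)
      - (2^-1 * (q1 + q2 - q3) - q4) = q5 - 2^-1 * (t1 + t2 - t3) by ring.
  exact: alg.
have := raise_lower (gunit Vp) (gsym Vp) (fun K => christoffel_jet2 K C E
     - \sum_M W M * pd M (fun y => christoffel g y K C E) p) A.
under eq_bigr do rewrite main.
by move=> ->; rewrite addrC subrK.
Qed.

Notation dH i be := (pd i (fun y => Hvec g y 0 be) x).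

(** The expansion of the slice part of d_a F: [tangent0] is its value at r = 0, [tangent_jet2] the
    r^2 coefficient for a = x^i, and [tangent_r1] the linear coefficient for a = r, where d_r u is r
    H / 2 to leading order. *)
Definition tangent0 (a : 'I_(2 + 1)) A : R :=
  (row_mx (\row_i (a == Tl i)%:R) 0 : 'rV[R]_(2 + n)) 0 A.
Definition tangent_jet2 i A : R :=
  (row_mx 0 (\row_al (4^-1 * dH i al)) : 'rV[R]_(2 + n)) 0 A.
Definition tangent_r1 A : R := (row_mx 0 (2^-1 *: Hvec g x) : 'rV[R]_(2 + n)) 0 A.
Notation tau := tangent0.
Notation theta := tangent_jet2.
Notation eta := tangent_r1.

Lemma tangent0_tan i k : tau (Tl i) (T k) = (i == k)%:R.
Proof. by rewrite /tau row_mxEl mxE eq_lshift. Qed.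
Lemma tangent0_nor a be : tau a (Nu be) = 0.
Proof. by rewrite /tau row_mxEr mxE. Qed.
Lemma tangent0_r A : tau rs A = 0.
Proof.
rewrite /tau; case: (split_ordP A) => k ->; last by rewrite row_mxEr mxE.
by rewrite row_mxEl mxE /r_index eq_rlshift.
Qed.
Lemma tangent_jet2_tan i k : theta i (T k) = 0.
Proof. by rewrite /theta row_mxEl mxE. Qed.
Lemma tangent_jet2_nor i be : theta i (Nu be) = 4^-1 * dH i be.
Proof. by rewrite /theta row_mxEr mxE. Qed.
Lemma tangent_r1_tan k : eta (T k) = 0.
Proof. by rewrite /eta row_mxEl mxE. Qed.
Lemma tangent_r1_nor be : eta (Nu be) = 2^-1 * H be.
Proof. by rewrite /eta row_mxEr mxE. Qed.

Lemma jet_tangent i A :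
  jet (fun r => slice_tangent u (s r) (Tl i) 0 A) (tau (Tl i) A) (theta i A).
Proof.
case: (split_ordP A) => k ->.
  rewrite tangent0_tan tangent_jet2_tan.
  by under eq_fun do rewrite slice_tangent_tan eq_lshift; exact: jet_cst.
rewrite tangent0_nor tangent_jet2_nor; under eq_fun do rewrite slice_tangent_nor.
by apply: jet0E; exact: (@lim_uT k i).
Qed.

Lemma lin_tangent_r A : (fun r => slice_tangent u (s r) rs 0 A / r) @ 0^'+ --> eta A.
Proof.
case: (split_ordP A) => k ->.
  rewrite tangent_r1_tan; under eq_fun do
    rewrite slice_tangent_tan /r_index eq_rlshift mul0r.
  exact: cvg_right_cst.
by rewrite tangent_r1_nor; under eq_fun do rewrite slice_tangent_nor; exact: (@lim_ur k).
Qed.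

Lemma cvg_tangent a A : (fun r => slice_tangent u (s r) a 0 A) @ 0^'+ --> tau a A.
Proof.
case: (split_ordP a) => k ->; first exact: jet_cvg (@jet_tangent k A).
rewrite (ord1 k) -/(r_index 2) tangent0_r; exact: lin_cvg (@lin_tangent_r A).
Qed.

#[local] Opaque tangent0 tangent_jet2 tangent_r1.

Lemma sum_tangent0 (f : 'I_(2 + n) -> R) i : \sum_A f A * tau (Tl i) A = f (T i).
Proof.
rewrite sum_TN [X in _ + X]big1 ?addr0 => [|be _]; last by rewrite tangent0_nor mulr0.
by under eq_bigr do rewrite tangent0_tan; exact: sum_delta'.
Qed.

Lemma sum_tangent0_2 (f : 'I_(2 + n) -> 'I_(2 + n) -> R) i j :
  \sum_A \sum_C f A C * tau (Tl i) A * tau (Tl j) C = f (T i) (T j).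
Proof. exact: (bilinear_pick (sum_tangent0 ^~ i) (sum_tangent0 ^~ j)). Qed.

Lemma sum_tangent_r1 (f : 'I_(2 + n) -> R) : \sum_A f A * eta A = 2^-1 * \sum_be f (Nu be) * H be.
Proof.
rewrite sum_TN big1 ?add0r => [|i _]; last by rewrite tangent_r1_tan mulr0.
by rewrite mulr_sumr; apply: eq_bigr => be _; rewrite tangent_r1_nor mulrCA.
Qed.

Lemma sum_tangent_r1_2 (f : 'I_(2 + n) -> 'I_(2 + n) -> R) :
  \sum_A \sum_C f A C * eta A * eta C = 4^-1 * \sum_be \sum_c f (Nu be) (Nu c) * H be * H c.
Proof.
transitivity (\sum_A (2^-1 * \sum_c f A (Nu c) * H c) * eta A).
  apply: eq_bigr => A _; rewrite (sum_tangent_r1 (fun C => f A C * eta A)) -mulrA; congr (_ * _).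
  by rewrite mulr_suml; apply: eq_bigr => c _; rewrite mulrAC.
rewrite (sum_tangent_r1 (fun A => 2^-1 * \sum_c f A (Nu c) * H c)) mulr_sumr mulr_sumr.
apply: eq_bigr => be _; rewrite !mulr_sumr mulr_suml mulr_sumr; apply: eq_bigr => c _.
by move: (f _ _) (H _) (H _) => q1 q2 q3; field.
Qed.

Lemma sum_tangent_jet2 (g0 g1 : 'I_(2 + n) -> 'I_(2 + n) -> R) i j :
  \sum_A \sum_C ((g1 A C * tau (Tl i) A + g0 A C * theta i A) * tau (Tl j) C
     + g0 A C * tau (Tl i) A * theta j C) =
  g1 (T i) (T j) + \sum_be 4^-1 * dH i be * g0 (Nu be) (T j)
  + \sum_be 4^-1 * dH j be * g0 (T i) (Nu be).
Proof.
have E k f : \sum_A f A * theta k A = \sum_be 4^-1 * dH k be * f (Nu be).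
  rewrite sum_TN big1 ?add0r => [|l _]; last by rewrite tangent_jet2_tan mulr0.
  by apply: eq_bigr => be _; rewrite tangent_jet2_nor mulrC.
apply: etrans (bilinear_pick_jet _ _ (sum_tangent0 ^~ i) (sum_tangent0 ^~ j) g0 g1) _.
by apply: congr2; [apply: congr1|]; exact: E.
Qed.

Lemma jet_slice_form (G : R -> 'I_(2 + n) -> 'I_(2 + n) -> R) (g0 g1 : 'I_(2 + n) -> 'I_(2 + n) -> R) i j :
  (forall A C, jet (fun r => G r A C) (g0 A C) (g1 A C)) ->
  jet (fun r => slice_form u (G r) (s r) (Tl i) (Tl j)) (g0 (T i) (T j))
    (g1 (T i) (T j) + \sum_be 4^-1 * dH i be * g0 (Nu be) (T j)
     + \sum_be 4^-1 * dH j be * g0 (T i) (Nu be)).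
Proof.
move=> hG; rewrite -sum_tangent_jet2 -(sum_tangent0_2 g0).
exact: (jet_bilinear (G := fun A C r => G r A C) hG (@jet_tangent i) (@jet_tangent j)).
Qed.

Lemma jet_slice_form_rr (G : R -> 'I_(2 + n) -> 'I_(2 + n) -> R) (g0 : 'I_(2 + n) -> 'I_(2 + n) -> R) :
  (forall A C, (fun r => G r A C) @ 0^'+ --> g0 A C) ->
  jet (fun r => slice_form u (G r) (s r) rs rs) 0
    (4^-1 * \sum_be \sum_c g0 (Nu be) (Nu c) * H be * H c).
Proof.
move=> hG; rewrite -sum_tangent_r1_2.
exact: (jet_bilinear_lin (G := fun A C r => G r A C) hG lin_tangent_r lin_tangent_r).
Qed.

Lemma cvg_slice_form (G : R -> 'I_(2 + n) -> 'I_(2 + n) -> R) (g0 : 'I_(2 + n) -> 'I_(2 + n) -> R) a b :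
  (forall A C, (fun r => G r A C) @ 0^'+ --> g0 A C) ->
  (fun r => slice_form u (G r) (s r) a b) @ 0^'+ --> \sum_A \sum_C g0 A C * tau a A * tau b C.
Proof.
move=> hG.
exact: (cvg_bilinear (G := fun A C r => G r A C) hG (@cvg_tangent a) (@cvg_tangent b)).
Qed.

Lemma lin_slice_form (G : R -> 'I_(2 + n) -> 'I_(2 + n) -> R) (g0 : 'I_(2 + n) -> 'I_(2 + n) -> R) a b :
  (forall A C, (fun r => G r A C / r) @ 0^'+ --> g0 A C) ->
  (fun r => slice_form u (G r) (s r) a b / r) @ 0^'+ --> \sum_A \sum_C g0 A C * tau a A * tau b C.
Proof.
move=> hG.
exact: (lin_bilinear (G := fun A C r => G r A C) hG (@cvg_tangent a) (@cvg_tangent b)).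
Qed.

(** The vector d_r F has no slice component along x, and its normal components tend to zero. They
    meet a coefficient that is already O(r^2), either because g0 has no mixed entries or because d_i
    u is O(r^2), so the product is o(r^2). *)
Lemma jet_slice_form_Tr (G : R -> 'I_(2 + n) -> 'I_(2 + n) -> R) (g0 g1 : 'I_(2 + n) -> 'I_(2 + n) -> R) i :
  (forall A C, jet (fun r => G r A C) (g0 A C) (g1 A C)) ->
  (forall be, g0 (T i) (Nu be) = 0) ->
  jet (fun r => slice_form u (G r) (s r) (Tl i) rs) 0 0.
Proof.
move=> hG g00.
have Z : \sum_(A < 2 + n) \sum_(C < 2 + n) 0 = (0 : R) by rewrite big1// => A _; rewrite big1.
rewrite -[X in jet _ X]Z -[X in jet _ _ X]Z; apply: jet_sum => A; apply: jet_sum => C.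
case: (split_ordP C) => c ->.
  under eq_fun do rewrite slice_tangent_tan /r_index eq_rlshift mulr0.
  exact: jet_cst.
have h := jetM (@hG A (Nu c)) (@jet_tangent i A).
have h0 : g0 A (Nu c) * tau (Tl i) A = 0.
  case: (split_ordP A) => k ->; last by rewrite tangent0_nor mulr0.
  rewrite tangent0_tan; case: eqP => [<-|_]; last by rewrite mulr0.
  by rewrite g00 mul0r.
rewrite h0 in h.
have e := jet0_cvgM h (@cvg_tangent rs (Nu c)).
by rewrite tangent0_r mulr0 in e.
Qed.

Let Xs w : open_collar V eps w -> (gt w)^T = gt w.
Proof. by move=> /open_collar_sub; exact: collar_sym. Qed.

Let r_tanT i : r_tangent R (Tl i) = 0.
Proof. by rewrite /r_tangent /r_index eq_lrshift. Qed.
Let r_tanr : r_tangent R rs = 1.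
Proof. by rewrite /r_tangent eqxx. Qed.

(** The first fundamental form at order zero and, below, at order r^2. Adaptedness removes the mixed
    blocks at both orders; the rr entry is 1 + |d_r u|^2, with r^2 coefficient |H|^2 / 4. *)
Definition bar0 : 'M[R]_(2 + 1) := block_mx (sigma_metric g x) 0 0 1%:M.
Definition bar_jet2 : 'M[R]_(2 + 1) :=
  block_mx (ulsubmx G1) 0 0 (4^-1 * nor_inner g x (Hvec g x) (Hvec g x))%:M.

Lemma bar0_TT i j : bar0 (Tl i) (Tl j) = g p (T i) (T j).
Proof. by rewrite block_mxEul !mxE. Qed.
Lemma bar0_Tr i : bar0 (Tl i) rs = 0.
Proof. by rewrite block_mxEur mxE. Qed.
Lemma bar0_rT i : bar0 rs (Tl i) = 0.
Proof. by rewrite block_mxEdl mxE. Qed.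
Lemma bar0_rr : bar0 rs rs = 1.
Proof. by rewrite block_mxEdr mxE eqxx. Qed.
Lemma bar_jet2_TT i j : bar_jet2 (Tl i) (Tl j) = G1 (T i) (T j).
Proof. by rewrite block_mxEul !mxE. Qed.
Lemma bar_jet2_Tr i : bar_jet2 (Tl i) rs = 0.
Proof. by rewrite block_mxEur mxE. Qed.
Lemma bar_jet2_rT i : bar_jet2 rs (Tl i) = 0.
Proof. by rewrite block_mxEdl mxE. Qed.
Lemma bar_jet2_rr : bar_jet2 rs rs = 4^-1 * nor_inner g x (Hvec g x) (Hvec g x).
Proof. by rewrite block_mxEdr mxE eqxx mulr1n. Qed.

Lemma jet_bar_Tr i : jet (fun r => bar_form gt u (s r) (Tl i) rs) 0 0.
Proof.
under eq_fun do rewrite bar_formE r_tanT mul0r addr0.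
apply: (jet_slice_form_Tr (G := fun r => gt (F r)) jet_metric) => be.
exact: (adapted_TN adapted B_sub).
Qed.

Lemma jet_bar a b : jet (fun r => bar_form gt u (s r) a b) (bar0 a b) (bar_jet2 a b).
Proof.
case: (split_ordP a) => i ->; case: (split_ordP b) => j ->;
  rewrite ?(ord1 i) ?(ord1 j) -?/(r_index 2).
- have h := @jet_slice_form (fun r => gt (F r)) _ _ i j jet_metric.
  rewrite [X in _ + X]big1 ?addr0 in h => [|be _]; last first.
    by rewrite (adapted_TN adapted B_sub) ?mulr0.
  rewrite [X in _ + X]big1 ?addr0 in h => [|be _]; last first.
    by rewrite (adapted_NT gsym adapted B_sub) ?mulr0.
  rewrite bar0_TT bar_jet2_TT.
  by under eq_fun do rewrite bar_formE r_tanT mul0r addr0.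
- by rewrite bar0_Tr bar_jet2_Tr; exact: (@jet_bar_Tr i).
- rewrite bar0_rT bar_jet2_rT; apply: jet_near (@jet_bar_Tr j).
  by apply: filterS ray_X => r [Xr _]; have e := bar_form_sym Xs Xr; exact: (symE e (Tl j) rs).
- rewrite bar0_rr bar_jet2_rr; under eq_fun do rewrite bar_formE r_tanr mulr1.
  have h := jet_slice_form_rr (G := fun r => gt (F r)) (fun A C => jet_cvg (@jet_metric A C)).
  by have := jetD h (jet_cst 1); rewrite add0r addr0.
Qed.

Lemma bar0_unit : bar0 \in unitmx.
Proof. by rewrite block_diag_mx_unit unitmx1 andbT; exact: (sigma_metric_unit gsym gunit adapted B_sub). Qed.

Let ibar0 : invmx bar0 = block_mx (invmx (sigma_metric g x)) 0 0 1%:M.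
Proof. by rewrite invmx_block_diag ?invmx1//; exact: bar0_unit. Qed.

Definition ginv_tan_jet2 i j : R := - \sum_k \sum_l gi i k * G1 (T k) (T l) * gi l j.

Lemma jet_ibar_TT i j :
  jet (fun r => invmx (bar_form gt u (s r)) (Tl i) (Tl j)) (gi i j) (ginv_tan_jet2 i j).
Proof.
have := @invmx_jet R _ _ _ _ bar0_unit jet_bar (Tl i) (Tl j).
have eT k l : invmx bar0 (Tl k) (Tl l) = gi k l by rewrite ibar0 block_mxEul.
have er k : invmx bar0 (Tl k) rs = 0 by rewrite ibar0 block_mxEur mxE.
have er' k : invmx bar0 rs (Tl k) = 0 by rewrite ibar0 block_mxEdl mxE.
rewrite eT sum_Tr er [X in _ + X]big1 ?addr0 => [|b _]; last by rewrite !mul0r.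
rewrite /ginv_tan_jet2; congr (jet _ _ (- _)); apply: eq_bigr => k _.
rewrite sum_Tr er' mulr0 addr0; apply: eq_bigr => l _.
by rewrite !eT bar_jet2_TT.
Qed.

Lemma jet_ibar_rr : jet (fun r => invmx (bar_form gt u (s r)) rs rs) 1
  (- (4^-1 * nor_inner g x (Hvec g x) (Hvec g x))).
Proof.
have := @invmx_jet R _ _ _ _ bar0_unit jet_bar rs rs.
have err : invmx bar0 rs rs = 1 by rewrite ibar0 block_mxEdr mxE eqxx.
have er k : invmx bar0 rs (Tl k) = 0 by rewrite ibar0 block_mxEdl mxE.
have er' k : invmx bar0 (Tl k) rs = 0 by rewrite ibar0 block_mxEur mxE.
rewrite sum_Tr [X in - (X + _)]big1 ?add0r => [|k _]; last first.
  by rewrite big1// => b _; rewrite er !mul0r.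
rewrite sum_Tr [X in - (X + _)]big1 ?add0r => [|k _]; last by rewrite er' mulr0.
by rewrite !err bar_jet2_rr mulr1 mul1r.
Qed.

(** The coefficient can stay unnamed: in the traced equation this entry multiplies a mixed entry of
    [graph_term], which tends to zero. *)
Lemma jet_ibar_Tr i : exists d : R, jet (fun r => invmx (bar_form gt u (s r)) (Tl i) rs) 0 d.
Proof.
have := @invmx_jet R _ _ _ _ bar0_unit jet_bar (Tl i) rs.
by rewrite {1}ibar0 block_mxEur mxE => h; eexists; exact: h.
Qed.

Lemma jet_ibar_rT i : exists d : R, jet (fun r => invmx (bar_form gt u (s r)) rs (Tl i)) 0 d.
Proof.
have := @invmx_jet R _ _ _ _ bar0_unit jet_bar rs (Tl i).
by rewrite {1}ibar0 block_mxEdl mxE => h; eexists; exact: h.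
Qed.

#[local] Opaque bar_form slice_form.

Notation sform al := (fun r => slice_form u (slice_christoffel gt (F r) al) (s r)).
Notation dform := (fun r => slice_form u (dr_metric gt (F r)) (s r)).

Let cvg_sch A C E : (fun r => slice_christoffel gt (F r) A C E) @ 0^'+ --> christoffel g p A C E.
Proof. exact: jet_cvg (@jet_slice_christoffel A C E). Qed.

Definition graph_term_jet2 al i j : R :=
  4^-1 * pd i (pd j (fun y => Hvec g y 0 al)) x
  + (christoffel_jet2 (Nu al) (T i) (T j)
     + \sum_be 4^-1 * dH i be * christoffel g p (Nu al) (Nu be) (T j)
     + \sum_be 4^-1 * dH j be * christoffel g p (Nu al) (T i) (Nu be))
  - \sum_k 4^-1 * dH k al * christoffel g p (T k) (T i) (T j)
  + 2^-1 * (2^-1 * H al * (- 2 * P (T i) (T j))).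

Lemma jet_graph_term al i j :
  jet (fun r => graph_term gt u (s r) al (Tl i) (Tl j))
    (christoffel g p (Nu al) (T i) (T j)) (graph_term_jet2 al i j).
Proof.
have e : (fun r => graph_term gt u (s r) al (Tl i) (Tl j)) = fun r =>
   pd (Tl i) (pd (Tl j) (U al)) (s r) + sform (Nu al) r (Tl i) (Tl j)
   - \sum_k pd (Tl k) (U al) (s r) * sform (T k) r (Tl i) (Tl j)
   + 2^-1 * (pd rs (U al) (s r) * dform r (Tl i) (Tl j)).
  have alg (q1 q2 q3 q4 q5 q6 q7 : R) (f f1 f2 : 'I_2 -> R) :
      q1 + q2 - q3 + (q4 * 0 + q5 * 0) - \sum_k f k * (f1 k * 0 + f2 k * 0) + 2^-1 * q6 * q7
      = q1 + q2 - q3 + 2^-1 * (q6 * q7).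
    rewrite big1 => [|k _]; last by rewrite !mulr0 addr0 mulr0.
    ring.
  by apply/funext => r; rewrite /graph_term !r_tanT; exact: alg.
rewrite e.
have h1 : jet (fun r => pd (Tl i) (pd (Tl j) (U al)) (s r)) 0
    (4^-1 * pd i (pd j (fun y => Hvec g y 0 al)) x).
  by apply: jet0E; exact: (@lim_uTT al i j).
have h2 := @jet_slice_form (fun r => slice_christoffel gt (F r) (Nu al)) _ _ i j
   (@jet_slice_christoffel (Nu al)).
have h3 : jet (fun r => \sum_k pd (Tl k) (U al) (s r) * sform (T k) r (Tl i) (Tl j))
    (\sum_(k < 2) 0) (\sum_k 4^-1 * dH k al * christoffel g p (T k) (T i) (T j)).
  apply: jet_sum => k; apply: jet0_cvgM; first by apply: jet0E; exact: (@lim_uT al k).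
  have := @cvg_slice_form (fun r => slice_christoffel gt (F r) (T k)) _ (Tl i) (Tl j) (@cvg_sch (T k)).
  by rewrite sum_tangent0_2.
rewrite big1// in h3.
have h4 : jet (fun r => pd rs (U al) (s r) * dform r (Tl i) (Tl j)) 0
    (2^-1 * H al * (- 2 * P (T i) (T j))).
  apply: linM; first exact: (@lim_ur al).
  have := @lin_slice_form (fun r => dr_metric gt (F r)) _ (Tl i) (Tl j) (@lin_dr_metric).
  by rewrite (sum_tangent0_2 (fun A C => - 2 * P A C)).
have := jetD (jetB (jetD h1 h2) h3) (jetZ (c := 2^-1) h4).
by rewrite add0r subr0 mulr0 addr0.
Qed.

Let cvg_shape A a : (fun r => shape_tangent gt u (s r) A a) @ 0^'+ --> (0 : R).
Proof.
have Z : \sum_(E < 2 + n) 0 = (0 : R) by rewrite big1.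
rewrite -[X in _ --> X]Z; apply: cvg_right_sum => E _.
rewrite -[X in _ --> X](mul0r (tau a E)); apply: cvg_rightM; last exact: cvg_tangent.
by have := cvg_rightZ (c := 2^-1) (lin_cvg (@lin_shape_op A E)); rewrite mulr0.
Qed.

(** Limits suffice for the mixed and rr entries, since these are multiplied by entries of the
    inverse form minus the identity that are O(r^2). Whenever an index is r, the Christoffel sum in
    the limit vanishes. *)
Lemma cvg_graph_term al a b (d : R) :
  (fun r => pd a (pd b (U al)) (s r)) @ 0^'+ --> d ->
  (fun r => graph_term gt u (s r) al a b) @ 0^'+ -->
    d + \sum_A \sum_C christoffel g p (Nu al) A C * tau a A * tau b C.
Proof.
move=> hd.
have hT k : (fun r => pd (Tl k) (U al) (s r)) @ 0^'+ --> (0 : R).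
  exact: jet_cvg (jet0E (@lim_uT al k)).
have hS A := @cvg_slice_form (fun r => slice_christoffel gt (F r) A) _ a b (@cvg_sch A).
have hM A : (fun r => shape_tangent gt u (s r) A a * r_tangent R b
     + shape_tangent gt u (s r) A b * r_tangent R a) @ 0^'+ --> (0 : R).
  have := cvg_rightD (cvg_rightM (@cvg_shape A a) (@cvg_right_cst R (r_tangent R b)))
    (cvg_rightM (@cvg_shape A b) (@cvg_right_cst R (r_tangent R a))).
  by rewrite !mul0r addr0.
have h3 : (fun r => \sum_k pd (Tl k) (U al) (s r) * sform (T k) r a b) @ 0^'+ --> (0 : R).
  have := @cvg_right_sum R _ (index_enum 'I_2) predT _ _ (fun k _ => cvg_rightM (hT k) (hS (T k))).
  by rewrite big1// => k _; rewrite mul0r.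
have h5 : (fun r => \sum_k pd (Tl k) (U al) (s r) *
     (shape_tangent gt u (s r) (T k) a * r_tangent R b
     + shape_tangent gt u (s r) (T k) b * r_tangent R a)) @ 0^'+ --> (0 : R).
  have := @cvg_right_sum R _ (index_enum 'I_2) predT _ _ (fun k _ => cvg_rightM (hT k) (hM (T k))).
  by rewrite big1// => k _; rewrite mul0r.
have h6 : (fun r => 2^-1 * pd rs (U al) (s r) * dform r a b) @ 0^'+ --> (0 : R).
  have := cvg_rightM (cvg_rightZ (c := 2^-1) (lin_cvg (@lim_ur al)))
    (lin_cvg (@lin_slice_form (fun r => dr_metric gt (F r)) _ a b (@lin_dr_metric))).
  by rewrite mulr0.
have := cvg_rightD (cvg_rightB (cvg_rightD (cvg_rightB (cvg_rightD hd (hS (Nu al))) h3)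
  (hM (Nu al))) h5) h6.
by rewrite !subr0 !addr0.
Qed.

Definition graph_term_rr2 al : R :=
  4^-1 * \sum_be \sum_c christoffel g p (Nu al) (Nu be) (Nu c) * H be * H c
  - \sum_be (\sum_L invmx (g p) (Nu al) L * P (Nu be) L) * H be.

(** Half of the shape operator behaves like - r P with one index raised, and d_r u like r H / 2. The
    factor 2 counts the two mixed Christoffel symbols that enter symmetrically. *)
Lemma jet_shape_tangent_r A : jet (fun r => 2 * shape_tangent gt u (s r) A rs) 0
  (- \sum_be (\sum_L invmx (g p) A L * P (Nu be) L) * H be).
Proof.
have Z : \sum_(E < 2 + n) 0 = (0 : R) by rewrite big1.
have h : jet (fun r => shape_tangent gt u (s r) A rs) (\sum_(E < 2 + n) 0)
    (\sum_E 2^-1 * (- 2 * \sum_L invmx (g p) A L * P E L) * eta E).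
  apply: jet_sum => E; apply: linM; last exact: lin_tangent_r.
  by have := cvg_rightZ (c := 2^-1) (@lin_shape_op A E); under eq_fun do rewrite mulrA.
rewrite Z sum_tangent_r1 in h; have := jetZ (c := 2) h; rewrite mulr0.
rewrite [X in jet _ _ X -> _](_ : _ = - \sum_be (\sum_L invmx (g p) A L * P (Nu be) L) * H be)//.
rewrite mulrA mulfV ?mul1r; last by rewrite pnatr_eq0.
rewrite -sumrN; apply: eq_bigr => be _.
by move: (\sum_L _) (H be) => q1 q2; field.
Qed.

(** The second derivative u_rr contains 12 w_2 r^2 log r and so has no jet in general; it is removed
    here and joined with -3 u_r / r in [minimal_graph_limit]. *)
Lemma jet_graph_term_rr al :
  jet (fun r => graph_term gt u (s r) al rs rs - pd rs (pd rs (U al)) (s r)) 0 (graph_term_rr2 al).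
Proof.
have e : (fun r => graph_term gt u (s r) al rs rs - pd rs (pd rs (U al)) (s r)) = fun r =>
   sform (Nu al) r rs rs - \sum_k pd (Tl k) (U al) (s r) * sform (T k) r rs rs
   + 2 * shape_tangent gt u (s r) (Nu al) rs
   - \sum_k pd (Tl k) (U al) (s r) * (2 * shape_tangent gt u (s r) (T k) rs)
   + 2^-1 * (pd rs (U al) (s r) * dform r rs rs).
  have alg (q1 q2 q3 q4 q6 q7 : R) (f f1 : 'I_2 -> R) :
      q1 + q2 - q3 + (q4 * 1 + q4 * 1) - \sum_k f k * (f1 k * 1 + f1 k * 1) + 2^-1 * q6 * q7 - q1
      = q2 - q3 + 2 * q4 - \sum_k f k * (2 * f1 k) + 2^-1 * (q6 * q7).
    rewrite (eq_bigr (fun k => f k * (2 * f1 k))) => [|k _]; ring.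
  by apply/funext => r; rewrite /graph_term !r_tanr; exact: alg.
rewrite e.
have hT k : jet (fun r => pd (Tl k) (U al) (s r)) 0 (4^-1 * dH k al).
  by apply: jet0E; exact: (@lim_uT al k).
have sum0 (f : 'I_2 -> R -> R) : (forall k, f k @ 0^'+ --> (0 : R)) ->
    jet (fun r => \sum_k pd (Tl k) (U al) (s r) * f k r) 0 0.
  move=> hf; have := jet_sum (fun k => jet0_cvgM (hT k) (hf k)).
  by rewrite big1// big1// => k _; rewrite mulr0.
have hSc A := @jet_slice_form_rr (fun r => slice_christoffel gt (F r) A) _ (@cvg_sch A).
have h3 := sum0 _ (fun k => jet_cvg (hSc (T k))).
have h5 := sum0 _ (fun k => jet_cvg (@jet_shape_tangent_r (T k))).
have h6 : jet (fun r => pd rs (U al) (s r) * dform r rs rs) 0 0.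
  have := linM (@lim_ur al) (@lin_slice_form (fun r => dr_metric gt (F r)) _ rs rs (@lin_dr_metric)).
  rewrite [X in _ * X]big1 ?mulr0// => A _; apply: big1 => C _.
  by rewrite tangent0_r mulr0 mul0r.
have := jetD (jetB (jetD (jetB (hSc (Nu al)) h3) (@jet_shape_tangent_r (Nu al))) h5)
  (jetZ (c := 2^-1) h6).
by rewrite mulr0 !subr0 !addr0.
Qed.

Lemma minimal_graph_limit al :
  \sum_i \sum_j (ginv_tan_jet2 i j * christoffel g p (Nu al) (T i) (T j)
                 + gi i j * graph_term_jet2 al i j)
  - 8^-1 * nor_inner g x (Hvec g x) (Hvec g x) * H al + graph_term_rr2 al + 4 * w2 x 0 al = 0.
Proof.
pose inv r a b := invmx (bar_form gt u (s r)) a b.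
pose X r a b := graph_term gt u (s r) al a b.
(* The rr term is split as (inv_rr - 1) X_rr + (X_rr - u_rr) + (u_rr - 3 u_r / r), so that each
   summand has a jet. The first one yields - 1/4 |H|^2 times 1/2 H, the source of the coefficient
   1/8. *)
have eqn : \forall r \near 0^'+, \sum_i \sum_j inv r (Tl i) (Tl j) * X r (Tl i) (Tl j)
   + \sum_i inv r (Tl i) rs * X r (Tl i) rs + \sum_i inv r rs (Tl i) * X r rs (Tl i)
   + ((inv r rs rs - 1) * X r rs rs + (X r rs rs - pd rs (pd rs (U al)) (s r))
      + (pd rs (pd rs (U al)) (s r) - 3 * (pd rs (U al) (s r) / r))) = 0.
  near=> r.
  have [Xr r0] : open_collar V eps (F r) /\ 0 < r by near: r; exact: ray_X.
  have [Qr _] : Q (s r) /\ 0 < r by near: r; exact: ray_in_collar.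
  have ur : bar_form gt u (s r) \in unitmx by near: r; exact: (near_unitmx bar0_unit jet_bar).
  have Xpos w : open_collar V eps w -> 0 < r_coord w by move=> [_ /andP[]].
  have Xu w : open_collar V eps w -> gt w \in unitmx.
    by move=> /open_collar_sub; exact: collar_unit.
  have Xc A C : Ck 2 (open_collar V eps) (fun w => gt w A C).
    by apply: Ck_S; exact: open_collarC.
  have := minimal_graph_equation Xo Xpos Xc Xs Xu al Xr ur (Y_minimal Qr).
  rewrite at_rr sum_Tr; under eq_bigr do rewrite sum_Tr.
  rewrite big_split sum_Tr /= => e.
  have alg (q1 q2 q3 q4 q5 q6 q7 : R) : q1 + q2 + (q3 + q4 * q5) = q7 ->
     q1 + q2 + q3 + ((q4 - 1) * q5 + (q5 - q6) + (q6 - q7)) = 0 by move=> <-; ring.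
  exact: alg e.
have jTT : jet (fun r => \sum_i \sum_j inv r (Tl i) (Tl j) * X r (Tl i) (Tl j)) 
    (\sum_i \sum_j gi i j * christoffel g p (Nu al) (T i) (T j))
    (\sum_i \sum_j (ginv_tan_jet2 i j * christoffel g p (Nu al) (T i) (T j)
                 + gi i j * graph_term_jet2 al i j)).
  apply: jet_sum => i; apply: jet_sum => j.
  exact: jetM (@jet_ibar_TT i j) (@jet_graph_term al i j).
have Z (a b : 'I_(2 + 1)) : a = rs \/ b = rs ->
    \sum_A \sum_C christoffel g p (Nu al) A C * tau a A * tau b C = 0.
  by move=> h; apply: big1 => A _; apply: big1 => C _; case: h => ->; rewrite tangent0_r ?mulr0// mul0r.
have XTr i : (fun r => X r (Tl i) rs) @ 0^'+ --> (0 : R).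
  have := cvg_graph_term (lin_cvg (@lim_uTr al i)).
  by rewrite Z ?addr0//; right.
have XrT i : (fun r => X r rs (Tl i)) @ 0^'+ --> (0 : R).
  have := cvg_graph_term (lin_cvg (@lim_urT al i)).
  by rewrite Z ?addr0//; left.
have Xrr : (fun r => X r rs rs) @ 0^'+ --> 2^-1 * H al.
  have := cvg_graph_term (@lim_urr al).
  by rewrite Z ?addr0//; left.
have sum0 (f f' : 'I_2 -> R -> R) : (forall i, exists d : R, jet (f i) 0 d) ->
    (forall i, f' i @ 0^'+ --> (0 : R)) -> jet (fun r => \sum_i f i r * f' i r) 0 0.
  move=> /choice[d hd] hf; have := jet_sum (fun k => jet0_cvgM (hd k) (hf k)).
  by rewrite big1// big1// => k _; rewrite mulr0.
have jTr := sum0 _ _ jet_ibar_Tr XTr.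
have jrT := sum0 _ _ jet_ibar_rT XrT.
have jrr : jet (fun r => inv r rs rs - 1) 0 (- (4^-1 * nor_inner g x (Hvec g x) (Hvec g x))).
  by have := jetB jet_ibar_rr (jet_cst 1); rewrite subrr subr0.
have jU : jet (fun r => pd rs (pd rs (U al)) (s r) - 3 * (pd rs (U al) (s r) / r))
    (- H al) (4 * w2 x 0 al).
  by apply: jetI; under eq_fun do rewrite opprK; exact: (@lim_urrc al).
have := jet_zero eqn (jetD (jetD (jetD jTT jTr) jrT)
  (jetD (jetD (jet0_cvgM jrr Xrr) (@jet_graph_term_rr al)) jU)).
rewrite !addr0 => e; rewrite -[RHS]e.
move: (\sum_i _) (graph_term_rr2 al) (nor_inner _ _ _ _) (H al) (w2 x 0 al) => q1 q2 q3 q4 q5.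
by field.
Unshelve. all: by end_near. Qed.

(** * Identification of the r^2 coefficient with geometric quantities *)

Notation DP := (cov_deriv2 g (schouten g) p).
Notation A_ := (second_form g x).
Notation nrm := (nor_inner g x).

Let Csym A C E : christoffel g p A C E = christoffel g p A E C.
Proof. exact: (christoffel_sym V_open gsym). Qed.

Let AE i j al : A_ i j 0 al = christoffel g p (Nu al) (T i) (T j).
Proof. exact: (second_formE gsym gunit adapted B_sub). Qed.

(** The first variation of the induced metric: differentiating the orthogonality of the coordinate
    vectors along Sigma turns the normal derivative of g_kl into -2 times the lowered second
    fundamental form. *)
Lemma pd_metric_nor be k l :
  pd (Nu be) (fun y => g y (T k) (T l)) p = - 2 * christoffel1 g p (Nu be) (T k) (T l).
Proof.
have c1E i j : christoffel1 g p (T j) (Nu be) (T i) = - christoffel1 g p (Nu be) (T i) (T j).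
  have := metric_compat V_open gsym (T i) (T j) (Nu be) Vp.
  rewrite (pd_T_adapted adapted B_open B_sub)// (christoffel1_sym V_open gsym (T j) _ _ Vp).
  by move=> /esym/eqP; rewrite addrC addr_eq0 => /eqP.
rewrite (metric_compat V_open gsym _ _ _ Vp) !c1E (christoffel1_sym V_open gsym (Nu be) (T l) _ Vp).
by move: (christoffel1 _ _ _ _ _) => q; ring.
Qed.

Lemma nor_inner_second_form k l :
  nrm (A_ k l) (Hvec g x) = \sum_be H be * christoffel1 g p (Nu be) (T k) (T l).
Proof.
rewrite /nor_inner exchange_big; apply: eq_bigr => be _ /=.
rewrite -(christoffel_lower gsym gunit _ _ _ Vp) sum_TN [X in _ * (X + _)]big1 ?add0r => [|i _]; last first.
  by rewrite (adapted_TN adapted B_sub)// mulr0.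
rewrite mulr_sumr; apply: eq_bigr => c _; rewrite AE.
by move: (christoffel _ _ _ _ _) (g _ _ _) (H _) => q1 q2 q3; ring.
Qed.

(** Displacement by H / 4 contributes 1/4 times -2, and the change of slice contributes -P. *)
Lemma metric_jet2_tan k l :
  G1 (T k) (T l) = - (2^-1 * nrm (A_ k l) (Hvec g x) + P (T k) (T l)).
Proof.
rewrite mxE sum_direction opprD; congr (_ - _).
rewrite nor_inner_second_form !mulr_sumr -sumrN; apply: eq_bigr => be _.
by rewrite pd_metric_nor; move: (christoffel1 _ _ _ _ _) (H _) => q1 q2; field.
Qed.

(** In the Koszul combination of covariant derivatives the Christoffel corrections cancel in pairs,
    by symmetry of P and of the connection, except for two equal terms with upper index contracted
    against P. *)
Lemma schouten_christoffelE L C E :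
  schouten_christoffel L C E = - 2^-1 * (DP C E L + DP E C L - DP L C E).
Proof.
have Ps A A' : P A A' = P A' A.
  exact: (collar_schouten_sym m_ge3 V_open eps_gt0 gt_metric gt_C3 g_plus_einstein).
rewrite /schouten_christoffel /cov_deriv2.
have -> : \sum_A christoffel g p A C E * P A L = 2^-1 *
    (\sum_e (christoffel g p e C E * P e L + christoffel g p e C L * P E e)
     + \sum_e (christoffel g p e E C * P e L + christoffel g p e E L * P C e)
     - \sum_e (christoffel g p e L C * P e E + christoffel g p e L E * P C e)).
  rewrite -big_split -sumrB mulr_sumr; apply: eq_bigr => e _ /=.
  rewrite (Csym e E C) (Csym e L C) (Csym e L E) (Ps E e).
  move: (christoffel _ _ _ _ _) (christoffel _ _ _ _ _) (christoffel _ _ _ _ _) => q1 q2 q3.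
  by move: (P _ _) (P _ _) (P _ _) => t1 t2 t3; field.
have alg (q1 q2 q3 t1 t2 t3 : R) :
  2^-1 * (t1 + t2 - t3) - 2^-1 * (q1 + q2 - q3)
  = - 2^-1 * (q1 - t1 + (q2 - t2) - (q3 - t3)) by ring.
exact: alg.
Qed.

Let gis i j : gi i j = gi j i.
Proof. exact: (ginv_tan_sym gsym B_sub). Qed.

Notation PH al := (\sum_be \sum_c ginv_nor g x al c * P (Nu be) (Nu c) * H be).
Notation trP := (\sum_i \sum_j gi i j * P (T i) (T j)).
Notation DPt al := (\sum_c \sum_i \sum_j ginv_nor g x al c * gi i j *
   (DP (Nu c) (T i) (T j) - 2 * DP (T i) (T j) (Nu c))).
Notation AHA al := (\sum_i \sum_j \sum_k \sum_l
   gi i j * gi k l * nrm (A_ i k) (Hvec g x) * A_ j l 0 al).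
Notation PA al := (\sum_i \sum_j \sum_k \sum_l
   gi i k * gi j l * P (T k) (T l) * A_ i j 0 al).
Notation CHH al := (\sum_be \sum_c christoffel g p (Nu al) (Nu be) (Nu c) * H be * H c).

Lemma ginv_tan_jet2_trace al :
  \sum_i \sum_j ginv_tan_jet2 i j * christoffel g p (Nu al) (T i) (T j)
  = 2^-1 * AHA al + PA al.
Proof.
have -> : AHA al = \sum_i \sum_j \sum_k \sum_l
    gi i k * gi l j * nrm (A_ k l) (Hvec g x) * A_ i j 0 al.
  rewrite sum4_reindex; apply: eq_bigr => i _; apply: eq_bigr => j _.
  by apply: eq_bigr => k _; apply: eq_bigr => l _; rewrite (gis k i).
rewrite mulr_sumr -big_split; apply: eq_bigr => i _ /=.
rewrite mulr_sumr -big_split; apply: eq_bigr => j _ /=.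
rewrite /ginv_tan_jet2 mulNr mulr_suml -sumrN mulr_sumr -big_split; apply: eq_bigr => k _ /=.
rewrite mulr_suml -sumrN mulr_sumr -big_split; apply: eq_bigr => l _ /=.
rewrite metric_jet2_tan AE (gis j l).
by move: (nrm _ _) (P _ _) (christoffel _ _ _ _ _) (gi i k) (gi l j) => q1 q2 q3 q4 q5; field.
Qed.

Lemma graph_term_rr2E al : graph_term_rr2 al = 4^-1 * CHH al - PH al.
Proof.
congr (_ - _); apply: eq_bigr => be _; rewrite mulr_suml sum_TN big1 ?add0r => [|i _].
  by [].
by rewrite (ginv_NT gsym gunit adapted B_sub) ?mul0r.
Qed.

(** The first term comes from displacement by H / 4, the second from varying the connection by -P.
    Against the symmetric [gi] the two derivatives in tangential directions coincide, which explains
    the 2 inside [DPt]. *)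
Lemma christoffel_jet2_trace al :
  \sum_i \sum_j gi i j * christoffel_jet2 (Nu al) (T i) (T j) =
  4^-1 * \sum_i \sum_j gi i j * \sum_be H be * pd (Nu be) (fun y => christoffel g y (Nu al) (T i) (T j)) p
  + 2^-1 * DPt al.
Proof.
have E i j : christoffel_jet2 (Nu al) (T i) (T j) =
    4^-1 * \sum_be H be * pd (Nu be) (fun y => christoffel g y (Nu al) (T i) (T j)) p
    + 2^-1 * \sum_c ginv_nor g x al c *
        (DP (Nu c) (T i) (T j) - DP (T i) (T j) (Nu c) - DP (T j) (T i) (Nu c)).
  rewrite christoffel_jet2E sum_direction; congr (_ + _).
  rewrite sum_TN big1 ?add0r => [|k _]; last first.
    by rewrite (ginv_NT gsym gunit adapted B_sub) ?mul0r.
  rewrite mulr_sumr; apply: eq_bigr => c _; rewrite schouten_christoffelE -/(ginv_nor g x al c).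
  by move: (DP _ _ _) (DP _ _ _) (DP _ _ _) (ginv_nor _ _ _ _) => q1 q2 q3 q4; ring.
have -> : DPt al = \sum_i \sum_j gi i j * \sum_c ginv_nor g x al c *
        (DP (Nu c) (T i) (T j) - DP (T i) (T j) (Nu c) - DP (T j) (T i) (Nu c)).
  rewrite exchange_big; under eq_bigr do rewrite exchange_big.
  transitivity (\sum_i \sum_j gi i j * \sum_c ginv_nor g x al c * DP (Nu c) (T i) (T j)
    - \sum_i \sum_j gi i j * \sum_c ginv_nor g x al c * DP (T i) (T j) (Nu c)
    - \sum_i \sum_j gi i j * \sum_c ginv_nor g x al c * DP (T i) (T j) (Nu c)).
    rewrite -!sumrB; apply: eq_bigr => i _; rewrite -!sumrB; apply: eq_bigr => j _.
    rewrite -!mulrBr -!sumrB mulr_sumr; apply: eq_bigr => c _.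
    by move: (DP _ _ _) (DP _ _ _) (gi _ _) (ginv_nor _ _ _ _) => q1 q2 q3 q4; ring.
  rewrite [X in _ - _ - X](sum2_sym (fun i j => \sum_c ginv_nor g x al c * DP (T i) (T j) (Nu c)) gis).
  rewrite -!sumrB; apply: eq_bigr => i _; rewrite -!sumrB; apply: eq_bigr => j _.
  rewrite -!mulrBr -!sumrB; congr (_ * _); apply: eq_bigr => c _.
  by rewrite !mulrBr.
rewrite !mulr_sumr -big_split; apply: eq_bigr => i _ /=.
rewrite !mulr_sumr -big_split; apply: eq_bigr => j _ /=.
by rewrite E mulrDr mulrCA [gi i j * (2^-1 * _)]mulrCA.
Qed.

Lemma graph_term_jet2_trace al :
  \sum_i \sum_j gi i j * graph_term_jet2 al i j =
  4^-1 * (\sum_i \sum_j gi i j * (pd i (pd j (fun y => Hvec g y 0 al)) x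
     + 2 * (\sum_be christoffel g p (Nu al) (T i) (Nu be) * dH j be)
     - \sum_k christoffel g p (T k) (T i) (T j) * dH k al
     + \sum_be H be * pd (Nu be) (fun z => christoffel g z (Nu al) (T i) (T j)) p))
  + 2^-1 * DPt al - 2^-1 * trP * H al.
Proof.
pose D i j := \sum_be christoffel g p (Nu al) (T i) (Nu be) * dH j be.
pose K i j := \sum_k christoffel g p (T k) (T i) (T j) * dH k al.
pose dd i j := pd i (pd j (fun y => Hvec g y 0 al)) x.
rewrite -(trace_graph_term dd D K (fun i j => P (T i) (T j)) (H al) gis (christoffel_jet2_trace al)).
apply: eq_bigr => i _; apply: eq_bigr => j _; congr (_ * _).
have e1 : \sum_be 4^-1 * dH i be * christoffel g p (Nu al) (Nu be) (T j) = 4^-1 * D j i.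
  by rewrite mulr_sumr; apply: eq_bigr => be _; rewrite (Csym _ (Nu be)) -mulrA [dH i be * _]mulrC.
have e2 : \sum_be 4^-1 * dH j be * christoffel g p (Nu al) (T i) (Nu be) = 4^-1 * D i j.
  by rewrite mulr_sumr; apply: eq_bigr => be _; rewrite -mulrA [dH j be * _]mulrC.
have e3 : \sum_k 4^-1 * dH k al * christoffel g p (T k) (T i) (T j) = 4^-1 * K i j.
  by rewrite mulr_sumr; apply: eq_bigr => k _; rewrite -mulrA [dH k al * _]mulrC.
by rewrite /graph_term_jet2 e1 e2 e3.
Qed.

(** The normal Christoffel term quadratic in H, which comes from the rr entry, completes the left
    side of [jacobi_identity]. After multiplication by 4 the Schouten terms are -2 trace(P) H from
    d_r gt and -4 P(H) from the shape operator; splitting the curvature by [weyl_trace] gives back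
    half of each. *)
Lemma minimal_graph_w2 al : - 16 * w2 x 0 al =
  laplace_perp g (Hvec g) x 0 al + AHA al - 2^-1 * nrm (Hvec g x) (Hvec g x) * H al
  + (\sum_i \sum_j \sum_be \sum_c
       gi i j * ginv_nor g x al c * H be * weyl g p (T i) (Nu be) (T j) (Nu c))
  - 2 * PH al - trP * H al + 4 * PA al + 2 * DPt al.
Proof.
have main := minimal_graph_limit al.
have J := jacobi_identity V_open gC gsym gunit adapted B_open B_sub al Bx.
have We := weyl_trace V_open gC gsym gunit adapted B_sub al Bx.
rewrite sum2D ginv_tan_jet2_trace graph_term_jet2_trace graph_term_rr2E in main.
have alg (w la a nH h we cu ph tp pa dp jj ch : R) :
  2^-1 * a + pa + (4^-1 * jj + 2^-1 * dp - 2^-1 * tp * h) - 8^-1 * nH * h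
    + (4^-1 * ch - ph) + 4 * w = 0 ->
  jj + ch = la - a + cu -> we = cu - tp * h - 2 * ph ->
  - 16 * w = la + a - 2^-1 * nH * h + we - 2 * ph - tp * h + 4 * pa + 2 * dp.
  move=> e1 e2 ->; have -> : la = jj + ch + a - cu by rewrite e2; ring.
  rewrite (_ : w = - 4^-1 * (2^-1 * a + pa + (4^-1 * jj + 2^-1 * dp - 2^-1 * tp * h)
    - 8^-1 * nH * h + (4^-1 * ch - ph))); first by field.
  by rewrite mulNr; apply/eqP; rewrite -subr_eq0 opprK; apply/eqP; rewrite -[RHS](mulr0 4^-1) -e1; field.
exact: (alg _ _ _ _ _ _ _ _ _ _ _ _ _ main J We).
Qed.

End GraphLimit.

Theorem proposition3p6 (R : realType) (n : nat)
  (* a chart V of M^d, d = 2 + n, and the metric dr^2 + gt on V x [0, eps) *)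
  (V : set 'rV[R]_(2 + n)) (eps : R)
  (gt : 'rV[R]_(2 + n + 1) -> 'M[R]_(2 + n))
  (* Y = graph of u over B x (0, delta) *)
  (B : set 'rV[R]_2) (delta : R)
  (u : 'rV[R]_(2 + 1) -> 'rV[R]_n) (w2 u4 : 'rV[R]_2 -> 'rV[R]_n)
  (n_gt0 : (0 < n)%N)
  (V_open : open V) (eps_gt0 : 0 < eps)
  (gt_metric : is_metric_on (collar V eps) gt)
  (gt_C3 : forall a b, Ck_on 3 (collar V eps) (fun w => gt w a b))
  (g_plus_einstein :
     is_einstein_on (open_collar V eps) (- (2 + n)%:R) (g_plus gt))
  (chart_adapted : is_adapted V (boundary_metric gt))
  (B_open : open B) (B_sub_V : forall x, B x -> V (sigma_pt n x))
  (delta_gt0 : 0 < delta)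
  (Y_in_X : forall s, open_collar B delta s -> open_collar V eps (graph u s))
  (u_C2 : forall alpha, Ck 2 (open_collar B delta) (fun s => u s 0 alpha))
  (w2_C2 : forall alpha, Ck 2 B (fun x => w2 x 0 alpha))
  (u4_C2 : forall alpha, Ck 2 B (fun x => u4 x 0 alpha))
  (Y_minimal : is_minimal_on (open_collar B delta) (g_plus gt) (graph u))
  (u_asymptotics : forall x alpha, B x ->
     remainder_o 4
       (fun s => u s 0 alpha
                 - u_expansion (boundary_metric gt) w2 u4 s 0 alpha) x) :
  forall (x : 'rV[R]_2) (alpha : 'I_n), B x ->
    let g := boundary_metric gt in
    let p := sigma_pt n x in
    let gi := ginv_tan g x in
    let gn := ginv_nor g x in
    let A := second_form g x in
    let H := Hvec g x in
    let P := schouten g p in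
    let W := weyl g p in
    let DP := cov_deriv2 g (schouten g) p in
    let T := @tan_ix n in
    let N := @nor_ix n in
    - 16 * w2 x 0 alpha =
      laplace_perp g (Hvec g) x 0 alpha
      + (\sum_i \sum_j \sum_k \sum_l
           gi i j * gi k l * nor_inner g x (A i k) H * A j l 0 alpha)
      - 2^-1 * nor_inner g x H H * H 0 alpha
      + (\sum_i \sum_j \sum_beta \sum_gamma
           gi i j * gn alpha gamma * H 0 beta * W (T i) (N beta) (T j) (N gamma))
      - 2 * (\sum_beta \sum_gamma
           gn alpha gamma * P (N beta) (N gamma) * H 0 beta)
      - (\sum_i \sum_j gi i j * P (T i) (T j)) * H 0 alpha
      + 4 * (\sum_i \sum_j \sum_k \sum_l
           gi i k * gi j l * P (T k) (T l) * A i j 0 alpha)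
      + 2 * (\sum_gamma \sum_i \sum_j
           gn alpha gamma * gi i j *
             (DP (N gamma) (T i) (T j) - 2 * DP (T i) (T j) (N gamma))).

Proof.
move=> x alpha Bx /=.
apply: (minimal_graph_w2 n_gt0 V_open eps_gt0 gt_metric gt_C3 g_plus_einstein chart_adapted
  B_open B_sub_V delta_gt0 Y_in_X u_C2 w2_C2 u4_C2 Y_minimal _ Bx) => al.
have := u_asymptotics x al Bx; congr (remainder_o 4 _ x); apply/funext => s.
by rewrite /u_expansion /r_expansion !mxE.
Qed.
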